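(* Fix $r\in(0,2.01]$. There is $\beta_0>0$ such that for every $\beta\in(0,\beta_0)$ there are values $m=m(\beta)>0$, $M=M(\beta)>0$, $h=h(\beta)>1.6831$ and a solution $(\psi,A)$, defined on $[-m,M]$, of $$\psi''=\psi(\beta^2\psi^2+A^2-1),\qquad A''=r\beta^2\psi^2A,$$ $$\psi'(-m)=\psi'(M)=0,\qquad A'(-m)=A'(M)=h,\qquad \psi>0 \text{ on } [-m,M],$$ such that the following hold: (i) $\lim_{\beta\to0^+}m(\beta)=0$ and $\lim_{\beta\to0^+}M(\beta)=\infty$; (ii) $\psi'>0$ on $(-m,0)$, $\psi'(0)=0$ and $\psi(0)=1$; (iii) $\psi'<0$ on $(0,M)$; (iv) there is an $h^0>1.6831$ such that $A'(-m)\to h^0$ as $\beta\to0^+$.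
   Context: Primes denote derivatives with respect to the independent variable $t\in[-m,M]$. The parameter $r$ equals $1/k^2$, where $k$ is the Ginzburg-Landau material constant, fixed with $k\ge 1/\sqrt{2.01}$. The functions $\psi$ and $A$ (and $m,M,h$) depend on $\beta$. *)

(* Defs.v *)
From Stdlib Require Import Reals.
From Coquelicot Require Import Coquelicot.
Open Scope R_scope.

(* Derivatives are relative to the closed interval, hence one-sided at its
   endpoints; the values of [f] and [f'] outside [a, b] are irrelevant. *)
Definition deriv_on (a b : R) (f f' : R -> R) : Prop :=
  forall t : R, a <= t <= b -> D_in f f' (fun x => a <= x <= b) t.

(* [psi'] and [A'] are determined on [-m, M] by [GL_dpsi] and [GL_dA]
   as soon as - m < M. *)
Record GL_solution (r beta m M h : R) (psi psi' A A' : R -> R) : Prop := {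
  GL_dpsi : deriv_on (- m) M psi psi';
  GL_ddpsi : deriv_on (- m) M psi'
    (fun t => psi t * (beta ^ 2 * psi t ^ 2 + A t ^ 2 - 1));
  GL_dA : deriv_on (- m) M A A';
  GL_ddA : deriv_on (- m) M A' (fun t => r * beta ^ 2 * psi t ^ 2 * A t);
  GL_psi_left : psi' (- m) = 0;
  GL_psi_right : psi' M = 0;
  GL_A_left : A' (- m) = h;
  GL_A_right : A' M = h;
  GL_psi_pos : forall t : R, - m <= t <= M -> 0 < psi t
}.

(* Main.v *)
Require Import Defs.
From Stdlib Require Import Reals.
From Coquelicot Require Import Coquelicot.
From Stdlib Require Import ZArith Lra Lia Classical ClassicalEpsilon.
Open Scope R_scope.
Set Bullet Behavior "Strict Subproofs".

(* Shoot from the maximum of psi: psi(0) = 1, psi'(0) = 0, A(0) = beta - 1, A'(0) = b, with b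
   as the only shooting parameter. Since 1 - A(0)^2 is of order beta and dominates beta^2, going
   left psi' vanishes again at -m with m ~ 2 beta / b. The first integral
   A'^2/(r beta^2) - Y, where Y = psi^2 (A^2 - 1) + beta^2 psi^4/2 - psi'^2, turns the
   condition A'(M) = A'(-m) into Y(M) = Y(-m), and Y(-m) ~ 2 beta is small and positive. If psi
   reaches 0 then Y <= 0 there, so A' has stayed below A'(-m); if psi' reaches 0 early then Y is of
   order one, so A' has exceeded A'(-m) before. Both behaviours are open in b, hence some
   intermediate b has neither, and for it psi' = 0 and A' = A'(-m) hold simultaneously.

   For beta = 0 the problem is psi'' = ((b t - 1)^2 - 1) psi. A Wronskian in the variable
   (b t - 1) / sqrt b shows that there is a unique critical b = h0 separating the trajectories
   whose psi vanishes (b < h0) from those whose psi' vanishes (b > h0); this confines b to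
   any given neighbourhood of h0 for small beta. Finally h0 > 1.6831 because a polynomial trial
   function makes the quadratic form of the linear problem negative at b = 1.6831. *)

(** * Picard iteration *)

(** The clip makes every trajectory global. It is inactive while 0 <= psi <= 1, and each use of the
    first integral checks this condition. A trajectory that neither turns nor vanishes has no
    natural stopping time, so the shooting takes place on [0, T] with T at least of order 1/beta,
    and arriving at T counts as undershooting. This is consistent because a positive decreasing psi,
    driven by an A that grows at least linearly, decays at least like 1/T^3; hence Y(T) < beta <=
    Y(-m), and equality of A' cannot first occur at T. Strict inequalities such as psi' < 0 fail at
    t = 0, so the times up to 1/8 are covered by separate estimates and the open conditions start at
    1/8. The shooting parameter comes from connectedness alone, so nothing is known about its
    uniqueness or its continuity in beta. It is therefore selected as close to h0 as possible up to
    an error beta, and this selection gives (iv). *)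

Section Picard.

Variables (I : Type) (F : (I -> R) -> I -> R) (L C : R) (y0 : I -> R).
Hypothesis HL : 1 <= L.
Hypothesis HC : 0 <= C.
Hypothesis F_lip : forall (x y : I -> R) (d : R),
  (forall i, Rabs (x i - y i) <= d) -> forall i, Rabs (F x i - F y i) <= L * d.
Hypothesis F_y0 : forall i, Rabs (F y0 i) <= C.

Fixpoint picard (n : nat) (t : R) (i : I) : R :=
  match n with
  | O => y0 i
  | S k => y0 i + RInt (fun s => F (picard k s) i) 0 t
  end.

(** In the norm weighted by [exp (2 * L * Rabs t)], integration from 0 gains a factor 1/(2L).
    Against the Lipschitz constant L this leaves a contraction by 1/2 on the whole line, with no
    restriction to short times. Negative t is reduced to positive t by reflection. *)
Lemma RInt_exp_bound (f : R -> R) (K t : R) :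
  (forall s, continuous f s) ->
  (forall s, Rabs (f s) <= K * exp (2 * L * Rabs s)) ->
  Rabs (RInt f 0 t) <= K / (2 * L) * exp (2 * L * Rabs t).
Proof.
  intros Hf HK.
  assert (HK0 : 0 <= K).
  { specialize (HK 0). rewrite Rabs_R0, Rmult_0_r, exp_0 in HK.
    pose proof (Rabs_pos (f 0)). lra. }
  assert (key : forall g : R -> R, (forall s, continuous g s) ->
     (forall s, 0 <= s -> Rabs (g s) <= K * exp (2 * L * s)) ->
     forall u, 0 <= u -> Rabs (RInt g 0 u) <= K / (2 * L) * exp (2 * L * u)).
  { intros g Hg Hgb u Hu.
    assert (HI : is_RInt (fun s => K * exp (2 * L * s)) 0 u
                   (K / (2 * L) * exp (2 * L * u) - K / (2 * L) * exp (2 * L * 0))).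
    { apply (is_RInt_derive (V := R_CompleteNormedModule)
               (fun s => K / (2 * L) * exp (2 * L * s))).
      - intros x _. auto_derive; [easy | field; lra].
      - intros x _. apply (ex_derive_continuous (V := R_NormedModule)). auto_derive; easy. }
    apply Rle_trans with (K / (2 * L) * exp (2 * L * u) - K / (2 * L) * exp (2 * L * 0)).
    - apply (norm_RInt_le (V := R_NormedModule) g (fun s => K * exp (2 * L * s)) 0 u); try easy.
      + intros x Hx. apply Hgb; lra.
      + apply (RInt_correct (V := R_CompleteNormedModule)).
        apply (ex_RInt_continuous (V := R_CompleteNormedModule)). intros; apply Hg.
    - rewrite Rmult_0_r, exp_0.
      assert (0 <= K / (2 * L)) by (apply Rmult_le_pos; [lra | left; apply Rinv_0_lt_compat; lra]).
      pose proof (exp_pos (2 * L * u)). nra. }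
  destruct (Rle_lt_dec 0 t) as [Ht | Ht].
  - rewrite (Rabs_pos_eq t) by lra. apply key; auto.
    intros s Hs. rewrite <- (Rabs_pos_eq s) at 2 by lra. apply HK.
  - rewrite (Rabs_left t) by lra.
    replace (RInt f 0 t) with (- RInt (fun s => f (- s)) 0 (- t)).
    + rewrite Rabs_Ropp. apply key; try lra.
      * intros s. apply (continuous_comp (fun s => - s) f); [|apply Hf].
        apply (continuous_opp (V := R_NormedModule) (fun x => x)), continuous_id.
      * intros s Hs. rewrite <- (Rabs_pos_eq s) at 2 by lra.
        rewrite <- (Rabs_Ropp s). apply HK.
    + assert (H := RInt_comp_lin (V := R_CompleteNormedModule) f (-1) 0 0 (- t)).
      replace (-1 * 0 + 0) with 0 in H by ring. replace (-1 * - t + 0) with t in H by ring.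
      rewrite <- H.
      * rewrite <- (RInt_opp (V := R_CompleteNormedModule)).
        { apply (RInt_ext (V := R_CompleteNormedModule)). intros x _.
          unfold scal, opp; simpl. unfold mult; simpl.
          replace (-1 * x + 0) with (- x) by ring. ring. }
        apply (ex_RInt_continuous (V := R_CompleteNormedModule)). intros s _.
        apply (continuous_comp (fun s => - s) f); [|apply Hf].
        apply (continuous_opp (V := R_NormedModule) (fun x => x)), continuous_id.
      * apply (ex_RInt_continuous (V := R_CompleteNormedModule)). intros; apply Hf.
Qed.

Lemma RInt_minus_cont (f g : R -> R) (t : R) :
  (forall s, continuous f s) -> (forall s, continuous g s) ->
  RInt (fun s => f s - g s) 0 t = RInt f 0 t - RInt g 0 t.
Proof.
  intros Hf Hg.
  apply (RInt_minus (V := R_CompleteNormedModule) f g);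
    apply (ex_RInt_continuous (V := R_CompleteNormedModule)); intros; auto.
Qed.

(** Uniform in the coordinate, because [F_lip] takes one bound [d] for all coordinates. *)
Definition unif_cont_at (y : R -> I -> R) (t : R) : Prop :=
  forall eps : posreal, exists d : posreal, forall s, Rabs (s - t) < d ->
    forall i, Rabs (y s i - y t i) <= eps.

Lemma F_cont (y : R -> I -> R) :
  (forall t, unif_cont_at y t) -> forall i s, continuous (fun u => F (y u) i) s.
Proof.
  intros Hy i s. apply filterlim_locally. intros eps.
  assert (He : 0 < eps / (2 * L)).
  { apply Rdiv_lt_0_compat; [apply cond_pos | lra]. }
  destruct (Hy s (mkposreal _ He)) as [d Hd].
  exists d. intros u Hu. change (Rabs (F (y u) i - F (y s) i) < eps).
  apply Rle_lt_trans with (L * (eps / (2 * L))).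
  - apply F_lip. intros j. apply (Hd u Hu).
  - replace (L * (eps / (2 * L))) with (eps / 2) by (field; lra).
    pose proof (cond_pos eps). lra.
Qed.

Lemma RInt_lip (f : R -> R) (K s t : R) :
  (forall u, continuous f u) ->
  (forall u, Rmin s t <= u <= Rmax s t -> Rabs (f u) <= K) ->
  Rabs (RInt f 0 t - RInt f 0 s) <= K * Rabs (t - s).
Proof.
  intros Hf HK.
  assert (Hex : forall a b, ex_RInt f a b).
  { intros a b. apply (ex_RInt_continuous (V := R_CompleteNormedModule)). intros; apply Hf. }
  assert (HCh : RInt f 0 t - RInt f 0 s = RInt f s t).
  { rewrite <- (RInt_Chasles f 0 s t) by auto. unfold plus; simpl. ring. }
  rewrite HCh. clear HCh.
  assert (key : forall a b, a <= b -> (forall u, a <= u <= b -> Rabs (f u) <= K) ->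
            Rabs (RInt f a b) <= K * (b - a)).
  { intros a b Hab Hb. replace (K * (b - a)) with ((b - a) * K) by ring.
    apply (norm_RInt_le_const (V := R_NormedModule) f a b _ K Hab Hb).
    apply (RInt_correct (V := R_CompleteNormedModule)), Hex. }
  destruct (Rle_lt_dec s t) as [H | H].
  - rewrite (Rabs_pos_eq (t - s)) by lra. apply key; auto.
    intros u Hu. apply HK. unfold Rmin, Rmax. destruct (Rle_dec s t); lra.
  - rewrite (Rabs_left (t - s)) by lra.
    rewrite <- (opp_RInt_swap f) by auto.
    unfold opp; simpl. rewrite Rabs_Ropp.
    replace (- (t - s)) with (s - t) by ring. apply key; [lra|].
    intros u Hu. apply HK. unfold Rmin, Rmax. destruct (Rle_dec s t); lra.
Qed.

Definition weight (t : R) := exp (2 * L * Rabs t).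

Lemma weight_ge1 t : 1 <= weight t.
Proof.
  unfold weight. rewrite <- exp_0. destruct (Rle_lt_dec (2 * L * Rabs t) 0) as [H | H].
  - assert (0 <= 2 * L * Rabs t) by (pose proof (Rabs_pos t); nra).
    replace (2 * L * Rabs t) with 0 by lra. lra.
  - left. apply exp_increasing. lra.
Qed.

Lemma weight_mono s t : Rabs s <= Rabs t -> weight s <= weight t.
Proof.
  intros H. unfold weight. destruct H as [H | H].
  - left. apply exp_increasing. nra.
  - rewrite H. lra.
Qed.

(** The three claims feed each other: continuity makes the next integral meaningful, the growth
    bound (a partial geometric sum) makes the next iterate continuous, and the step bound sums to
    the growth bound. *)
Lemma picard_step n :
  (forall t, unif_cont_at (picard n) t) /\
  (forall t i, Rabs (picard n t i - y0 i) <= C * (1 - (/ 2) ^ n) * 2 * weight t) /\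
  (forall t i, Rabs (picard (S n) t i - picard n t i) <= C * (/ 2) ^ n * weight t).
Proof.
  induction n as [|n [IHc [IHb IHs]]].
  - assert (Hc : forall t, unif_cont_at (picard 0) t).
    { intros t eps. exists (mkposreal 1 Rlt_0_1). intros s _ i. simpl.
      rewrite Rminus_diag, Rabs_R0. left. apply cond_pos. }
    split; [exact Hc | split].
    + intros t i. simpl. rewrite Rminus_diag, Rabs_R0. pose proof (weight_ge1 t). nra.
    + intros t i. simpl picard.
      rewrite Rplus_minus_l.
      apply Rle_trans with (C / (2 * L) * exp (2 * L * Rabs t)).
      * apply RInt_exp_bound.
        { intros s. apply continuous_const. }
        intros s. change (exp (2 * L * Rabs s)) with (weight s).
        eapply Rle_trans; [apply F_y0|]. pose proof (weight_ge1 s). nra.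
      * simpl. unfold weight. pose proof (exp_pos (2 * L * Rabs t)).
        assert (C / (2 * L) <= C).
        { apply Rmult_le_reg_r with (2 * L); [lra|].
          replace (C / (2 * L) * (2 * L)) with C by (field; lra). nra. }
        nra.
  - assert (HFb : forall t i, Rabs (F (picard n t) i) <= (2 * L + 1) * C * weight t).
    { intros t i.
      replace (F (picard n t) i) with ((F (picard n t) i - F y0 i) + F y0 i) by ring.
      eapply Rle_trans; [apply Rabs_triang|].
      assert (Rabs (F (picard n t) i - F y0 i) <= L * (C * 2 * weight t)).
      { apply F_lip. intros j. eapply Rle_trans; [apply IHb|].
        pose proof (weight_ge1 t). assert (0 <= (/ 2) ^ n) by (apply pow_le; lra).
        assert (0 <= C * weight t) by nra. nra. }
      pose proof (F_y0 i). pose proof (weight_ge1 t). nra. }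
    assert (HFc : forall i s, continuous (fun u => F (picard n u) i) s) by (apply F_cont; auto).
    assert (Hc : forall t, unif_cont_at (picard (S n)) t).
    (* [K] bounds the integrand within distance 1 of t, so the next iterate is [K]-Lipschitz
       there. *)
    { intros t eps. set (K := (2 * L + 1) * C * weight (Rabs t + 1)).
      assert (HK : 0 <= K).
      { unfold K. pose proof (weight_ge1 (Rabs t + 1)). apply Rmult_le_pos; nra. }
      assert (Hd : 0 < Rmin 1 (eps / (K + 1))).
      { apply Rmin_glb_lt; [lra|]. apply Rdiv_lt_0_compat; [apply cond_pos | lra]. }
      exists (mkposreal _ Hd). intros s Hs i. simpl in Hs.
      assert (Hs1 : Rabs (s - t) < 1) by (eapply Rlt_le_trans; [exact Hs | apply Rmin_l]).
      assert (Hs2 : Rabs (s - t) < eps / (K + 1))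
        by (eapply Rlt_le_trans; [exact Hs | apply Rmin_r]).
      simpl picard.
      replace (y0 i + RInt (fun u => F (picard n u) i) 0 s -
               (y0 i + RInt (fun u => F (picard n u) i) 0 t))
        with (RInt (fun u => F (picard n u) i) 0 s - RInt (fun u => F (picard n u) i) 0 t) by ring.
      apply Rle_trans with (K * Rabs (s - t)).
      - apply RInt_lip; [apply HFc|]. intros u Hu.
        eapply Rle_trans; [apply HFb|]. unfold K.
        apply Rmult_le_compat_l; [nra|]. apply weight_mono.
        rewrite (Rabs_pos_eq (Rabs t + 1)) by (pose proof (Rabs_pos t); lra).
        unfold Rmin, Rmax in Hu. destruct (Rle_dec t s);
        unfold Rabs in *; repeat destruct Rcase_abs; lra.
      - apply Rmult_lt_compat_l with (r := K + 1) in Hs2; [|lra].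
        replace ((K + 1) * (eps / (K + 1))) with (pos eps) in Hs2 by (field; lra).
        pose proof (Rabs_pos (s - t)). nra. }
    split; [exact Hc | split].
    + intros t i. eapply Rle_trans.
      { replace (picard (S n) t i - y0 i)
          with ((picard (S n) t i - picard n t i) + (picard n t i - y0 i)) by ring.
        apply Rabs_triang. }
      specialize (IHs t i). specialize (IHb t i).
      replace (C * (1 - (/ 2) ^ S n) * 2 * weight t)
        with (C * (/ 2) ^ n * weight t + C * (1 - (/ 2) ^ n) * 2 * weight t) by (simpl; field).
      lra.
    + intros t i. change (picard (S (S n)) t i) with
        (y0 i + RInt (fun s => F (picard (S n) s) i) 0 t).
      change (picard (S n) t i) with (y0 i + RInt (fun s => F (picard n s) i) 0 t).
      assert (HFc' : forall i s, continuous (fun u => F (picard (S n) u) i) s)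
        by (apply F_cont; auto).
      assert (Hcancel : forall u v w : R, u + v - (u + w) = v - w) by (intros; ring).
      rewrite Hcancel, <- RInt_minus_cont by auto. clear Hcancel.
      replace (C * (/ 2) ^ S n * weight t)
        with ((L * (C * (/ 2) ^ n)) / (2 * L) * weight t) by (simpl; field; lra).
      eapply Rle_trans; [apply RInt_exp_bound with (K := L * (C * (/ 2) ^ n))|].
      * intros s. apply (continuous_minus (V := R_NormedModule)); [apply HFc' | apply HFc].
      * intros s. change (exp (2 * L * Rabs s)) with (weight s).
        replace (L * (C * (/ 2) ^ n) * weight s) with (L * (C * (/ 2) ^ n * weight s)) by ring.
        apply F_lip. intros j. apply IHs.
      * unfold weight. lra.
Qed.

Lemma picard_tail n k t i :
  Rabs (picard (n + k) t i - picard n t i) <= 2 * C * (/ 2) ^ n * weight t.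
Proof.
  assert (H : Rabs (picard (n + k) t i - picard n t i)
              <= 2 * C * (/ 2) ^ n * (1 - (/ 2) ^ k) * weight t).
  { induction k as [|k IH].
    - rewrite Nat.add_0_r, Rminus_diag, Rabs_R0. simpl. lra.
    - rewrite Nat.add_succ_r.
      replace (picard (S (n + k)) t i - picard n t i) with
        ((picard (S (n + k)) t i - picard (n + k) t i) + (picard (n + k) t i - picard n t i)) by ring.
      eapply Rle_trans; [apply Rabs_triang|].
      destruct (picard_step (n + k)) as [_ [_ Hs]]. specialize (Hs t i).
      rewrite pow_add in Hs. simpl pow.
      replace (2 * C * (/ 2) ^ n * (1 - / 2 * (/ 2) ^ k) * weight t)
        with (C * ((/ 2) ^ n * (/ 2) ^ k) * weight t
              + 2 * C * (/ 2) ^ n * (1 - (/ 2) ^ k) * weight t) by field.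
      lra. }
  eapply Rle_trans; [exact H|].
  pose proof (weight_ge1 t).
  assert (0 <= (/ 2) ^ n) by (apply pow_le; lra).
  assert (0 <= (/ 2) ^ k) by (apply pow_le; lra).
  assert (0 <= 2 * C * (/ 2) ^ n) by nra.
  assert (0 <= 2 * C * (/ 2) ^ n * weight t) by nra. nra.
Qed.

Lemma geometric_small (K : R) (eps : posreal) :
  0 <= K -> exists n, forall m, (n <= m)%nat -> K * (/ 2) ^ m < eps.
Proof.
  intros HK.
  assert (He : 0 < eps / (K + 1)) by (apply Rdiv_lt_0_compat; [apply cond_pos | lra]).
  destruct (pow_lt_1_zero (/ 2)) with (y := eps / (K + 1)) as [n Hn];
    [rewrite Rabs_pos_eq; lra | exact He |].
  exists n. intros m Hm. specialize (Hn m Hm).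
  assert (0 < (/ 2) ^ m) by (apply pow_lt; lra).
  rewrite Rabs_pos_eq in Hn by lra.
  apply Rmult_lt_compat_l with (r := K + 1) in Hn; [|lra].
  replace ((K + 1) * (eps / (K + 1))) with (pos eps) in Hn by (field; lra). nra.
Qed.

Lemma picard_limit t i : exists l, is_lim_seq (fun n => picard n t i) (Finite l).
Proof.
  apply ex_lim_seq_cauchy_corr.
  intros eps.
  pose proof (weight_ge1 t).
  destruct (geometric_small (4 * C * weight t) eps) as [N HN]; [nra|].
  exists N. intros n m Hn Hm. specialize (HN N (Nat.le_refl _)).
  assert (Hn' := picard_tail N (n - N) t i). assert (Hm' := picard_tail N (m - N) t i).
  replace (N + (n - N))%nat with n in Hn' by lia.
  replace (N + (m - N))%nat with m in Hm' by lia.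
  replace (picard n t i - picard m t i) with
    ((picard n t i - picard N t i) - (picard m t i - picard N t i)) by ring.
  eapply Rle_lt_trans; [apply Rabs_triang|]. rewrite Rabs_Ropp. lra.
Qed.

Theorem picard_lindelof :
  exists y : R -> I -> R, (forall i, y 0 i = y0 i) /\
    forall t i, is_derive (fun s => y s i) t (F (y t) i).
Proof.
  pose (y := fun t i => real (Lim_seq (fun n => picard n t i))).
  assert (Hlim : forall t i, is_lim_seq (fun n => picard n t i) (Finite (y t i))).
  { intros t i. destruct (picard_limit t i) as [l Hl]. unfold y.
    rewrite (is_lim_seq_unique _ _ Hl). exact Hl. }
  assert (Hb : forall n t i, Rabs (y t i - picard n t i) <= 2 * C * (/ 2) ^ n * weight t).
  { intros n t i.
    assert (Hl : is_lim_seq (fun k => Rabs (picard (n + k) t i - picard n t i))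
                   (Finite (Rabs (y t i - picard n t i)))).
    { apply (is_lim_seq_abs _ (Finite (y t i - picard n t i))).
      apply is_lim_seq_minus'; [|apply is_lim_seq_const].
      apply (is_lim_seq_ext (fun k => picard (k + n) t i)).
      - intros k. f_equal. lia.
      - apply (is_lim_seq_incr_n (fun k => picard k t i)), Hlim. }
    refine (is_lim_seq_le _ _ (Finite _) (Finite _) (fun k => picard_tail n k t i) Hl _).
    apply is_lim_seq_const. }
  assert (Hyc : forall t, unif_cont_at y t).
  { intros t eps.
    assert (He : 0 < eps / 3) by (pose proof (cond_pos eps); lra).
    pose proof (weight_ge1 (Rabs t + 1)).
    destruct (geometric_small (2 * C * weight (Rabs t + 1)) (mkposreal _ He)) as [n Hn]; [nra|].
    specialize (Hn n (Nat.le_refl _)). simpl in Hn.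
    destruct (picard_step n) as [Hc _]. destruct (Hc t (mkposreal _ He)) as [d Hd].
    assert (Hd' : 0 < Rmin d 1) by (apply Rmin_glb_lt; [apply cond_pos | lra]).
    exists (mkposreal _ Hd'). intros s Hs i. simpl in Hs.
    assert (Hs1 : Rabs (s - t) < d) by (eapply Rlt_le_trans; [exact Hs | apply Rmin_l]).
    assert (Hs2 : Rabs (s - t) < 1) by (eapply Rlt_le_trans; [exact Hs | apply Rmin_r]).
    specialize (Hd s Hs1 i). simpl in Hd.
    assert (Hw : forall u, Rabs u <= Rabs t + 1 -> Rabs (y u i - picard n u i) <= eps / 3).
    { intros u Hu. eapply Rle_trans; [apply Hb|].
      assert (weight u <= weight (Rabs t + 1)).
      { apply weight_mono. rewrite (Rabs_pos_eq (Rabs t + 1)); [lra|].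
        pose proof (Rabs_pos t); lra. }
      assert (0 <= (/ 2) ^ n) by (apply pow_le; lra).
      assert (0 <= 2 * C * (/ 2) ^ n) by nra. nra. }
    assert (H1 := Hw s). assert (H2 := Hw t).
    assert (Hst : Rabs s <= Rabs t + 1).
    { replace s with ((s - t) + t) by ring. eapply Rle_trans; [apply Rabs_triang|]. lra. }
    specialize (H1 Hst). specialize (H2 ltac:(lra)).
    replace (y s i - y t i) with
      ((y s i - picard n s i) + (picard n s i - picard n t i) + - (y t i - picard n t i)) by ring.
    eapply Rle_trans; [apply Rabs_triang|]. rewrite Rabs_Ropp.
    eapply Rle_trans; [apply Rplus_le_compat_r, Rabs_triang|]. lra. }
  assert (HFc : forall i s, continuous (fun u => F (y u) i) s) by (apply F_cont; auto).
  (* Both sides are compared with iterate S n: the tail of the iteration and the integrated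
     Lipschitz error each contribute at most C 2^-n times the weight. *)
  assert (Hint : forall t i, y t i = y0 i + RInt (fun s => F (y s) i) 0 t).
  { intros t i. apply cond_eq. intros eps Heps.
    pose proof (weight_ge1 t).
    destruct (geometric_small (2 * (2 * C * weight t)) (mkposreal _ Heps)) as [n Hn]; [nra|].
    specialize (Hn n (Nat.le_refl _)). simpl in Hn.
    assert (HFn : forall i s, continuous (fun u => F (picard n u) i) s).
    { apply F_cont. apply (picard_step n). }
    assert (H1 := Hb (S n) t i).
    assert (H2 : Rabs (RInt (fun s => F (picard n s) i - F (y s) i) 0 t)
                 <= L * (2 * C * (/ 2) ^ n) / (2 * L) * exp (2 * L * Rabs t)).
    { apply RInt_exp_bound.
      - intros s. apply (continuous_minus (V := R_NormedModule)); [apply HFn | apply HFc].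
      - intros s. change (exp (2 * L * Rabs s)) with (weight s).
        replace (L * (2 * C * (/ 2) ^ n) * weight s) with (L * (2 * C * (/ 2) ^ n * weight s)) by ring.
        apply F_lip. intros j. rewrite Rabs_minus_sym. apply Hb. }
    rewrite RInt_minus_cont in H2 by auto.
    change (exp (2 * L * Rabs t)) with (weight t) in H2.
    replace (L * (2 * C * (/ 2) ^ n) / (2 * L) * weight t)
      with (C * (/ 2) ^ n * weight t) in H2 by (field; lra).
    simpl pow in H1.
    replace (y t i - (y0 i + RInt (fun s => F (y s) i) 0 t)) with
      ((y t i - picard (S n) t i)
       + (RInt (fun s => F (picard n s) i) 0 t - RInt (fun s => F (y s) i) 0 t))
      by (simpl; ring).
    eapply Rle_lt_trans; [apply Rabs_triang|].
    assert (0 <= (/ 2) ^ n) by (apply pow_le; lra).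
    assert (0 <= C * (/ 2) ^ n * weight t) by (apply Rmult_le_pos; nra).
    lra. }
  exists y. split.
  - intros i. rewrite Hint.
    rewrite (RInt_point (V := R_CompleteNormedModule)). unfold zero; simpl. ring.
  - intros t i.
    apply (is_derive_ext (fun t => y0 i + RInt (fun s => F (y s) i) 0 t)).
    { intros u. symmetry. apply Hint. }
    replace (F (y t) i) with (plus zero (F (y t) i)) by (unfold plus, zero; simpl; ring).
    apply (is_derive_plus (V := R_NormedModule)); [apply (is_derive_const (V := R_NormedModule))|].
    apply (is_derive_RInt (V := R_NormedModule) (fun s => F (y s) i) _ 0).
    + apply filter_forall. intros u. apply (RInt_correct (V := R_CompleteNormedModule)).
      apply (ex_RInt_continuous (V := R_CompleteNormedModule)); intros; apply HFc.
    + apply HFc.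
Qed.

End Picard.

(** * The clipped system *)

(** [auto_derive] leaves [Derive f x] for functions known only through an [is_derive] hypothesis;
    these terms are replaced by the known values. *)
Ltac derive_subst :=
  repeat match goal with
  | H : is_derive ?f ?x ?l |- _ =>
      try (replace (Derive (fun y : R => f y) x) with l
             by (symmetry; apply is_derive_unique; exact H));
      clear H
  end.

Ltac derive_tac :=
  auto_derive; [repeat match goal with |- _ /\ _ => split end;
     first [exact I | eexists; eassumption | idtac]
    | derive_subst; unfold Rminus; try ring].

(** * Monotonicity and Gronwall inequalities *)

Lemma mean_value (f f' : R -> R) (x y : R) :
  x < y -> (forall t, x <= t <= y -> is_derive f t (f' t)) ->
  exists c, f y - f x = f' c * (y - x) /\ x < c < y.
Proof.
  intros Hxy Hd. apply MVT_cor2; [exact Hxy|].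
  intros c Hc. apply is_derive_Reals, Hd, Hc.
Qed.

Lemma derive_nonneg_le (f f' : R -> R) (x y : R) :
  x <= y -> (forall t, x <= t <= y -> is_derive f t (f' t)) ->
  (forall t, x < t < y -> 0 <= f' t) -> f x <= f y.
Proof.
  intros [Hxy | ->] Hd Hp; [|lra].
  destruct (mean_value f f' x y Hxy Hd) as [c [Hc1 Hc2]].
  specialize (Hp c Hc2). nra.
Qed.

Lemma derive_pos_lt (f f' : R -> R) (x y : R) :
  x < y -> (forall t, x <= t <= y -> is_derive f t (f' t)) ->
  (forall t, x < t < y -> 0 < f' t) -> f x < f y.
Proof.
  intros Hxy Hd Hp.
  destruct (mean_value f f' x y Hxy Hd) as [c [Hc1 Hc2]].
  specialize (Hp c Hc2). nra.
Qed.

Lemma derive_nonpos_le (f f' : R -> R) (x y : R) :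
  x <= y -> (forall t, x <= t <= y -> is_derive f t (f' t)) ->
  (forall t, x < t < y -> f' t <= 0) -> f y <= f x.
Proof.
  intros [Hxy | ->] Hd Hp; [|lra].
  destruct (mean_value f f' x y Hxy Hd) as [c [Hc1 Hc2]].
  specialize (Hp c Hc2). nra.
Qed.

Lemma derive_neg_lt (f f' : R -> R) (x y : R) :
  x < y -> (forall t, x <= t <= y -> is_derive f t (f' t)) ->
  (forall t, x < t < y -> f' t < 0) -> f y < f x.
Proof.
  intros Hxy Hd Hp.
  destruct (mean_value f f' x y Hxy Hd) as [c [Hc1 Hc2]].
  specialize (Hp c Hc2). nra.
Qed.

(** f exp(-C t) is nonincreasing and f exp(C t) is nondecreasing. The second bound controls the past
    by the present: it treats negative times, and in [no_double_zero] it transports a zero back to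
    the start. *)
Lemma gronwall (f f' : R -> R) (C x y : R) :
  x <= y -> (forall t, x <= t <= y -> is_derive f t (f' t)) ->
  (forall t, x <= t <= y -> Rabs (f' t) <= C * f t) ->
  f y <= f x * exp (C * (y - x)) /\ f x <= f y * exp (C * (y - x)).
Proof.
  intros Hxy Hd Hb.
  assert (Hb' : forall t, x <= t <= y -> - (C * f t) <= f' t <= C * f t).
  { intros t Ht. apply Rabs_le_between, Hb, Ht. }
  split.
  - assert (H : f y * exp (- C * (y - x)) <= f x * exp (- C * (x - x))).
    { apply (derive_nonpos_le (fun t => f t * exp (- C * (t - x)))
               (fun t => (f' t - C * f t) * exp (- C * (t - x)))); [exact Hxy| |].
      - intros t Ht. specialize (Hd t Ht). derive_tac.
      - intros t Ht. specialize (Hb' t ltac:(lra)).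
        pose proof (exp_pos (- C * (t - x))). nra. }
    rewrite Rminus_diag, Rmult_0_r, exp_0, Rmult_1_r in H.
    replace (f y) with (f y * exp (- C * (y - x)) * exp (C * (y - x))).
    + apply Rmult_le_compat_r; [left; apply exp_pos | exact H].
    + rewrite Rmult_assoc, <- exp_plus.
      replace (- C * (y - x) + C * (y - x)) with 0 by ring. rewrite exp_0. ring.
  - assert (H : f x * exp (C * (x - x)) <= f y * exp (C * (y - x))).
    { apply (derive_nonneg_le (fun t => f t * exp (C * (t - x)))
               (fun t => (f' t + C * f t) * exp (C * (t - x)))); [exact Hxy| |].
      - intros t Ht. specialize (Hd t Ht). derive_tac.
      - intros t Ht. specialize (Hb' t ltac:(lra)).
        pose proof (exp_pos (C * (t - x))). nra. }
    rewrite Rminus_diag, Rmult_0_r, exp_0, Rmult_1_r in H. exact H.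
Qed.

Lemma gronwall_sym (f f' : R -> R) (C T : R) :
  (forall t, Rabs t < T -> is_derive f t (f' t)) ->
  (forall t, Rabs t < T -> Rabs (f' t) <= C * f t) ->
  forall t, Rabs t < T -> f t <= f 0 * exp (C * Rabs t).
Proof.
  intros Hd Hb t Ht.
  assert (Hin : forall s, Rmin 0 t <= s <= Rmax 0 t -> Rabs s < T).
  { intros s. unfold Rmin, Rmax. destruct (Rle_dec 0 t);
      unfold Rabs in *; destruct (Rcase_abs t), (Rcase_abs s); lra. }
  unfold Rmin, Rmax in Hin. destruct (Rle_dec 0 t) as [H | H].
  - rewrite (Rabs_pos_eq t) by lra. replace (C * t) with (C * (t - 0)) by ring.
    apply (gronwall f f' C 0 t); auto.
  - rewrite (Rabs_left t) by lra. replace (C * - t) with (C * (0 - t)) by ring.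
    apply (gronwall f f' C t 0); auto; lra.
Qed.

Definition clip (x : R) := Rmax 0 (Rmin 1 x).

Lemma clip_bounds x : 0 <= clip x <= 1.
Proof. unfold clip, Rmax, Rmin. destruct Rle_dec; destruct Rle_dec; lra. Qed.

Lemma clip_id x : 0 <= x <= 1 -> clip x = x.
Proof. intros H. unfold clip, Rmax, Rmin. destruct Rle_dec; destruct Rle_dec; lra. Qed.

Lemma clip_neg x : x <= 0 -> clip x = 0.
Proof. intros H. unfold clip, Rmax, Rmin. destruct Rle_dec; destruct Rle_dec; lra. Qed.

Lemma clip_pos x : 0 < x -> 0 < clip x.
Proof. intros H. unfold clip, Rmax, Rmin. destruct Rle_dec; destruct Rle_dec; lra. Qed.

Lemma clip_lip x y : Rabs (clip x - clip y) <= Rabs (x - y).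
Proof.
  unfold clip, Rmax, Rmin. repeat destruct Rle_dec; unfold Rabs; repeat destruct Rcase_abs; lra.
Qed.

Lemma clip_abs_le x : clip x <= Rabs x.
Proof. unfold clip, Rmax, Rmin, Rabs. repeat destruct Rle_dec; destruct Rcase_abs; lra. Qed.

(** Applied to A, this makes the field globally Lipschitz. With K = [field_bound T] the a priori
    bound [AB_bound] shows it inactive for |t| < T. *)
Definition trunc (K x : R) := Rmax (- K) (Rmin K x).

Lemma trunc_bound K x : 0 <= K -> Rabs (trunc K x) <= K.
Proof.
  intros. unfold trunc, Rmax, Rmin, Rabs. repeat destruct Rle_dec; destruct Rcase_abs; lra.
Qed.

Lemma trunc_abs_le K x : 0 <= K -> Rabs (trunc K x) <= Rabs x.
Proof.
  intros. unfold trunc, Rmax, Rmin, Rabs.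
  repeat destruct Rle_dec; repeat destruct Rcase_abs; lra.
Qed.

Lemma trunc_id K x : Rabs x <= K -> trunc K x = x.
Proof.
  unfold trunc, Rmax, Rmin, Rabs. repeat destruct Rle_dec; destruct Rcase_abs; lra.
Qed.

Lemma trunc_lip K x y : 0 <= K -> Rabs (trunc K x - trunc K y) <= Rabs (x - y).
Proof.
  intros. unfold trunc, Rmax, Rmin. repeat destruct Rle_dec; unfold Rabs;
    repeat destruct Rcase_abs; lra.
Qed.

(* [P, V, A, B] stand for psi, psi', A, A' and [k] for beta^2. Clipping psi to [0, 1] does not
   affect the solutions sought and rules out blow-up. *)
Record flow_on (D : R -> Prop) (r k a b : R) (P V A B : R -> R) : Prop := {
  flow_P0 : P 0 = 1;
  flow_V0 : V 0 = 0;
  flow_A0 : A 0 = a;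
  flow_B0 : B 0 = b;
  flow_dP : forall t, D t -> is_derive P t (V t);
  flow_dV : forall t, D t ->
    is_derive V t (clip (P t) * (k * clip (P t) ^ 2 + A t ^ 2 - 1));
  flow_dA : forall t, D t -> is_derive A t (B t);
  flow_dB : forall t, D t -> is_derive B t (r * k * clip (P t) ^ 2 * A t)
}.

Inductive coord := cP | cV | cA | cB.

Definition truncated_field (r k K : R) (x : coord -> R) (i : coord) : R :=
  match i with
  | cP => x cV
  | cV => clip (x cP) * (k * clip (x cP) ^ 2 + trunc K (x cA) ^ 2 - 1)
  | cA => x cB
  | cB => r * k * clip (x cP) ^ 2 * trunc K (x cA)
  end.

Lemma Rabs_mult_le x y a b : Rabs x <= a -> Rabs y <= b -> Rabs (x * y) <= a * b.
Proof.
  intros. rewrite Rabs_mult. apply Rmult_le_compat; auto using Rabs_pos.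
Qed.

(** Two values of the parameter are allowed, so that the same estimate yields the Lipschitz property
    (k = k') and the dependence on beta. *)
Lemma field_V_diff k k' c c' x x' K :
  0 <= k <= 1 -> 0 <= k' <= 1 -> 0 <= c <= 1 -> 0 <= c' <= 1 ->
  Rabs x <= K -> Rabs x' <= K ->
  Rabs (c * (k * c ^ 2 + x ^ 2 - 1) - c' * (k' * c' ^ 2 + x' ^ 2 - 1))
  <= Rabs (k - k') + (4 + K ^ 2) * Rabs (c - c') + 2 * K * Rabs (x - x').
Proof.
  intros Hk Hk' Hc Hc' Hx Hx'.
  replace (c * (k * c ^ 2 + x ^ 2 - 1) - c' * (k' * c' ^ 2 + x' ^ 2 - 1)) with
    (c' ^ 3 * (k - k') + (k * (c ^ 2 + c * c' + c' ^ 2) + x ^ 2 - 1) * (c - c')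
      + (c' * (x + x')) * (x - x')) by ring.
  assert (Hc3 : 0 <= c' ^ 3 <= 1) by (split; simpl; nra).
  assert (HK : 0 <= K) by (pose proof (Rabs_pos x); lra).
  assert (Hx2 : 0 <= x ^ 2 <= K ^ 2).
  { rewrite <- (pow2_abs x). pose proof (Rabs_pos x). split; nra. }
  eapply Rle_trans; [apply Rabs_triang|]. apply Rplus_le_compat.
  - eapply Rle_trans; [apply Rabs_triang|]. apply Rplus_le_compat.
    + rewrite <- (Rmult_1_l (Rabs (k - k'))).
      apply Rabs_mult_le; [rewrite Rabs_pos_eq; lra | lra].
    + apply Rabs_mult_le; [|lra]. apply Rabs_le.
      assert (0 <= c ^ 2 + c * c' + c' ^ 2 <= 3) by nra. nra.
  - apply Rabs_mult_le; [|lra]. apply Rabs_le.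
    apply Rabs_le_between in Hx. apply Rabs_le_between in Hx'. nra.
Qed.

Lemma field_B_diff k k' c c' x x' K :
  0 <= k <= 1 -> 0 <= k' <= 1 -> 0 <= c <= 1 -> 0 <= c' <= 1 ->
  Rabs x <= K -> Rabs x' <= K ->
  Rabs (k * c ^ 2 * x - k' * c' ^ 2 * x')
  <= K * Rabs (k - k') + 2 * K * Rabs (c - c') + Rabs (x - x').
Proof.
  intros Hk Hk' Hc Hc' Hx Hx'.
  replace (k * c ^ 2 * x - k' * c' ^ 2 * x') with
    ((c ^ 2 * x) * (k - k') + (k' * (c + c') * x) * (c - c') + (k' * c' ^ 2) * (x - x')) by ring.
  assert (HK : 0 <= K) by (pose proof (Rabs_pos x); lra).
  assert (0 <= c ^ 2 <= 1) by nra. assert (0 <= c' ^ 2 <= 1) by nra.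
  eapply Rle_trans; [apply Rabs_triang|]. apply Rplus_le_compat.
  - eapply Rle_trans; [apply Rabs_triang|]. apply Rplus_le_compat.
    + apply Rabs_mult_le; [|lra]. replace K with (1 * K) by ring.
      apply Rabs_mult_le; [rewrite Rabs_pos_eq; lra | lra].
    + apply Rabs_mult_le; [|lra].
      apply Rabs_mult_le; [rewrite Rabs_pos_eq; nra | lra].
  - rewrite <- (Rmult_1_l (Rabs (x - x'))).
    apply Rabs_mult_le; [rewrite Rabs_pos_eq; nra | lra].
Qed.

Lemma truncated_flow (r k a b K : R) :
  0 < r <= 2.01 -> 0 <= k <= 1 -> -1 <= a <= 0 -> 1 <= b <= 4 -> 1 <= K ->
  exists y : R -> coord -> R,
    (y 0 cP = 1 /\ y 0 cV = 0 /\ y 0 cA = a /\ y 0 cB = b) /\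
    forall t i, is_derive (fun s => y s i) t (truncated_field r k K (y t) i).
Proof.
  intros Hr Hk Ha Hb HK.
  pose (y0 := fun i => match i with cP => 1 | cV => 0 | cA => a | cB => b end).
  destruct (picard_lindelof coord (truncated_field r k K)
              (10 * K ^ 2) (10 * K ^ 2) y0) as [y [Hy0 Hy]].
  - nra.
  - nra.
  - intros x y d Hd i.
    assert (Hd0 : 0 <= d) by (eapply Rle_trans; [apply Rabs_pos | apply (Hd cP)]).
    assert (HKK : 1 <= K ^ 2) by nra.
    assert (HKK' : K <= K ^ 2) by nra.
    pose proof (clip_bounds (x cP)) as C1. pose proof (clip_bounds (y cP)) as C2.
    pose proof (trunc_bound K (x cA) ltac:(lra)) as T1.
    pose proof (trunc_bound K (y cA) ltac:(lra)) as T2.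
    assert (L1 : Rabs (clip (x cP) - clip (y cP)) <= d)
      by (eapply Rle_trans; [apply clip_lip | apply Hd]).
    assert (L2 : Rabs (trunc K (x cA) - trunc K (y cA)) <= d)
      by (eapply Rle_trans; [apply trunc_lip; lra | apply Hd]).
    destruct i; cbn [truncated_field].
    + specialize (Hd cV). nra.
    + eapply Rle_trans; [apply (field_V_diff k k _ _ _ _ K); auto|].
      rewrite Rminus_diag, Rabs_R0.
      assert (K * Rabs (trunc K (x cA) - trunc K (y cA)) <= K * d)
        by (apply Rmult_le_compat_l; lra).
      assert ((4 + K ^ 2) * Rabs (clip (x cP) - clip (y cP)) <= (4 + K ^ 2) * d)
        by (apply Rmult_le_compat_l; lra).
      assert (K * d <= K ^ 2 * d) by (apply Rmult_le_compat_r; lra).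
      assert (1 * d <= K ^ 2 * d) by (apply Rmult_le_compat_r; lra). lra.
    + specialize (Hd cB). nra.
    + replace (r * k * clip (x cP) ^ 2 * trunc K (x cA) - r * k * clip (y cP) ^ 2 * trunc K (y cA))
        with (r * (k * clip (x cP) ^ 2 * trunc K (x cA) - k * clip (y cP) ^ 2 * trunc K (y cA)))
        by ring.
      apply Rle_trans with (2.01 * (2 * K * d + d)).
      * apply Rabs_mult_le; [rewrite Rabs_pos_eq; lra|].
        eapply Rle_trans; [apply (field_B_diff k k _ _ _ _ K); auto|].
        rewrite Rminus_diag, Rabs_R0.
        assert (K * Rabs (clip (x cP) - clip (y cP)) <= K * d)
          by (apply Rmult_le_compat_l; lra). lra.
      * assert (K * d <= K ^ 2 * d) by (apply Rmult_le_compat_r; lra).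
        assert (1 * d <= K ^ 2 * d) by (apply Rmult_le_compat_r; lra). lra.
  - assert (HKK : 1 <= K ^ 2) by nra.
    assert (HKK' : K <= K ^ 2) by nra.
    pose proof (clip_bounds (y0 cP)) as C1.
    pose proof (trunc_bound K (y0 cA) ltac:(lra)) as T1.
    intros i. destruct i; cbn [truncated_field].
    + change (Rabs 0 <= 10 * K ^ 2). rewrite Rabs_R0. nra.
    + replace (10 * K ^ 2) with (1 * (10 * K ^ 2)) by ring.
      apply Rabs_mult_le; [rewrite Rabs_pos_eq; apply C1|].
      assert (0 <= clip (y0 cP) ^ 2 <= 1) by nra.
      assert (0 <= trunc K (y0 cA) ^ 2 <= K ^ 2).
      { rewrite <- (pow2_abs (trunc K (y0 cA))). pose proof (Rabs_pos (trunc K (y0 cA))). nra. }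
      apply Rabs_le. simpl in *. nra.
    + change (Rabs b <= 10 * K ^ 2). rewrite Rabs_pos_eq; nra.
    + apply Rle_trans with (2.01 * K); [|nra].
      apply Rabs_mult_le; [|exact T1].
      assert (0 <= clip (y0 cP) ^ 2 <= 1) by nra.
      assert (0 <= k * clip (y0 cP) ^ 2 <= 1) by nra.
      rewrite Rmult_assoc, Rabs_pos_eq; simpl in *; nra.
  - exists y. split; [|exact Hy].
    rewrite !Hy0. simpl. auto.
Qed.

Definition field_bound (T : R) := 5 * exp (2 * T).

Lemma field_bound_ge T : 0 <= T -> 1 <= field_bound T.
Proof.
  intros H. unfold field_bound. pose proof (exp_ineq1_le (2 * T)). lra.
Qed.

(** [g] is left abstract so that the bound applies to the truncated field as well as to the original
    one. Thanks to the clip it does not involve P. *)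
Lemma AB_bound (A B g : R -> R) (a b T : R) :
  A 0 = a -> B 0 = b -> -1 <= a <= 0 -> 1 <= b <= 4 ->
  (forall t, Rabs t < T -> is_derive A t (B t)) ->
  (forall t, Rabs t < T -> is_derive B t (g t)) ->
  (forall t, Rabs t < T -> Rabs (g t) <= 2.01 * Rabs (A t)) ->
  forall t, Rabs t < T ->
    Rabs (A t) <= field_bound (Rabs t) /\ Rabs (B t) <= field_bound (Rabs t).
Proof.
  intros HA0 HB0 Ha Hb HA HB Hg t Ht.
  assert (H : A t ^ 2 + B t ^ 2 <= (A 0 ^ 2 + B 0 ^ 2) * exp (4 * Rabs t)).
  { apply (gronwall_sym (fun t => A t ^ 2 + B t ^ 2)
             (fun t => 2 * A t * B t + 2 * B t * g t) 4 T); [| |exact Ht].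
    - intros s Hs. specialize (HA s Hs). specialize (HB s Hs).
      derive_tac.
    - intros s Hs. specialize (Hg s Hs).
      replace (2 * A s * B s + 2 * B s * g s) with (2 * B s * (A s + g s)) by ring.
      rewrite !Rabs_mult, (Rabs_pos_eq 2) by lra.
      pose proof (Rabs_triang (A s) (g s)).
      rewrite <- (pow2_abs (A s)), <- (pow2_abs (B s)).
      pose proof (Rabs_pos (A s)). pose proof (Rabs_pos (B s)).
      apply Rle_trans with (2 * Rabs (B s) * (3.01 * Rabs (A s))).
      + apply Rmult_le_compat_l; lra.
      + pose proof (pow2_ge_0 (Rabs (A s) - Rabs (B s))). nra. }
  rewrite HA0, HB0 in H.
  assert (He : exp (4 * Rabs t) = exp (2 * Rabs t) ^ 2).
  { simpl. rewrite Rmult_1_r, <- exp_plus. f_equal. ring. }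
  rewrite He in H. pose proof (exp_pos (2 * Rabs t)) as Hp. unfold field_bound.
  set (X := exp (2 * Rabs t)) in *.
  assert (H' : A t ^ 2 + B t ^ 2 <= (5 * X) ^ 2).
  { assert (0 <= X ^ 2) by nra. assert (a ^ 2 + b ^ 2 <= 25) by nra.
    replace ((5 * X) ^ 2) with (25 * X ^ 2) by ring. nra. }
  split; apply Rabs_le; pose proof (pow2_ge_0 (A t)); pose proof (pow2_ge_0 (B t)); split; nra.
Qed.

Lemma flow_AB_bound (D : R -> Prop) r k a b P V A B (T : R) :
  flow_on D r k a b P V A B -> (forall t, Rabs t < T -> D t) ->
  0 < r <= 2.01 -> 0 <= k <= 1 -> -1 <= a <= 0 -> 1 <= b <= 4 ->
  forall t, Rabs t < T ->
    Rabs (A t) <= field_bound (Rabs t) /\ Rabs (B t) <= field_bound (Rabs t).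
Proof.
  intros Hf HD Hr Hk Ha Hb.
  apply (AB_bound A B (fun t => r * k * clip (P t) ^ 2 * A t) a b T); auto.
  - apply Hf.
  - apply Hf.
  - intros; apply (flow_dA _ _ _ _ _ _ _ _ _ Hf); auto.
  - intros; apply (flow_dB _ _ _ _ _ _ _ _ _ Hf); auto.
  - intros t Ht. apply Rabs_mult_le; [|lra].
    pose proof (clip_bounds (P t)). assert (0 <= clip (P t) ^ 2 <= 1) by nra.
    assert (0 <= k * clip (P t) ^ 2 <= 1) by nra.
    rewrite Rmult_assoc, Rabs_pos_eq; nra.
Qed.

Lemma local_flow (r k a b T : R) :
  0 < r <= 2.01 -> 0 <= k <= 1 -> -1 <= a <= 0 -> 1 <= b <= 4 -> 0 <= T ->
  exists P V A B, flow_on (fun t => Rabs t < T) r k a b P V A B.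
Proof.
  intros Hr Hk Ha Hb HT.
  pose proof (field_bound_ge T HT) as HK.
  destruct (truncated_flow r k a b (field_bound T) Hr Hk Ha Hb HK)
    as [y [[HP [HV [HA HB]]] Hd]].
  assert (Hbd : forall t, Rabs t < T -> trunc (field_bound T) (y t cA) = y t cA).
  { intros t Ht. apply trunc_id. apply Rle_trans with (field_bound (Rabs t)).
    - apply (AB_bound (fun t => y t cA) (fun t => y t cB)
        (fun t => r * k * clip (y t cP) ^ 2 * trunc (field_bound T) (y t cA)) a b T); try assumption.
      + intros s _. apply (Hd s cA).
      + intros s _. apply (Hd s cB).
      + intros s _. apply Rabs_mult_le; [|apply trunc_abs_le; lra].
        pose proof (clip_bounds (y s cP)). assert (0 <= clip (y s cP) ^ 2 <= 1) by nra.
        assert (0 <= k * clip (y s cP) ^ 2 <= 1) by nra.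
        rewrite Rmult_assoc, Rabs_pos_eq; nra.
    - unfold field_bound. apply Rmult_le_compat_l; [lra|]. left. apply exp_increasing. lra. }
  exists (fun t => y t cP), (fun t => y t cV), (fun t => y t cA), (fun t => y t cB).
  split; try assumption; intros t Ht.
  - apply (Hd t cP).
  - assert (H := Hd t cV). simpl in H. rewrite Hbd in H by exact Ht. exact H.
  - apply (Hd t cA).
  - assert (H := Hd t cB). simpl in H. rewrite Hbd in H by exact Ht. exact H.
Qed.

(** The parameter enters as one more, constant, coordinate: a single Gronwall estimate then covers
    initial data and parameter. *)
Definition dist2 (k k' : R) (P V A B P' V' A' B' : R -> R) (t : R) : R :=
  (P t - P' t) ^ 2 + (V t - V' t) ^ 2 + (A t - A' t) ^ 2 + (B t - B' t) ^ 2 + (k - k') ^ 2.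

Lemma flow_dep (D : R -> Prop) r k a b P V A B k' a' b' P' V' A' B' (T : R) :
  flow_on D r k a b P V A B -> flow_on D r k' a' b' P' V' A' B' ->
  (forall t, Rabs t < T -> D t) ->
  0 < r <= 2.01 -> 0 <= k <= 1 -> -1 <= a <= 0 -> 1 <= b <= 4 ->
  0 <= k' <= 1 -> -1 <= a' <= 0 -> 1 <= b' <= 4 ->
  forall t, Rabs t < T ->
    dist2 k k' P V A B P' V' A' B' t
    <= ((a - a') ^ 2 + (b - b') ^ 2 + (k - k') ^ 2) * exp (60 * field_bound T ^ 2 * Rabs t).
Proof.
  intros Hf Hf' HD Hr Hk Ha Hb Hk' Ha' Hb' t Ht.
  assert (HT : 0 <= T) by (pose proof (Rabs_pos t); lra).
  pose proof (field_bound_ge T HT) as HK.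
  set (K := field_bound T) in *.
  assert (H0 : dist2 k k' P V A B P' V' A' B' 0 = (a - a') ^ 2 + (b - b') ^ 2 + (k - k') ^ 2).
  { destruct Hf, Hf'. unfold dist2. rewrite flow_P1, flow_V1, flow_A1, flow_B1,
      flow_P2, flow_V2, flow_A2, flow_B2. ring. }
  rewrite <- H0.
  apply (gronwall_sym (dist2 k k' P V A B P' V' A' B')
    (fun t => 2 * (P t - P' t) * (V t - V' t)
      + 2 * (V t - V' t) * (clip (P t) * (k * clip (P t) ^ 2 + A t ^ 2 - 1)
                            - clip (P' t) * (k' * clip (P' t) ^ 2 + A' t ^ 2 - 1))
      + 2 * (A t - A' t) * (B t - B' t)
      + 2 * (B t - B' t) * (r * k * clip (P t) ^ 2 * A t - r * k' * clip (P' t) ^ 2 * A' t))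
    (60 * K ^ 2) T); [| |exact Ht]; clear t Ht.
  - intros s Hs.
    destruct Hf as [_ _ _ _ d1 d2 d3 d4]. destruct Hf' as [_ _ _ _ d1' d2' d3' d4'].
    specialize (HD s Hs).
    specialize (d1 s HD). specialize (d2 s HD). specialize (d3 s HD). specialize (d4 s HD).
    specialize (d1' s HD). specialize (d2' s HD). specialize (d3' s HD). specialize (d4' s HD).
    unfold dist2. derive_tac.
  - intros s Hs.
    assert (HsT : field_bound (Rabs s) <= K).
    { unfold K, field_bound. apply Rmult_le_compat_l; [lra|]. left. apply exp_increasing. lra. }
    destruct (flow_AB_bound D r k a b P V A B T Hf HD Hr Hk Ha Hb s Hs) as [HA _].
    destruct (flow_AB_bound D r k' a' b' P' V' A' B' T Hf' HD Hr Hk' Ha' Hb' s Hs) as [HA' _].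
    assert (E1 := field_V_diff k k' (clip (P s)) (clip (P' s)) (A s) (A' s) K
      Hk Hk' (clip_bounds _) (clip_bounds _) ltac:(lra) ltac:(lra)).
    assert (E2 := field_B_diff k k' (clip (P s)) (clip (P' s)) (A s) (A' s) K
      Hk Hk' (clip_bounds _) (clip_bounds _) ltac:(lra) ltac:(lra)).
    replace (r * k * clip (P s) ^ 2 * A s - r * k' * clip (P' s) ^ 2 * A' s)
      with (r * (k * clip (P s) ^ 2 * A s - k' * clip (P' s) ^ 2 * A' s)) by ring.
    set (dv := clip (P s) * _ - _) in *. set (db := k * clip (P s) ^ 2 * A s - _) in *.
    assert (Hc := clip_lip (P s) (P' s)).
    unfold dist2.
    rewrite <- (pow2_abs (P s - P' s)), <- (pow2_abs (V s - V' s)), <- (pow2_abs (A s - A' s)),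
      <- (pow2_abs (B s - B' s)), <- (pow2_abs (k - k')).
    assert (Hdb : Rabs (r * db) <= 2.01 * Rabs db).
    { apply Rabs_mult_le; [rewrite Rabs_pos_eq; lra | lra]. }
    apply Rle_trans with (2 * Rabs (P s - P' s) * Rabs (V s - V' s)
      + 2 * Rabs (V s - V' s) * Rabs dv + 2 * Rabs (A s - A' s) * Rabs (B s - B' s)
      + 2 * Rabs (B s - B' s) * Rabs (r * db)).
    { eapply Rle_trans; [apply Rabs_triang|]. apply Rplus_le_compat;
        [|rewrite !Rabs_mult, (Rabs_pos_eq 2); lra].
      eapply Rle_trans; [apply Rabs_triang|]. apply Rplus_le_compat;
        [|rewrite !Rabs_mult, (Rabs_pos_eq 2); lra].
      eapply Rle_trans; [apply Rabs_triang|]. apply Rplus_le_compat;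
        rewrite !Rabs_mult, (Rabs_pos_eq 2); lra. }
    pose proof (Rabs_pos (P s - P' s)) as Q1. pose proof (Rabs_pos (V s - V' s)) as Q2.
    pose proof (Rabs_pos (A s - A' s)) as Q3. pose proof (Rabs_pos (B s - B' s)) as Q4.
    pose proof (Rabs_pos (k - k')) as Q5.
    set (p := Rabs (P s - P' s)) in *. set (v := Rabs (V s - V' s)) in *.
    set (x := Rabs (A s - A' s)) in *. set (y := Rabs (B s - B' s)) in *.
    set (kk := Rabs (k - k')) in *.
    assert (HK2 : K <= K ^ 2) by nra.
    assert (F1 : Rabs dv <= 5 * K ^ 2 * (p + x + kk)).
    { eapply Rle_trans; [exact E1|].
      assert ((4 + K ^ 2) * Rabs (clip (P s) - clip (P' s)) <= (4 + K ^ 2) * p)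
        by (apply Rmult_le_compat_l; lra).
      assert (K * x <= K ^ 2 * x) by (apply Rmult_le_compat_r; lra).
      assert (1 * p <= K ^ 2 * p) by (apply Rmult_le_compat_r; lra).
      assert (1 * kk <= K ^ 2 * kk) by (apply Rmult_le_compat_r; lra). nra. }
    assert (F2 : Rabs (r * db) <= 5 * K ^ 2 * (p + x + kk)).
    { eapply Rle_trans; [exact Hdb|].
      assert (K * Rabs (clip (P s) - clip (P' s)) <= K * p)
        by (apply Rmult_le_compat_l; lra).
      assert (K * p <= K ^ 2 * p) by (apply Rmult_le_compat_r; lra).
      assert (1 * x <= K ^ 2 * x) by (apply Rmult_le_compat_r; lra).
      assert (K * kk <= K ^ 2 * kk) by (apply Rmult_le_compat_r; lra). nra. }
    assert (G1 : v * Rabs dv <= v * (5 * K ^ 2 * (p + x + kk)))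
      by (apply Rmult_le_compat_l; lra).
    assert (G2 : y * Rabs (r * db) <= y * (5 * K ^ 2 * (p + x + kk)))
      by (apply Rmult_le_compat_l; lra).
    pose proof (pow2_ge_0 (v - p)). pose proof (pow2_ge_0 (v - x)).
    pose proof (pow2_ge_0 (v - kk)). pose proof (pow2_ge_0 (y - p)).
    pose proof (pow2_ge_0 (y - x)). pose proof (pow2_ge_0 (y - kk)).
    pose proof (pow2_ge_0 v). pose proof (pow2_ge_0 p). pose proof (pow2_ge_0 x).
    pose proof (pow2_ge_0 y). pose proof (pow2_ge_0 kk).
    assert (G3 : v * (p + x + kk) <= 2 * (p ^ 2 + v ^ 2 + x ^ 2 + y ^ 2 + kk ^ 2)) by lra.
    assert (G4 : y * (p + x + kk) <= 2 * (p ^ 2 + v ^ 2 + x ^ 2 + y ^ 2 + kk ^ 2)) by lra.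
    assert (G5 : 2 * p * v + 2 * x * y <= 2 * (p ^ 2 + v ^ 2 + x ^ 2 + y ^ 2 + kk ^ 2)) by lra.
    set (S := p ^ 2 + v ^ 2 + x ^ 2 + y ^ 2 + kk ^ 2) in *.
    assert (HS : 0 <= S) by (unfold S; lra).
    assert (G3' : K ^ 2 * (v * (p + x + kk)) <= K ^ 2 * (2 * S))
      by (apply Rmult_le_compat_l; lra).
    assert (G4' : K ^ 2 * (y * (p + x + kk)) <= K ^ 2 * (2 * S))
      by (apply Rmult_le_compat_l; lra).
    assert (1 * S <= K ^ 2 * S) by (apply Rmult_le_compat_r; lra).
    lra.
Qed.

(** * Existence, continuous dependence, first zeros *)

Lemma square_le_abs x y : 0 <= y -> x ^ 2 <= y ^ 2 -> Rabs x <= y.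
Proof.
  intros Hy H. rewrite <- (Rabs_pos_eq y Hy). apply Rsqr_le_abs_0.
  unfold Rsqr. simpl in H. lra.
Qed.

Lemma flow_unique (D : R -> Prop) r k a b P V A B P' V' A' B' (T : R) :
  flow_on D r k a b P V A B -> flow_on D r k a b P' V' A' B' ->
  (forall t, Rabs t < T -> D t) ->
  0 < r <= 2.01 -> 0 <= k <= 1 -> -1 <= a <= 0 -> 1 <= b <= 4 ->
  forall t, Rabs t < T -> P t = P' t /\ V t = V' t /\ A t = A' t /\ B t = B' t.
Proof.
  intros Hf Hf' HD Hr Hk Ha Hb t Ht.
  assert (H := flow_dep D r k a b P V A B k a b P' V' A' B' T Hf Hf' HD
    Hr Hk Ha Hb Hk Ha Hb t Ht).
  rewrite !Rminus_diag in H. unfold dist2 in H. rewrite Rminus_diag in H.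
  pose proof (pow2_ge_0 (P t - P' t)). pose proof (pow2_ge_0 (V t - V' t)).
  pose proof (pow2_ge_0 (A t - A' t)). pose proof (pow2_ge_0 (B t - B' t)).
  replace (0 ^ 2 + 0 ^ 2 + 0 ^ 2) with 0 in H by ring.
  rewrite Rmult_0_l in H. replace (0 ^ 2) with 0 in H by ring.
  assert (Hz : forall x y, (x - y) ^ 2 <= 0 -> x = y).
  { intros x y Hxy. assert (Rabs (x - y) <= 0) by (apply square_le_abs; lra).
    pose proof (Rabs_pos (x - y)). assert (Hxy0 : Rabs (x - y) = 0) by lra.
    apply Rabs_eq_0 in Hxy0. lra. }
  repeat split; apply Hz; lra.
Qed.

Lemma flow_restrict (D D' : R -> Prop) r k a b P V A B :
  flow_on D r k a b P V A B -> (forall t, D' t -> D t) -> flow_on D' r k a b P V A B.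
Proof.
  intros [H1 H2 H3 H4 H5 H6 H7 H8] HD. split; auto.
Qed.

(** Flows on |t| < n + 1 agree on overlaps by uniqueness. The value at t is read off the flow of
    index [N t], and near t it coincides with that one fixed flow, hence is differentiable. *)
Theorem global_flow (r k a b : R) :
  0 < r <= 2.01 -> 0 <= k <= 1 -> -1 <= a <= 0 -> 1 <= b <= 4 ->
  exists P V A B, flow_on (fun _ => True) r k a b P V A B.
Proof.
  intros Hr Hk Ha Hb.
  assert (Hloc : forall n : nat, exists Y : (R -> R) * (R -> R) * (R -> R) * (R -> R),
    let '(P, V, A, B) := Y in flow_on (fun t => Rabs t < INR n + 1) r k a b P V A B).
  { intros n. destruct (local_flow r k a b (INR n + 1) Hr Hk Ha Hb) as [P [V [A [B H]]]].
    - pose proof (pos_INR n). lra.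
    - exists (P, V, A, B). exact H. }
  apply choice in Hloc. destruct Hloc as [Y HY].
  pose (Pn := fun n => fst (fst (fst (Y n)))). pose (Vn := fun n => snd (fst (fst (Y n)))).
  pose (An := fun n => snd (fst (Y n))). pose (Bn := fun n => snd (Y n)).
  assert (Hn : forall n, flow_on (fun t => Rabs t < INR n + 1) r k a b (Pn n) (Vn n) (An n) (Bn n)).
  { intros n. specialize (HY n). unfold Pn, Vn, An, Bn.
    destruct (Y n) as [[[P V] A] B]. exact HY. }
  clear HY.
  pose (N := fun t : R => Z.to_nat (up (Rabs t))).
  assert (HN : forall t, Rabs t < INR (N t) + 1).
  { intros t. unfold N. destruct (archimed (Rabs t)) as [H1 _]. pose proof (Rabs_pos t).
    rewrite INR_IZR_INZ, Z2Nat.id; [lra|]. apply le_IZR. lra. }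
  assert (Hag : forall n m t, Rabs t < INR n + 1 -> Rabs t < INR m + 1 ->
     Pn n t = Pn m t /\ Vn n t = Vn m t /\ An n t = An m t /\ Bn n t = Bn m t).
  { intros n m t H1 H2.
    apply (flow_unique (fun t => Rabs t < Rmin (INR n + 1) (INR m + 1)) r k a b
      _ _ _ _ _ _ _ _ (Rmin (INR n + 1) (INR m + 1))); auto.
    - eapply flow_restrict; [apply Hn|]. intros s Hs. simpl in Hs.
      eapply Rlt_le_trans; [exact Hs | apply Rmin_l].
    - eapply flow_restrict; [apply Hn|]. intros s Hs. simpl in Hs.
      eapply Rlt_le_trans; [exact Hs | apply Rmin_r].
    - apply Rmin_glb_lt; auto. }
  assert (Hloc : forall t, locally t (fun s => Rabs s < INR (N t) + 1)).
  { intros t. assert (Hd : 0 < INR (N t) + 1 - Rabs t) by (specialize (HN t); lra).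
    exists (mkposreal _ Hd). intros s Hs. change (Rabs (s - t) < INR (N t) + 1 - Rabs t) in Hs.
    replace s with ((s - t) + t) by ring. eapply Rle_lt_trans; [apply Rabs_triang|]. lra. }
  exists (fun t => Pn (N t) t), (fun t => Vn (N t) t), (fun t => An (N t) t), (fun t => Bn (N t) t).
  split; try (apply Hn); intros t _.
  - apply (is_derive_ext_loc (Pn (N t))); [|apply (Hn (N t)), HN].
    generalize (Hloc t). apply filter_imp. intros s Hs. apply Hag; auto.
  - apply (is_derive_ext_loc (Vn (N t))); [|apply (Hn (N t)), HN].
    generalize (Hloc t). apply filter_imp. intros s Hs. apply Hag; auto.
  - apply (is_derive_ext_loc (An (N t))); [|apply (Hn (N t)), HN].
    generalize (Hloc t). apply filter_imp. intros s Hs. apply Hag; auto.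
  - apply (is_derive_ext_loc (Bn (N t))); [|apply (Hn (N t)), HN].
    generalize (Hloc t). apply filter_imp. intros s Hs. apply Hag; auto.
Qed.

(* [beta - 1] is the value of [A] at [0]: the defect [1 - A(0)^2] is of order
   [beta], hence dominates the nonlinear term [beta^2 psi^2]. *)
Definition family (r beta b : R) := flow_on (fun _ => True) r (beta ^ 2) (beta - 1) b.

(** [C] depends on T only, so all trajectories are compared at once, including with beta' = 0. The
    factor 36 = 6^2 absorbs the differences of the initial data and of beta^2. *)
Lemma family_dep (T : R) : 0 <= T ->
  exists C, 1 <= C /\
  forall r beta beta' b b' P V A B P' V' A' B',
  0 < r <= 2.01 -> 0 <= beta <= 1 -> 0 <= beta' <= 1 -> 1 <= b <= 4 -> 1 <= b' <= 4 ->
  family r beta b P V A B -> family r beta' b' P' V' A' B' ->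
  forall t, Rabs t <= T ->
    Rabs (P t - P' t) <= C * (Rabs (beta - beta') + Rabs (b - b')) /\
    Rabs (V t - V' t) <= C * (Rabs (beta - beta') + Rabs (b - b')) /\
    Rabs (A t - A' t) <= C * (Rabs (beta - beta') + Rabs (b - b')) /\
    Rabs (B t - B' t) <= C * (Rabs (beta - beta') + Rabs (b - b')).
Proof.
  intros HT. set (E := exp (60 * field_bound (T + 1) ^ 2 * T)).
  assert (HE : 1 <= E).
  { unfold E. pose proof (field_bound_ge (T + 1) ltac:(lra)).
    pose proof (exp_ineq1_le (60 * field_bound (T + 1) ^ 2 * T)).
    assert (0 <= 60 * field_bound (T + 1) ^ 2 * T) by (apply Rmult_le_pos; nra). lra. }
  exists (6 * E). split; [lra|].
  intros r beta beta' b b' P V A B P' V' A' B' Hr Hbe Hbe' Hb Hb' Hf Hf' t Ht.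
  assert (H := flow_dep _ r _ _ b P V A B _ _ b' P' V' A' B' (T + 1) Hf Hf'
    (fun _ _ => I) Hr ltac:(nra) ltac:(lra) Hb ltac:(nra) ltac:(lra) Hb' t ltac:(lra)).
  assert (H' : dist2 (beta ^ 2) (beta' ^ 2) P V A B P' V' A' B' t
    <= (6 * E * (Rabs (beta - beta') + Rabs (b - b'))) ^ 2).
  { eapply Rle_trans; [exact H|].
    apply Rle_trans with ((36 * (Rabs (beta - beta') + Rabs (b - b')) ^ 2) * (E * E)).
    2:{ right. ring. }
    pose proof (Rabs_pos (beta - beta')). pose proof (Rabs_pos (b - b')).
    apply Rmult_le_compat.
    - pose proof (pow2_ge_0 (beta - 1 - (beta' - 1))). pose proof (pow2_ge_0 (b - b')).
      pose proof (pow2_ge_0 (beta ^ 2 - beta' ^ 2)). lra.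
    - left; apply exp_pos.
    - replace ((beta ^ 2 - beta' ^ 2) ^ 2) with ((beta - beta') ^ 2 * (beta + beta') ^ 2) by ring.
      replace (beta - 1 - (beta' - 1)) with (beta - beta') by ring.
      rewrite <- (pow2_abs (beta - beta')), <- (pow2_abs (b - b')).
      assert ((beta + beta') ^ 2 <= 4) by nra.
      assert (Rabs (beta - beta') ^ 2 * (beta + beta') ^ 2 <= Rabs (beta - beta') ^ 2 * 4)
        by (apply Rmult_le_compat_l; nra).
      nra.
    - apply Rle_trans with E; [|nra]. unfold E.
      assert (Hm : 60 * field_bound (T + 1) ^ 2 * Rabs t <= 60 * field_bound (T + 1) ^ 2 * T).
      { apply Rmult_le_compat_l; [nra | exact Ht]. }
      destruct Hm as [Hm | Hm]; [left; apply exp_increasing, Hm | rewrite Hm; lra]. }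
  unfold dist2 in H'.
  pose proof (pow2_ge_0 (P t - P' t)). pose proof (pow2_ge_0 (V t - V' t)).
  pose proof (pow2_ge_0 (A t - A' t)). pose proof (pow2_ge_0 (B t - B' t)).
  pose proof (pow2_ge_0 (beta ^ 2 - beta' ^ 2)).
  pose proof (Rabs_pos (beta - beta')). pose proof (Rabs_pos (b - b')).
  assert (0 <= 6 * E * (Rabs (beta - beta') + Rabs (b - b'))) by (apply Rmult_le_pos; lra).
  repeat split; apply square_le_abs; lra.
Qed.

Lemma is_derive_continuity_pt (f : R -> R) (t l : R) : is_derive f t l -> continuity_pt f t.
Proof.
  intros H. apply derivable_continuous_pt. exists l. apply is_derive_Reals, H.
Qed.

Lemma continuity_pt_pos (f : R -> R) (t : R) :
  continuity_pt f t -> 0 < f t -> exists e, 0 < e /\ forall s, Rabs (s - t) < e -> 0 < f s.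
Proof.
  intros Hc Hp. destruct (Hc (f t) Hp) as [e [He H]]. exists e. split; [exact He|].
  intros s Hs. destruct (Req_dec s t) as [-> | Hne]; [exact Hp|].
  assert (Rabs (f s - f t) < f t).
  { apply H. split; [split; [exact I | congruence] | exact Hs]. }
  apply Rabs_lt_between in H0. lra.
Qed.

Lemma continuity_pt_neg (f : R -> R) (t : R) :
  continuity_pt f t -> f t < 0 -> exists e, 0 < e /\ forall s, Rabs (s - t) < e -> f s < 0.
Proof.
  intros Hc Hp.
  destruct (continuity_pt_pos (fun x => - f x) t) as [e [He H]]; [|lra|].
  - apply continuity_pt_opp, Hc.
  - exists e. split; [exact He|]. intros s Hs. specialize (H s Hs). lra.
Qed.

Lemma first_zero (f : R -> R) (x y : R) :
  x <= y -> (forall t, x <= t <= y -> continuity_pt f t) -> 0 < f x -> f y <= 0 ->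
  exists s, x < s <= y /\ f s = 0 /\ forall t, x <= t < s -> 0 < f t.
Proof.
  intros Hxy Hc Hx Hy.
  pose (S := fun s => x <= s <= y /\ forall t, x <= t <= s -> 0 < f t).
  destruct (completeness S) as [s [Hub Hlub]].
  - exists y. intros z [Hz _]. lra.
  - exists x. split; [lra|]. intros t Ht. replace t with x by lra. exact Hx.
  - assert (Hxs : x <= s).
    { apply Hub. split; [lra|]. intros t Ht. replace t with x by lra. exact Hx. }
    assert (Hsy : s <= y) by (apply Hlub; intros z [Hz _]; lra).
    assert (Hlt : forall t, x <= t < s -> 0 < f t).
    { intros t Ht. apply NNPP. intros Hn. assert (s <= t); [|lra].
      apply Hlub. intros z [Hz1 Hz2]. apply Rnot_lt_le. intros Hzt.
      apply Hn, Hz2. lra. }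
    assert (Hs0 : f s <= 0).
    { apply Rnot_lt_le. intros Hp.
      assert (Hsy' : s < y) by (destruct Hsy as [H | H]; [exact H | rewrite H in Hp; lra]).
      destruct (continuity_pt_pos f s (Hc s ltac:(lra)) Hp) as [e [He H]].
      assert (Hm : s + Rmin (e / 2) (y - s) <= s).
      { apply Hub. pose proof (Rmin_l (e / 2) (y - s)). pose proof (Rmin_r (e / 2) (y - s)).
        assert (0 < Rmin (e / 2) (y - s)) by (apply Rmin_glb_lt; lra).
        split; [lra|]. intros t Ht. destruct (Rlt_le_dec t s) as [Hts | Hts].
        - apply Hlt; lra.
        - apply H. rewrite Rabs_pos_eq; lra. }
      assert (0 < Rmin (e / 2) (y - s)) by (apply Rmin_glb_lt; lra). lra. }
    assert (Hs0' : 0 <= f s).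
    { apply Rnot_lt_le. intros Hp.
      destruct (continuity_pt_neg f s (Hc s ltac:(lra)) Hp) as [e [He H]].
      assert (x < s) by (destruct Hxs as [Hl | Hl]; [exact Hl | rewrite <- Hl in Hp; lra]).
      pose proof (Rmax_l x (s - e / 2)). pose proof (Rmax_r x (s - e / 2)).
      assert (Rmax x (s - e / 2) < s) by (apply Rmax_lub_lt; lra).
      specialize (H (Rmax x (s - e / 2))). specialize (Hlt (Rmax x (s - e / 2))).
      rewrite Rabs_left in H by lra. specialize (H ltac:(lra)). specialize (Hlt ltac:(lra)). lra. }
    exists s. split; [|split; [lra | exact Hlt]].
    split; [|exact Hsy]. destruct Hxs as [Hl | Hl]; [exact Hl|]. rewrite <- Hl in Hs0. lra.
Qed.

Definition open_in (b1 b2 : R) (U : R -> Prop) : Prop :=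
  forall b, b1 <= b <= b2 -> U b -> exists e, 0 < e /\
    forall b', b1 <= b' <= b2 -> Rabs (b' - b) < e -> U b'.

(** The supremum of U1 lies in neither open set. This is applied twice: to find the critical field
    at beta = 0 and to shoot at fixed beta. *)
Lemma interval_connected (b1 b2 : R) (U1 U2 : R -> Prop) :
  b1 <= b2 -> open_in b1 b2 U1 -> open_in b1 b2 U2 -> U1 b1 -> U2 b2 ->
  (forall b, b1 <= b <= b2 -> U1 b -> U2 b -> False) ->
  exists b, b1 <= b <= b2 /\ ~ U1 b /\ ~ U2 b.
Proof.
  intros H12 Ho1 Ho2 HU1 HU2 Hdis.
  destruct (completeness (fun b => b1 <= b <= b2 /\ U1 b)) as [c [Hub Hlub]].
  - exists b2. intros z [Hz _]. lra.
  - exists b1. split; [lra | exact HU1].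
  - assert (Hc : b1 <= c <= b2).
    { split; [apply Hub; split; [lra | exact HU1] | apply Hlub; intros z [Hz _]; lra]. }
    exists c. split; [exact Hc|]. split; intros HU.
    + destruct (Ho1 c Hc HU) as [e [He H]].
      assert (c < b2).
      { destruct Hc as [_ [Hc | Hc]]; [exact Hc|]. subst c. destruct (Hdis b2 ltac:(lra) HU HU2). }
      assert (0 < Rmin (e / 2) (b2 - c)) by (apply Rmin_glb_lt; lra).
      pose proof (Rmin_l (e / 2) (b2 - c)). pose proof (Rmin_r (e / 2) (b2 - c)).
      assert (c + Rmin (e / 2) (b2 - c) <= c); [|lra].
      apply Hub. split; [lra|]. apply H; [lra|]. rewrite Rabs_pos_eq; lra.
    + destruct (Ho2 c Hc HU) as [e [He H]].
      assert (c <= c - e); [|lra].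
      apply Hlub. intros z [Hz1 Hz2]. apply Rnot_lt_le. intros Hze.
      apply (Hdis z Hz1 Hz2), H; [exact Hz1|].
      assert (z <= c) by (apply Hub; auto). rewrite Rabs_left1; lra.
Qed.

(** * A single trajectory to the right of the maximum *)

Lemma derive_neg_local (f : R -> R) (s l : R) :
  is_derive f s l -> l < 0 -> exists e, 0 < e /\
    (forall t, s < t < s + e -> f t < f s) /\ (forall t, s - e < t < s -> f s < f t).
Proof.
  intros Hd Hl. apply is_derive_Reals in Hd.
  destruct (Hd (- l / 2)) as [e He]; [lra|].
  exists e. split; [apply cond_pos|].
  assert (Hq : forall t, t <> s -> Rabs (t - s) < e -> (f t - f s) / (t - s) < 0).
  { intros t Hts Ht. specialize (He (t - s) ltac:(lra) Ht).
    replace (s + (t - s)) with t in He by ring.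
    apply Rabs_lt_between in He. lra. }
  assert (Hm : forall t, t <> s -> f t - f s = (f t - f s) / (t - s) * (t - s))
    by (intros; field; lra).
  split; intros t Ht.
  - specialize (Hq t ltac:(lra)). rewrite Rabs_pos_eq in Hq by lra. specialize (Hq ltac:(lra)).
    specialize (Hm t ltac:(lra)). nra.
  - specialize (Hq t ltac:(lra)). rewrite Rabs_left in Hq by lra. specialize (Hq ltac:(lra)).
    specialize (Hm t ltac:(lra)). nra.
Qed.

Lemma derive_pos_local (f : R -> R) (s l : R) :
  is_derive f s l -> 0 < l -> exists e, 0 < e /\
    (forall t, s < t < s + e -> f s < f t) /\ (forall t, s - e < t < s -> f t < f s).
Proof.
  intros Hd Hl.
  destruct (derive_neg_local (fun t => - f t) s (- l)) as [e [He [H1 H2]]].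
  - apply (is_derive_opp (V := R_NormedModule)), Hd.
  - lra.
  - exists e. split; [exact He|]. split; intros t Ht.
    + specialize (H1 t Ht). lra.
    + specialize (H2 t Ht). lra.
Qed.

Section Trajectory.

Variables (r beta b : R) (P V A B : R -> R).
Hypothesis Hr : 0 < r <= 2.01.
Hypothesis Hbeta : 0 <= beta <= 1 / 100.
Hypothesis Hb : 1 <= b <= 4.
Hypothesis Hf : family r beta b P V A B.

Definition potential (t : R) : R := beta ^ 2 * clip (P t) ^ 2 + A t ^ 2 - 1.

Lemma family_0 : P 0 = 1 /\ V 0 = 0 /\ A 0 = beta - 1 /\ B 0 = b.
Proof. repeat split; apply Hf. Qed.

Lemma dP t : is_derive P t (V t).
Proof. apply Hf; exact I. Qed.

Lemma dV t : is_derive V t (clip (P t) * potential t).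
Proof. apply Hf; exact I. Qed.

Lemma dA t : is_derive A t (B t).
Proof. apply Hf; exact I. Qed.

Lemma dB t : is_derive B t (r * beta ^ 2 * clip (P t) ^ 2 * A t).
Proof. apply Hf; exact I. Qed.

Lemma coupling_bound t : 0 <= r * beta ^ 2 * clip (P t) ^ 2 <= 2.01 * beta ^ 2.
Proof.
  pose proof (clip_bounds (P t)). assert (0 <= clip (P t) ^ 2 <= 1) by nra.
  assert (0 <= beta ^ 2) by nra.
  assert (0 <= r * beta ^ 2 <= 2.01 * beta ^ 2) by nra.
  nra.
Qed.

Lemma beta_sq : 0 <= beta ^ 2 <= 1 / 100 * beta.
Proof. nra. Qed.

(** Bootstrap: as long as B >= b/2, A stays above -1 and is nonnegative from time 2 on. Until then B
    loses at most 4.02 beta^2, and afterwards it is nondecreasing. *)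
Lemma B_lower t : 0 <= t -> b / 2 <= B t.
Proof.
  intros Ht. apply Rnot_lt_le. intros Hlt.
  destruct family_0 as [_ [_ [A0 B0]]].
  destruct (first_zero (fun s => B s - b / 2) 0 t Ht) as [s [Hs [Hs0 Hpos]]].
  - intros u _. apply continuity_pt_minus.
    + eapply is_derive_continuity_pt, dB.
    + apply continuity_pt_const. intros x y; reflexivity.
  - rewrite B0. lra.
  - lra.
  - assert (HA : forall u, 0 <= u <= s -> beta - 1 + b / 2 * u <= A u).
    { intros u Hu. destruct (Req_dec u 0) as [-> | Hu0]; [lra|].
      destruct (mean_value A B 0 u) as [c [Hc1 Hc2]]; [lra | intros; apply dA|].
      specialize (Hpos c ltac:(lra)). rewrite A0 in Hc1. nra. }
    pose proof beta_sq as Hb2.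
    assert (Hearly : forall u, 0 <= u <= s -> u <= 2 -> b - 4.02 * beta ^ 2 <= B u).
    { intros u Hu Hu2. destruct (Req_dec u 0) as [-> | Hu0]; [lra|].
      destruct (mean_value B (fun v => r * beta ^ 2 * clip (P v) ^ 2 * A v) 0 u)
        as [c [Hc1 Hc2]]; [lra | intros; apply dB|].
      pose proof (coupling_bound c). specialize (HA c ltac:(lra)).
      assert (- 1 <= A c) by nra. rewrite B0 in Hc1.
      assert (- (2.01 * beta ^ 2) <= r * beta ^ 2 * clip (P c) ^ 2 * A c) by nra. nra. }
    destruct (Rle_lt_dec s 2) as [Hs2 | Hs2].
    + specialize (Hearly s ltac:(lra) Hs2). lra.
    + specialize (Hearly 2 ltac:(lra) ltac:(lra)).
      assert (B 2 <= B s); [|lra].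
      apply (derive_nonneg_le B (fun v => r * beta ^ 2 * clip (P v) ^ 2 * A v)); [lra | |].
      * intros; apply dB.
      * intros u Hu. pose proof (coupling_bound u). specialize (HA u ltac:(lra)).
        apply Rmult_le_pos; nra.
Qed.

Lemma A_increasing s t : 0 <= s -> s < t -> A s + b / 2 * (t - s) <= A t.
Proof.
  intros Hs Hst.
  destruct (mean_value A B s t) as [c [Hc1 Hc2]]; [lra | intros; apply dA|].
  pose proof (B_lower c ltac:(lra)). nra.
Qed.

Lemma A_lower t : 0 <= t -> beta - 1 + b / 2 * t <= A t.
Proof.
  intros [Ht | <-].
  - pose proof (A_increasing 0 t ltac:(lra) Ht). destruct family_0 as [_ [_ [A0 _]]].
    rewrite A0 in H. lra.
  - destruct family_0 as [_ [_ [A0 _]]]. lra.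
Qed.

(** Origin of the constant 1/8: the slope of A is at most 5 there, so A <= beta - 1 + 5/8 < 0. *)
Lemma A_early t : 0 <= t <= 1 / 8 -> A t < 0.
Proof.
  intros Ht. apply Rnot_le_lt. intros HA.
  destruct family_0 as [_ [_ [A0 B0]]].
  destruct (Req_dec t 0) as [-> | Ht0]; [lra|].
  destruct (mean_value A B 0 t) as [c [Hc1 Hc2]]; [lra | intros; apply dA|].
  destruct (mean_value B (fun v => r * beta ^ 2 * clip (P v) ^ 2 * A v) 0 c)
    as [d [Hd1 Hd2]]; [lra | intros; apply dB|].
  rewrite A0 in Hc1. rewrite B0 in Hd1.
  pose proof (coupling_bound d) as Hk. pose proof beta_sq as Hb2.
  destruct (flow_AB_bound (fun _ => True) r _ _ b P V A B 1 Hf (fun _ _ => I) Hr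
    ltac:(nra) ltac:(lra) Hb d) as [HAd _]; [rewrite Rabs_pos_eq; lra|].
  assert (Hfb : field_bound (Rabs d) <= 5 * exp 1).
  { unfold field_bound. apply Rmult_le_compat_l; [lra|]. left. apply exp_increasing.
    rewrite Rabs_pos_eq; lra. }
  pose proof exp_le_3. apply Rabs_le_between in HAd.
  assert (r * beta ^ 2 * clip (P d) ^ 2 * A d <= 1 / 100) by nra.
  assert (B c <= 5) by nra. nra.
Qed.

Lemma B_decreasing t : 0 <= t -> A t <= 0 -> B t <= b.
Proof.
  intros Ht HA. destruct family_0 as [_ [_ [_ B0]]]. rewrite <- B0.
  apply (derive_nonpos_le B (fun v => r * beta ^ 2 * clip (P v) ^ 2 * A v)); [lra | |].
  - intros; apply dB.
  - intros u Hu. pose proof (coupling_bound u).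
    pose proof (A_increasing u t ltac:(lra) ltac:(lra)).
    assert (0 <= b / 2 * (t - u)) by (apply Rmult_le_pos; lra). nra.
Qed.

Lemma B_increasing s t : 0 <= s <= t -> 0 <= A s -> B s <= B t.
Proof.
  intros Ht HA.
  apply (derive_nonneg_le B (fun v => r * beta ^ 2 * clip (P v) ^ 2 * A v)); [lra | |].
  - intros; apply dB.
  - intros u Hu. pose proof (coupling_bound u).
    pose proof (A_increasing s u ltac:(lra) ltac:(lra)).
    assert (0 <= b / 2 * (u - s)) by (apply Rmult_le_pos; lra).
    apply Rmult_le_pos; lra.
Qed.

Lemma potential_lower t : -1 <= potential t.
Proof.
  unfold potential. pose proof (pow2_ge_0 (A t)). pose proof (pow2_ge_0 (clip (P t))).
  pose proof (pow2_ge_0 beta). nra.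
Qed.

Lemma V_lower s t : s <= t -> V s - (t - s) <= V t.
Proof.
  intros Hst.
  assert (V s + s <= V t + t); [|lra].
  apply (derive_nonneg_le (fun u => V u + u) (fun u => clip (P u) * potential u + 1)); [exact Hst| |].
  - intros u _. pose proof (dV u) as d. derive_tac.
  - intros u _. pose proof (potential_lower u). pose proof (clip_bounds (P u)). nra.
Qed.

Lemma P_early t : 0 <= t <= 1 / 8 -> 1 / 2 <= P t.
Proof.
  intros Ht. destruct family_0 as [P0 [V0 _]].
  destruct (Req_dec t 0) as [-> | Ht0]; [lra|].
  destruct (mean_value P V 0 t) as [c [Hc1 Hc2]]; [lra | intros; apply dP|].
  pose proof (V_lower 0 c ltac:(lra)). rewrite P0 in Hc1. rewrite V0 in H. nra.
Qed.

(** Here the choice A(0) = beta - 1 pays off: |A| < 1 - beta gives A^2 - 1 < -2 beta + beta^2, which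
    leaves room for the term beta^2 psi^2. *)
Lemma potential_neg t : 0 < t -> A t <= 1 - beta -> forall s, 0 < s < t -> potential s < 0.
Proof.
  intros Ht HA s Hs.
  pose proof (A_increasing s t ltac:(lra) ltac:(lra)).
  pose proof (A_lower s ltac:(lra)). unfold potential. pose proof beta_sq.
  pose proof (clip_bounds (P s)). assert (0 <= clip (P s) ^ 2 <= 1) by nra.
  assert (beta ^ 2 * clip (P s) ^ 2 <= beta ^ 2 * 1) by (apply Rmult_le_compat_l; lra).
  assert (0 < b / 2 * s) by nra. assert (0 < b / 2 * (t - s)) by nra.
  assert (A s ^ 2 < (1 - beta) ^ 2) by nra. nra.
Qed.

Lemma V_neg t : 0 < t -> A t <= 1 - beta -> V t < 0.
Proof.
  intros Ht HA. destruct family_0 as [_ [V0 _]].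
  assert (Hq := potential_neg t Ht HA).
  (* Later the clip may vanish and give only weak monotonicity; strict decrease comes from the times
     up to 1/8, where P >= 1/2. *)
  pose proof (Rmin_l t (1 / 8)). pose proof (Rmin_r t (1 / 8)).
  assert (0 < Rmin t (1 / 8)) by (apply Rmin_glb_lt; lra).
  apply Rle_lt_trans with (V (Rmin t (1 / 8))).
  - apply (derive_nonpos_le V (fun u => clip (P u) * potential u)); [lra | |].
    + intros; apply dV.
    + intros u Hu. specialize (Hq u ltac:(lra)). pose proof (clip_bounds (P u)). nra.
  - rewrite <- V0 at 1.
    apply (derive_neg_lt V (fun u => clip (P u) * potential u)); [lra | |].
    + intros; apply dV.
    + intros u Hu. specialize (Hq u ltac:(lra)). pose proof (P_early u ltac:(lra)).
      pose proof (clip_pos (P u) ltac:(lra)). nra.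
Qed.

Lemma V_neg_early t : 0 < t <= 1 / 8 -> V t < 0.
Proof.
  intros Ht. apply V_neg; [lra|]. pose proof (A_early t ltac:(lra)). lra.
Qed.

Lemma P_le_1 t : 0 <= t -> (forall s, 0 < s < t -> V s <= 0) -> P t <= 1.
Proof.
  intros Ht HV. destruct family_0 as [P0 _]. rewrite <- P0.
  apply (derive_nonpos_le P V); [exact Ht | intros; apply dP | exact HV].
Qed.

(** Since [clip (P t)] is at most |P t|, the derivative of P^2 + V^2 is bounded by a multiple of P^2
    + V^2; a zero would propagate back to time 0, where P = 1. *)
Lemma no_double_zero s : 0 <= s -> P s = 0 -> V s = 0 -> False.
Proof.
  intros Hs HP HV. destruct family_0 as [P0 [V0 _]].
  set (K := field_bound (s + 1)).
  assert (HAK : forall t, 0 <= t <= s -> Rabs (A t) <= K).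
  { intros t Ht.
    destruct (flow_AB_bound (fun _ => True) r _ _ b P V A B (s + 1) Hf (fun _ _ => I) Hr
      ltac:(nra) ltac:(lra) Hb t) as [HAd _]; [rewrite Rabs_pos_eq; lra|].
    eapply Rle_trans; [exact HAd|]. unfold K, field_bound.
    apply Rmult_le_compat_l; [lra|]. left. apply exp_increasing. rewrite Rabs_pos_eq; lra. }
  destruct (gronwall (fun t => P t ^ 2 + V t ^ 2)
    (fun t => 2 * P t * V t + 2 * V t * (clip (P t) * potential t)) (3 + K ^ 2) 0 s Hs) as [_ H].
  - intros t _. pose proof (dP t) as d1. pose proof (dV t) as d2. derive_tac.
  - intros t Ht. specialize (HAK t Ht).
    assert (HA2 : A t ^ 2 <= K ^ 2).
    { rewrite <- (pow2_abs (A t)). pose proof (Rabs_pos (A t)). nra. }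
    assert (Hq : Rabs (potential t) <= 1 + K ^ 2).
    { apply Rabs_le. pose proof (potential_lower t). pose proof (pow2_ge_0 K).
      split; [lra|]. unfold potential.
      pose proof (clip_bounds (P t)). assert (0 <= clip (P t) ^ 2 <= 1) by nra.
      assert (0 <= beta ^ 2 <= 1) by nra. nra. }
    replace (2 * P t * V t + 2 * V t * (clip (P t) * potential t))
      with (2 * V t * (P t + clip (P t) * potential t)) by ring.
    rewrite !Rabs_mult, (Rabs_pos_eq 2) by lra.
    assert (Hs1 : Rabs (P t + clip (P t) * potential t) <= Rabs (P t) * (2 + K ^ 2)).
    { eapply Rle_trans; [apply Rabs_triang|]. rewrite Rabs_mult.
      assert (Rabs (clip (P t)) <= Rabs (P t)).
      { rewrite Rabs_pos_eq; [apply clip_abs_le | apply clip_bounds]. }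
      assert (Rabs (clip (P t)) * Rabs (potential t) <= Rabs (P t) * (1 + K ^ 2)).
      { apply Rmult_le_compat; auto using Rabs_pos. }
      lra. }
    rewrite <- (pow2_abs (P t)), <- (pow2_abs (V t)).
    pose proof (Rabs_pos (V t)). pose proof (Rabs_pos (P t)). pose proof (pow2_ge_0 K).
    assert (Rabs (V t) * Rabs (P t + clip (P t) * potential t)
            <= Rabs (V t) * (Rabs (P t) * (2 + K ^ 2))) by (apply Rmult_le_compat_l; lra).
    pose proof (pow2_ge_0 (Rabs (V t) - Rabs (P t))).
    assert (2 * Rabs (V t) * Rabs (P t) * (2 + K ^ 2)
            <= (Rabs (P t) ^ 2 + Rabs (V t) ^ 2) * (2 + K ^ 2))
      by (apply Rmult_le_compat_r; lra).
    nra.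
  - rewrite P0, V0, HP, HV in H.
    replace ((0 ^ 2 + 0 ^ 2) * exp ((3 + K ^ 2) * (s - 0))) with 0 in H by ring. lra.
Qed.

Lemma zero_crossing s : 0 < s -> P s = 0 -> (forall t, 0 <= t < s -> 0 < P t) ->
  V s < 0 /\ exists e, 0 < e /\ forall t, s < t < s + e -> P t < 0.
Proof.
  intros Hs HP Hpos.
  destruct (Rtotal_order (V s) 0) as [HV | [HV | HV]].
  - split; [exact HV|].
    destruct (derive_neg_local P s (V s) (dP s) HV) as [e [He [H _]]].
    exists e. split; [exact He|]. intros t Ht. specialize (H t Ht). lra.
  - destruct (no_double_zero s ltac:(lra) HP HV).
  - destruct (derive_pos_local P s (V s) (dP s) HV) as [e [He [_ H]]].
    pose proof (Rmax_l 0 (s - e / 2)). pose proof (Rmax_r 0 (s - e / 2)).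
    assert (Rmax 0 (s - e / 2) < s) by (apply Rmax_lub_lt; lra).
    specialize (H (Rmax 0 (s - e / 2)) ltac:(lra)).
    specialize (Hpos (Rmax 0 (s - e / 2)) ltac:(lra)). lra.
Qed.

Definition virial (t : R) : R :=
  P t ^ 2 * (A t ^ 2 - 1) + beta ^ 2 * P t ^ 4 / 2 - V t ^ 2.

(** [virial] is Y of the overview. The range of P makes the clip inactive, and then the terms
    containing V cancel. *)
Lemma virial_derive t : 0 <= P t <= 1 -> is_derive virial t (2 * P t ^ 2 * A t * B t).
Proof.
  intros HP. pose proof (dP t) as d1. pose proof (dV t) as d2. pose proof (dA t) as d3.
  unfold potential in d2. rewrite (clip_id (P t) HP) in d2.
  unfold virial. derive_tac. field.
Qed.

(** The first integral: [B ^ 2 - r * beta ^ 2 * virial] has derivative zero. *)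
Lemma energy s t : s <= t -> (forall u, s <= u <= t -> 0 <= P u <= 1) ->
  B t ^ 2 - B s ^ 2 = r * beta ^ 2 * (virial t - virial s).
Proof.
  intros Hst HP.
  assert (Hd : forall u, s <= u <= t ->
            is_derive (fun u => B u ^ 2 - r * beta ^ 2 * virial u) u 0).
  { intros u Hu. pose proof (dB u) as d1. pose proof (virial_derive u (HP u Hu)) as d2.
    rewrite (clip_id (P u) (HP u Hu)) in d1. derive_tac. }
  assert (H1 := derive_nonneg_le _ (fun _ => 0) s t Hst Hd ltac:(intros; lra)).
  assert (H2 := derive_nonpos_le _ (fun _ => 0) s t Hst Hd ltac:(intros; lra)).
  simpl in H1, H2. simpl. lra.
Qed.

Lemma V_nondecreasing s t : 0 <= s <= t -> 1 <= A s -> V s <= V t.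
Proof.
  intros Hst HA.
  apply (derive_nonneg_le V (fun u => clip (P u) * potential u)); [lra | intros; apply dV |].
  intros u Hu. pose proof (A_increasing s u ltac:(lra) ltac:(lra)).
  pose proof (clip_bounds (P u)). apply Rmult_le_pos; [lra|].
  unfold potential. assert (0 <= beta ^ 2 * clip (P u) ^ 2)
    by (apply Rmult_le_pos; apply pow2_ge_0).
  assert (0 <= b / 2 * (u - s)) by (apply Rmult_le_pos; lra). nra.
Qed.

(* While [P] decreases, [V] gains at least [P T] times the integral of [A^2 - 1] over
   [T/2, T], which is of order [T^3], and [V] cannot exceed [0]. *)
Lemma P_decay T : 16 <= T ->
  (forall t, 0 < t < T -> V t <= 0) -> (forall t, 0 < t < T -> 0 <= P t) ->
  P T * T ^ 3 <= 1536.
Proof.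
  intros HT HV HP. destruct family_0 as [P0 [V0 _]].
  destruct (Rle_lt_dec (P T) 0) as [HPT | HPT].
  { assert (0 < T ^ 3) by (apply pow_lt; lra). nra. }
  assert (HV6 : -6 <= V 6).
  { pose proof (V_lower 0 6 ltac:(lra)). lra. }
  assert (HVT : V T <= 0).
  { apply Rnot_lt_le. intros Hp.
    assert (HcV : continuity_pt V T) by (eapply is_derive_continuity_pt, dV).
    destruct (continuity_pt_pos V T HcV Hp) as [e [He H]].
    pose proof (Rmax_l 1 (T - e / 2)). pose proof (Rmax_r 1 (T - e / 2)).
    assert (Rmax 1 (T - e / 2) < T) by (apply Rmax_lub_lt; lra).
    specialize (H (Rmax 1 (T - e / 2))). specialize (HV (Rmax 1 (T - e / 2)) ltac:(lra)).
    rewrite Rabs_left in H by lra. specialize (H ltac:(lra)). lra. }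
  assert (HA : forall t, 6 <= t -> 2 <= A t).
  { intros t Ht. pose proof (A_lower t ltac:(lra)). nra. }
  assert (HV62 : V 6 <= V (T / 2)).
  { apply V_nondecreasing; [lra|]. specialize (HA 6 ltac:(lra)). lra. }
  destruct (mean_value V (fun u => clip (P u) * potential u) (T / 2) T)
    as [c [Hc1 Hc2]]; [lra | intros; apply dV|].
  assert (HPc : P T <= clip (P c)).
  { assert (P T <= P c).
    { apply (derive_nonpos_le P V); [lra | intros; apply dP |]. intros; apply HV; lra. }
    rewrite clip_id; [exact H|]. split; [lra|].
    apply P_le_1; [lra|]. intros; apply HV; lra. }
  assert (HAc : T / 8 <= A c).
  { pose proof (A_lower c ltac:(lra)). nra. }
  assert (Hq : T ^ 2 / 128 <= potential c).
  { unfold potential. pose proof (pow2_ge_0 (clip (P c))). pose proof (pow2_ge_0 beta).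
    assert (0 <= beta ^ 2 * clip (P c) ^ 2) by (apply Rmult_le_pos; lra).
    nra. }
  assert (HT2 : 0 <= T ^ 2) by nra.
  assert (P T * (T ^ 2 / 128) <= clip (P c) * potential c) by (apply Rmult_le_compat; lra).
  assert (P T * (T ^ 2 / 128) * (T - T / 2) <= 6) by nra.
  (* V rises from at least -6 to at most 0 over [T/2, T], hence 1536 = 6 * 256. The bound T >= 16 is
     what makes A >= T/8 and A^2 - 1 >= T^2/128 there. *)
  replace (P T * T ^ 3) with (256 * (P T * (T ^ 2 / 128) * (T - T / 2))) by field. lra.
Qed.

(** On [T/2, T] the slope V is nondecreasing, so P drops by at least -V(T) T/2, and it cannot drop
    by more than 1. *)
Lemma V_decay T : 16 <= T ->
  (forall t, 0 < t <= T -> V t <= 0) -> (forall t, 0 < t <= T -> 0 <= P t) ->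
  - V T * T <= 2.
Proof.
  intros HT HV HP.
  destruct (mean_value P V (T / 2) T) as [c [Hc1 Hc2]]; [lra | intros; apply dP|].
  pose proof (HP T ltac:(lra)).
  assert (P (T / 2) <= 1) by (apply P_le_1; [lra|]; intros; apply HV; lra).
  assert (V c <= V T).
  { apply V_nondecreasing; [lra|]. pose proof (A_lower c ltac:(lra)). nra. }
  nra.
Qed.

End Trajectory.

(** * The limit problem *)

(** Lets [first_zero] locate the first time at which one of several strict inequalities fails. *)
Lemma continuity_pt_Rmin (f g : R -> R) (t : R) :
  continuity_pt f t -> continuity_pt g t -> continuity_pt (fun u => Rmin (f u) (g u)) t.
Proof.
  intros Hf Hg.
  apply (continuity_pt_ext (fun u => (f u + g u - Rabs (f u - g u)) * / 2)).
  - intros u. unfold Rmin, Rabs. destruct Rle_dec; destruct Rcase_abs; lra.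
  - apply continuity_pt_mult; [|apply continuity_pt_const; intros x y; reflexivity].
    apply continuity_pt_minus; [apply continuity_pt_plus; assumption|].
    apply (continuity_pt_comp (fun u => f u - g u) Rabs); [|apply Rcontinuity_abs].
    apply continuity_pt_minus; assumption.
Qed.

(** Strict inequalities, so that [hits] and [turns] are open conditions on b. *)
Definition hits (P : R -> R) : Prop := exists t, 0 <= t /\ P t < 0.
Definition turns (V : R -> R) : Prop := exists t, 0 <= t /\ 0 < V t.

Lemma V_nonpos (V : R -> R) : ~ turns V -> forall t, 0 <= t -> V t <= 0.
Proof. intros H t Ht. apply Rnot_lt_le. intros Hlt. apply H. exists t. auto. Qed.

Section OneTrajectory.

Variables (r b : R) (P V A B : R -> R).
Hypothesis Hr : 0 < r <= 2.01.
Hypothesis Hb : 1 <= b <= 4.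
Hypothesis Hf : family r 0 b P V A B.

Let H0 : 0 <= 0 <= 1 / 100.
Proof. lra. Qed.

Lemma limit_B t : B t = b.
Proof.
  assert (Hd : forall s, is_derive B s 0).
  { intros s. replace 0 with (r * 0 ^ 2 * clip (P s) ^ 2 * A s) by ring.
    apply (dB r 0 b P V A B Hf). }
  destruct (family_0 r 0 b P V A B Hf) as [_ [_ [_ B0]]]. rewrite <- B0.
  destruct (Rle_lt_dec 0 t) as [Ht | Ht].
  - apply Rle_antisym.
    + apply (derive_nonpos_le B (fun _ => 0)); auto; intros; lra.
    + apply (derive_nonneg_le B (fun _ => 0)); auto; intros; lra.
  - apply Rle_antisym.
    + apply (derive_nonneg_le B (fun _ => 0)); auto; intros; lra.
    + apply (derive_nonpos_le B (fun _ => 0)); auto; intros; lra.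
Qed.

Lemma limit_A t : A t = b * t - 1.
Proof.
  assert (Hd : forall s, is_derive (fun u => A u - b * u) s 0).
  { intros s. pose proof (dA r 0 b P V A B Hf s) as d. rewrite limit_B in d. derive_tac. }
  destruct (family_0 r 0 b P V A B Hf) as [_ [_ [A0 _]]].
  assert (A t - b * t = A 0 - b * 0); [|lra].
  destruct (Rle_lt_dec 0 t) as [Ht | Ht].
  - apply Rle_antisym.
    + apply (derive_nonpos_le (fun u => A u - b * u) (fun _ => 0)); auto; intros; lra.
    + apply (derive_nonneg_le (fun u => A u - b * u) (fun _ => 0)); auto; intros; lra.
  - apply Rle_antisym.
    + apply (derive_nonneg_le (fun u => A u - b * u) (fun _ => 0)); auto; intros; lra.
    + apply (derive_nonpos_le (fun u => A u - b * u) (fun _ => 0)); auto; intros; lra.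
Qed.

Lemma limit_potential t : potential 0 P A t = (b * t - 1) ^ 2 - 1.
Proof. unfold potential. rewrite limit_A. ring. Qed.

Lemma limit_V_neg t : 0 < t -> b * t <= 2 -> V t < 0.
Proof.
  intros Ht Hbt. apply (V_neg r 0 b P V A B Hr H0 Hb Hf t Ht). rewrite limit_A. lra.
Qed.

Lemma limit_V_incr s t : 2 <= b * s -> s <= t -> V s <= V t.
Proof.
  intros Hs Hst. apply (V_nondecreasing r 0 b P V A B Hr H0 Hb Hf).
  - split; [nra | exact Hst].
  - rewrite limit_A. lra.
Qed.

Lemma hits_zero t : 0 <= t -> P t <= 0 -> hits P.
Proof.
  intros Ht HPt.
  destruct (first_zero P 0 t Ht) as [s [Hs1 [Hs2 Hs3]]].
  - intros u _. eapply is_derive_continuity_pt, (dP r 0 b P V A B Hf).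
  - destruct (family_0 r 0 b P V A B Hf) as [P0 _]. lra.
  - exact HPt.
  - destruct (zero_crossing r 0 b P V A B Hr H0 Hb Hf s ltac:(lra) Hs2 Hs3)
      as [_ [e [He H]]].
    exists (s + e / 2). split; [lra|]. apply H. lra.
Qed.

Lemma P_pos : ~ hits P -> forall t, 0 <= t -> 0 < P t.
Proof.
  intros H t Ht. apply Rnot_le_lt. intros Hle. apply H, (hits_zero t Ht Hle).
Qed.

(** A turn before the first zero of P would keep V positive up to that zero, since V is
    nondecreasing once b t >= 2. After the zero the clip switches the force off, so V keeps its
    negative value and P never comes back. *)
Lemma not_hits_and_turns : hits P -> turns V -> False.
Proof.
  intros [t1 [Ht1 HP1]] [t2 [Ht2 HV2]].
  destruct (family_0 r 0 b P V A B Hf) as [P0 [V0 _]].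
  assert (HdP := dP r 0 b P V A B Hf). assert (HdV := dV r 0 b P V A B Hf).
  assert (Hcross : forall t, 0 <= t -> 0 < V t -> 2 < b * t).
  { intros t Ht HV. apply Rnot_le_lt. intros Hle.
    destruct Ht as [Ht | <-]; [|lra]. pose proof (limit_V_neg t Ht Hle). lra. }
  assert (Hbt2 := Hcross t2 Ht2 HV2).
  destruct (first_zero P 0 t1 Ht1) as [s [Hs1 [Hs2 Hs3]]]; [|lra|lra|].
  { intros u _. eapply is_derive_continuity_pt, HdP. }
  destruct (zero_crossing r 0 b P V A B Hr H0 Hb Hf s ltac:(lra) Hs2 Hs3) as [HVs _].
  assert (Hst2 : s < t2).
  { apply Rnot_le_lt. intros Hle. pose proof (limit_V_incr t2 s ltac:(lra) Hle). lra. }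
  destruct (first_zero (fun t => - V t) s t2) as [z [Hz1 [Hz2 Hz3]]]; [lra| |lra|lra|].
  { intros u _. apply continuity_pt_opp. eapply is_derive_continuity_pt, HdV. }
  assert (V z <= V s); [|lra].
  apply (derive_nonpos_le V (fun t => clip (P t) * potential 0 P A t));
    [lra | intros; apply HdV |].
  intros t Ht. assert (P t <= 0).
  { rewrite <- Hs2. apply (derive_nonpos_le P V); [lra | intros; apply HdP |].
    intros u Hu. specialize (Hz3 u ltac:(lra)). lra. }
  rewrite clip_neg by assumption. lra.
Qed.

(* Rounded minimizer of [f'^2 + ((b t - 1)^2 - 1) f^2], integrated over [0, 3] with
   [b = 1.6831], among polynomials of degree 6 with a double zero at 3. *)
Definition trial (t : R) : R := (3 - t) ^ 2 * (10 + 7 * t + 5 * t ^ 2 - 8 * t ^ 3 + 2 * t ^ 4).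
Definition trial' (t : R) : R :=
  3 + 26 * t - 285 * t ^ 2 + 284 * t ^ 3 - 100 * t ^ 4 + 12 * t ^ 5.

Definition trial_energy (t : R) : R :=
  (9) * t ^ 1 + (-1355511 / 100) * t ^ 2 + (20094139441 / 3000000) * t ^ 3
    + (-97467389853 / 20000000) * t ^ 4 + (15934676375789 / 500000000) * t ^ 5
    + (-4281642455557 / 100000000) * t ^ 6 + (19234638102619 / 700000000) * t ^ 7
    + (-2925757898571 / 200000000) * t ^ 8 + (3180386431757 / 300000000) * t ^ 9
    + (-3599475474439 / 500000000) * t ^ 10 + (328868019543 / 100000000) * t ^ 11
    + (-57120896321 / 60000000) * t ^ 12 + (55173717931 / 325000000) * t ^ 13
    + (-300113561 / 17500000) * t ^ 14 + (283282561 / 375000000) * t ^ 15.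

Lemma trial_derive t : is_derive trial t (trial' t).
Proof. unfold trial, trial'. auto_derive; [easy | ring]. Qed.

Lemma trial_energy_derive t : is_derive trial_energy t
  (trial' t ^ 2 + ((16831 / 10000 * t - 1) ^ 2 - 1) * trial t ^ 2).
Proof. unfold trial_energy, trial, trial'. auto_derive; [easy | field]. Qed.

(* Jacobi's identity: with [w = V/P], the derivative of [trial_energy - trial^2 w] is the
   square [(trial' - trial w)^2], up to a nonnegative clipping term. *)
Lemma hits_small : b = 16831 / 10000 -> hits P.
Proof.
  intros Hb0. apply NNPP. intros Hn. assert (HP := P_pos Hn).
  assert (HdP := dP r 0 b P V A B Hf). assert (HdV := dV r 0 b P V A B Hf).
  destruct (family_0 r 0 b P V A B Hf) as [P0 [V0 _]].
  assert (H : trial_energy 0 - trial 0 ^ 2 * V 0 / P 0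
              <= trial_energy 3 - trial 3 ^ 2 * V 3 / P 3).
  { apply (derive_nonneg_le (fun t => trial_energy t - trial t ^ 2 * V t / P t)
      (fun t => (trial' t - trial t * V t / P t) ^ 2
        + trial t ^ 2 * ((b * t - 1) ^ 2 - 1) * (P t - clip (P t)) / P t)); [lra| |].
    - intros t Ht. pose proof (trial_derive t) as d1. pose proof (trial_energy_derive t) as d2.
      pose proof (HdP t) as d3. pose proof (HdV t) as d4. rewrite limit_potential in d4.
      specialize (HP t ltac:(lra)). rewrite Hb0 in *.
      auto_derive.
      + repeat split; try (eexists; eassumption); lra.
      + derive_subst. field. lra.
    - intros t Ht. specialize (HP t ltac:(lra)).
      (* While the potential is negative, P is decreasing from 1 and the clip is inactive;
         afterwards both factors are nonnegative. *)
      assert (0 <= ((b * t - 1) ^ 2 - 1) * (P t - clip (P t))).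
      { destruct (Rle_lt_dec (b * t) 2) as [Hle | Hlt].
        - assert (P t <= 1).
          { apply (P_le_1 r 0 b P V A B Hf); [lra|]. intros s Hs. left.
            apply limit_V_neg; [lra | nra]. }
          rewrite (clip_id (P t)) by lra. lra.
        - pose proof (clip_abs_le (P t)). rewrite (Rabs_pos_eq (P t)) in H by lra.
          apply Rmult_le_pos; [nra | lra]. }
      pose proof (pow2_ge_0 (trial' t - trial t * V t / P t)).
      apply Rplus_le_le_0_compat; [assumption|].
      apply Rmult_le_pos; [|left; apply Rinv_0_lt_compat; lra].
      rewrite Rmult_assoc. apply Rmult_le_pos; [apply pow2_ge_0 | assumption]. }
  assert (E0 : trial_energy 0 = 0) by (unfold trial_energy; ring).
  assert (E3 : trial_energy 3 < 0) by (unfold trial_energy; lra).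
  assert (T3 : trial 3 = 0) by (unfold trial; ring).
  rewrite E0, V0, T3 in H. unfold Rdiv in H. lra.
Qed.

(** Explicit barriers: the force is at least 9 t^2 - 6 t up to 2/3, which leaves V >= -4/9 and P >=
    23/27. If V stayed nonpositive, P would remain above 11/27 up to 5/3, and the positive force on
    [2/3, 5/3] would raise V by 22/9. *)
Lemma turns_large : b = 3 -> turns V.
Proof.
  intros Hb0. apply NNPP. intros Hn. assert (HV := V_nonpos V Hn).
  assert (HdP := dP r 0 b P V A B Hf). assert (HdV := dV r 0 b P V A B Hf).
  destruct (family_0 r 0 b P V A B Hf) as [P0 [V0 _]].
  assert (HV1 : forall t, 0 <= t <= 2 / 3 -> - (3 * t ^ 2 - 3 * t ^ 3) <= V t).
  { intros t Ht.
    assert (V 0 + (3 * 0 ^ 2 - 3 * 0 ^ 3) <= V t + (3 * t ^ 2 - 3 * t ^ 3)); [|rewrite V0 in H; lra].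
    apply (derive_nonneg_le (fun t => V t + (3 * t ^ 2 - 3 * t ^ 3))
       (fun t => clip (P t) * potential 0 P A t + (6 * t - 9 * t ^ 2))); [lra| |].
    - intros s _. pose proof (HdV s) as d. derive_tac.
    - intros s Hs. rewrite limit_potential, Hb0. pose proof (clip_bounds (P s)).
      assert (9 * s ^ 2 - 6 * s <= 0) by nra.
      replace (clip (P s) * ((3 * s - 1) ^ 2 - 1) + (6 * s - 9 * s ^ 2))
        with ((1 - clip (P s)) * - (9 * s ^ 2 - 6 * s)) by ring.
      apply Rmult_le_pos; lra. }
  assert (HV23 : - (4 / 9) <= V (2 / 3)) by (specialize (HV1 (2 / 3) ltac:(lra)); lra).
  assert (HP23 : 23 / 27 <= P (2 / 3)).
  { assert (P 0 + (0 ^ 3 - 3 / 4 * 0 ^ 4) <= P (2 / 3) + ((2 / 3) ^ 3 - 3 / 4 * (2 / 3) ^ 4));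
      [|rewrite P0 in H; lra].
    apply (derive_nonneg_le (fun t => P t + (t ^ 3 - 3 / 4 * t ^ 4))
       (fun t => V t + (3 * t ^ 2 - 3 * t ^ 3))); [lra| |].
    - intros s _. pose proof (HdP s) as d. derive_tac. field.
    - intros s Hs. specialize (HV1 s ltac:(lra)). lra. }
  assert (HPl : forall t, 2 / 3 <= t <= 5 / 3 -> 11 / 27 <= P t).
  { intros t Ht.
    assert (P (2 / 3) + 4 / 9 * (2 / 3) <= P t + 4 / 9 * t); [|lra].
    apply (derive_nonneg_le (fun t => P t + 4 / 9 * t) (fun t => V t + 4 / 9)); [lra| |].
    - intros s _. pose proof (HdP s) as d. derive_tac.
    - intros s Hs. pose proof (limit_V_incr (2 / 3) s ltac:(lra) ltac:(lra)). lra. }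
  assert (HP1 : forall t, 0 <= t -> P t <= 1).
  { intros t Ht. apply (P_le_1 r 0 b P V A B Hf); [exact Ht|].
    intros s Hs. apply HV. lra. }
  assert (V (2 / 3) - 11 / 27 * (3 * (2 / 3) ^ 3 - 3 * (2 / 3) ^ 2)
          <= V (5 / 3) - 11 / 27 * (3 * (5 / 3) ^ 3 - 3 * (5 / 3) ^ 2)).
  { apply (derive_nonneg_le (fun t => V t - 11 / 27 * (3 * t ^ 3 - 3 * t ^ 2))
       (fun t => clip (P t) * potential 0 P A t - 11 / 27 * (9 * t ^ 2 - 6 * t))); [lra| |].
    - intros s _. pose proof (HdV s) as d. derive_tac.
    - intros s Hs. specialize (HPl s ltac:(lra)). specialize (HP1 s ltac:(lra)).
      rewrite limit_potential, Hb0, (clip_id (P s)) by lra.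
      assert (0 <= 9 * s ^ 2 - 6 * s) by nra.
      replace (P s * ((3 * s - 1) ^ 2 - 1) - 11 / 27 * (9 * s ^ 2 - 6 * s))
        with ((P s - 11 / 27) * (9 * s ^ 2 - 6 * s)) by ring.
      apply Rmult_le_pos; lra. }
  pose proof (HV (5 / 3) ltac:(lra)). lra.
Qed.

(* At the first turning point the virial equals [P^2 (A^2 - 1) > 0]; it is still positive
   slightly before. *)
Lemma turns_virial : turns V -> exists t, 1 / 8 < t /\ 0 < virial 0 P V A t /\
  (forall s, 0 < s <= t -> V s < 0) /\ (forall s, 0 <= s <= t -> 0 < P s).
Proof.
  intros HT. assert (HP := P_pos (fun H => not_hits_and_turns H HT)).
  destruct HT as [t2 [Ht2 HV2]].
  assert (HdP := dP r 0 b P V A B Hf). assert (HdV := dV r 0 b P V A B Hf).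
  assert (Hearly := V_neg_early r 0 b P V A B Hr H0 Hb Hf).
  assert (Ht2' : 1 / 8 < t2).
  { apply Rnot_le_lt. intros Hle. destruct Ht2 as [Ht2 | <-].
    - specialize (Hearly t2 ltac:(lra)). lra.
    - destruct (family_0 r 0 b P V A B Hf) as [_ [V0 _]]. lra. }
  destruct (first_zero (fun t => - V t) (1 / 8) t2) as [M [HM1 [HM2 HM3]]]; [lra| | |lra|].
  { intros u _. apply continuity_pt_opp. eapply is_derive_continuity_pt, HdV. }
  { specialize (Hearly (1 / 8) ltac:(lra)). lra. }
  assert (HbM : 2 < b * M).
  { apply Rnot_le_lt. intros Hle. pose proof (limit_V_neg M ltac:(lra) Hle). lra. }
  assert (HVn : forall s, 0 < s < M -> V s < 0).
  { intros s Hs. destruct (Rle_lt_dec s (1 / 8)) as [Hle | Hlt].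
    - apply Hearly. lra.
    - specialize (HM3 s ltac:(lra)). lra. }
  assert (HPM : 0 <= P M <= 1).
  { specialize (HP M ltac:(lra)). split; [lra|].
    apply (P_le_1 r 0 b P V A B Hf); [lra|]. intros s Hs. left. apply HVn, Hs. }
  assert (HY : 0 < virial 0 P V A M).
  { unfold virial. replace (V M) with 0 by lra. rewrite limit_A.
    specialize (HP M ltac:(lra)). assert (0 < P M ^ 2) by nra.
    assert (0 < (b * M - 1) ^ 2 - 1) by nra.
    assert (0 < P M ^ 2 * ((b * M - 1) ^ 2 - 1)) by (apply Rmult_lt_0_compat; lra). lra. }
  destruct (continuity_pt_pos (virial 0 P V A) M) as [e [He H]].
  - eapply is_derive_continuity_pt, (virial_derive r 0 b P V A B Hf M HPM).
  - exact HY.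
  - pose proof (Rmax_l ((M + 1 / 8) / 2) (M - e / 2)).
    pose proof (Rmax_r ((M + 1 / 8) / 2) (M - e / 2)).
    assert (Rmax ((M + 1 / 8) / 2) (M - e / 2) < M) by (apply Rmax_lub_lt; lra).
    exists (Rmax ((M + 1 / 8) / 2) (M - e / 2)). split; [lra|]. split.
    + apply H. rewrite Rabs_left; lra.
    + split; intros s Hs; [apply HVn | apply HP]; lra.
Qed.

End OneTrajectory.

Section TwoTrajectories.

Variables (r b b' : R) (P V A B P' V' A' B' : R -> R).
Hypothesis Hr : 0 < r <= 2.01.
Hypothesis Hb : 1 <= b <= 4.
Hypothesis Hb' : 1 <= b' <= 4.
Hypothesis Hbb : b < b'.
Hypothesis Hf : family r 0 b P V A B.
Hypothesis Hf' : family r 0 b' P' V' A' B'.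

(* In the variable [x = (b t - 1) / sqrt b] the equation reads [u'' = (x^2 - 1/b) u], so
   at equal [x] the Wronskian of the two trajectories is increasing. In the
   proof [tau] maps the time of the second trajectory to that of the first. *)
Lemma rescaled_exclusion : ~ hits P -> ~ turns V' -> False.
Proof.
  intros HnP HnV.
  set (rho := sqrt (b / b')).
  assert (Hq : 0 < b / b') by (apply Rdiv_lt_0_compat; lra).
  assert (Hq1 : b / b' < 1).
  { apply Rmult_lt_reg_r with b'; [lra|]. unfold Rdiv. rewrite Rmult_assoc, Rinv_l; lra. }
  assert (Hrho2 : rho ^ 2 = b / b') by (unfold rho; rewrite pow2_sqrt; lra).
  assert (Hrho : 0 < rho) by (apply sqrt_lt_R0, Hq).
  assert (Hrho1 : rho < 1) by nra.
  assert (Hrb : rho * b' = b / rho).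
  { apply Rmult_eq_reg_r with rho; [|lra].
    replace (rho * b' * rho) with (rho ^ 2 * b') by ring. rewrite Hrho2. field. lra. }
  pose (tau := fun t => (rho * (b' * t - 1) + 1) / b).
  assert (Htau0 : 0 < tau 0).
  { unfold tau. apply Rdiv_lt_0_compat; lra. }
  assert (Htau_inc : forall t, tau t = tau 0 + t / rho).
  { intros t. unfold tau. apply Rmult_eq_reg_r with b; [|lra].
    replace ((rho * (b' * t - 1) + 1) / b * b) with (rho * b' * t - rho + 1) by (field; lra).
    rewrite Hrb. field. lra. }
  assert (Hinv : 0 < / rho) by (apply Rinv_0_lt_compat; lra).
  assert (HP := P_pos r b P V A B Hr Hb Hf HnP).
  assert (HV' := V_nonpos V' HnV).
  assert (HdP := dP r 0 b P V A B Hf). assert (HdV := dV r 0 b P V A B Hf).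
  assert (HdP' := dP r 0 b' P' V' A' B' Hf'). assert (HdV' := dV r 0 b' P' V' A' B' Hf').
  assert (HdT : forall t, is_derive tau t (/ rho)).
  { intros t. apply (is_derive_ext (fun t => tau 0 + t / rho)).
    - intros s. symmetry. apply Htau_inc.
    - auto_derive; [easy | field; lra]. }
  destruct (family_0 r 0 b' P' V' A' B' Hf') as [P0' [V0' _]].
  (* When the second trajectory starts at its maximum, the first one is already past its own; hence
     the Wronskian [W] starts positive. *)
  assert (HV0 : V (tau 0) < 0).
  { apply (limit_V_neg r b P V A B Hr Hb Hf); [exact Htau0|].
    unfold tau. replace (b * ((rho * (b' * 0 - 1) + 1) / b)) with (1 - rho) by (field; lra). lra. }
  assert (HP'1 : forall t, 0 <= t -> P' t <= 1).
  { intros t Ht. apply (P_le_1 r 0 b' P' V' A' B' Hf'); [exact Ht|].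
    intros s Hs. apply HV'. lra. }
  pose (W := fun t => V' t * P (tau t) - P' t * V (tau t) / rho).
  assert (HVneg : forall s, 0 <= s -> (forall t, 0 <= t < s -> V (tau t) < 0) ->
            forall u, 0 < u < tau s -> V u < 0).
  { intros s Hs Hlt u Hu. destruct (Rle_lt_dec u (tau 0)) as [Hu0 | Hu0].
    - apply (limit_V_neg r b P V A B Hr Hb Hf); [lra|].
      assert (b * tau 0 <= 1); [|nra].
      unfold tau. replace (b * ((rho * (b' * 0 - 1) + 1) / b)) with (1 - rho) by (field; lra). lra.
    - pose proof (Htau_inc s) as Hts. pose proof (Htau_inc ((u - tau 0) * rho)) as Htu.
      replace ((u - tau 0) * rho / rho) with (u - tau 0) in Htu by (field; lra).
      replace u with (tau ((u - tau 0) * rho)) by lra. apply Hlt.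
      split; [apply Rmult_le_pos; lra|].
      assert (Hus : u - tau 0 < s / rho) by lra.
      apply Rmult_lt_compat_r with (r := rho) in Hus; [|lra].
      replace (s / rho * rho) with s in Hus by (field; lra). exact Hus. }
  assert (HW : forall s, 0 <= s ->
     (forall t, 0 <= t < s -> 0 < P' t) -> (forall t, 0 <= t < s -> V (tau t) < 0) ->
     - V (tau 0) / rho <= W s).
  { intros s Hs HPs HVs.
    assert (HW0 : W 0 = - V (tau 0) / rho) by (unfold W; rewrite V0', P0'; field; lra).
    rewrite <- HW0. specialize (HVneg s Hs HVs).
    apply (derive_nonneg_le W (fun t =>
      clip (P' t) * potential 0 P' A' t * P (tau t)
      - P' t * (clip (P (tau t)) * potential 0 P A (tau t)) / rho ^ 2)); [exact Hs | |].
    - intros t _. pose proof (HdP (tau t)) as d1. pose proof (HdV (tau t)) as d2.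
      pose proof (HdP' t) as d3. pose proof (HdV' t) as d4. pose proof (HdT t) as d5.
      assert (d6 := is_derive_comp P tau t _ _ d1 d5).
      assert (d7 := is_derive_comp V tau t _ _ d2 d5).
      unfold scal in d6, d7; simpl in d6, d7; unfold mult in d6, d7; simpl in d6, d7.
      pose (Pt := fun x => P (tau x)). pose (Vt := fun x => V (tau x)).
      change (is_derive Pt t (/ rho * V (tau t))) in d6.
      change (is_derive Vt t (/ rho * (clip (P (tau t)) * potential 0 P A (tau t)))) in d7.
      unfold W. change (fun t => V' t * P (tau t) - P' t * V (tau t) / rho)
        with (fun t => V' t * Pt t - P' t * Vt t / rho).
      clear d1 d2 d5. auto_derive.
      + repeat split; eexists; eassumption.
      + derive_subst. unfold Pt, Vt. field. lra.
    - intros t Ht.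
      rewrite (limit_potential r b P V A B Hf), (limit_potential r b' P' V' A' B' Hf').
      assert (0 < tau t).
      { rewrite Htau_inc. assert (0 < t / rho) by (apply Rdiv_lt_0_compat; lra). lra. }
      assert (Hts : tau t < tau s).
      { rewrite (Htau_inc t), (Htau_inc s). unfold Rdiv. nra. }
      specialize (HP (tau t) ltac:(lra)). specialize (HPs t ltac:(lra)).
      assert (P (tau t) <= 1).
      { apply (P_le_1 r 0 b P V A B Hf); [lra|]. intros u Hu. left. apply HVneg. lra. }
      specialize (HP'1 t ltac:(lra)). rewrite !clip_id by lra.
      assert (Hx : b * tau t - 1 = rho * (b' * t - 1)) by (unfold tau; field; lra).
      rewrite Hx.
      replace (P' t * ((b' * t - 1) ^ 2 - 1) * P (tau t) -
        P' t * (P (tau t) * ((rho * (b' * t - 1)) ^ 2 - 1)) / rho ^ 2)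
        with (P' t * P (tau t) * (/ rho ^ 2 - 1)) by (field; lra).
      apply Rmult_le_pos; [apply Rmult_le_pos; lra|].
      assert (1 <= / rho ^ 2); [|lra].
      rewrite <- Rinv_1. apply Rinv_le_contravar; nra. }
  assert (Hpos0 : 0 < - V (tau 0) / rho) by (apply Rdiv_lt_0_compat; lra).
  (* At a first failure one factor of P' V(tau) vanishes, so W reduces to V' P(tau) <= 0, against
     the positive lower bound [HW]. *)
  assert (Hall : forall s, 0 <= s -> 0 < Rmin (P' s) (- V (tau s))).
  { intros s Hs. apply Rnot_le_lt. intros Hle.
    destruct (first_zero (fun t => Rmin (P' t) (- V (tau t))) 0 s Hs)
      as [z [Hz1 [Hz2 Hz3]]].
    - intros u _. apply continuity_pt_Rmin.
      + eapply is_derive_continuity_pt, HdP'.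
      + apply continuity_pt_opp. apply (continuity_pt_comp tau V).
        * eapply is_derive_continuity_pt, HdT.
        * eapply is_derive_continuity_pt, HdV.
    - rewrite P0'. apply Rmin_glb_lt; lra.
    - exact Hle.
    - assert (Hz4 : forall t, 0 <= t < z -> 0 < P' t /\ V (tau t) < 0).
      { intros t Ht. specialize (Hz3 t Ht).
        pose proof (Rmin_l (P' t) (- V (tau t))). pose proof (Rmin_r (P' t) (- V (tau t))). lra. }
      specialize (HW z ltac:(lra) (fun t Ht => proj1 (Hz4 t Ht)) (fun t Ht => proj2 (Hz4 t Ht))).
      assert (Hz5 : P' z * V (tau z) = 0).
      { unfold Rmin in Hz2. destruct (Rle_dec (P' z) (- V (tau z))).
        - rewrite Hz2. ring.
        - replace (V (tau z)) with 0 by lra. ring. }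
      unfold W, Rdiv in HW. rewrite Hz5 in HW.
      assert (0 < tau z).
      { rewrite Htau_inc. assert (0 < z / rho) by (apply Rdiv_lt_0_compat; lra). lra. }
      pose proof (HP (tau z) ltac:(lra)). pose proof (HV' z ltac:(lra)).
      unfold Rdiv in Hpos0. nra. }
  assert (Hall' : forall s, 0 <= s -> 0 < P' s /\ V (tau s) < 0).
  { intros s Hs. specialize (Hall s Hs).
    pose proof (Rmin_l (P' s) (- V (tau s))). pose proof (Rmin_r (P' s) (- V (tau s))). lra. }
  (* Now w <= W <= -V(T)/rho while -V(T) <= 2/T by [V_decay]; T is chosen so large that w rho T >=
     3. *)
  set (w := - V (tau 0) / rho) in *.
  set (T := Rmax 16 (3 / (w * rho)) + tau 0).
  assert (Hwr : 0 < w * rho) by (apply Rmult_lt_0_compat; lra).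
  assert (HT16 : 16 <= T) by (unfold T; pose proof (Rmax_l 16 (3 / (w * rho))); lra).
  assert (HT3 : 3 / (w * rho) <= T) by (unfold T; pose proof (Rmax_r 16 (3 / (w * rho))); lra).
  set (s := (T - tau 0) * rho).
  assert (Hs : 0 <= s).
  { unfold s, T. apply Rmult_le_pos; [|lra]. pose proof (Rmax_l 16 (3 / (w * rho))). lra. }
  assert (Hts : tau s = T) by (rewrite Htau_inc; unfold s; field; lra).
  assert (HVT : forall t, 0 < t <= T -> V t <= 0).
  { intros t Ht. left. apply (HVneg (s + 1) ltac:(lra)).
    (* [HVneg] yields an open interval; using s + 1 instead of s includes the end point T. *)
    - intros u Hu. apply Hall'. lra.
    - rewrite (Htau_inc (s + 1)). rewrite (Htau_inc s) in Hts.
      replace ((s + 1) / rho) with (s / rho + / rho) by (field; lra). lra. }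
  assert (Hdec := V_decay r 0 b P V A B Hr ltac:(lra) Hb Hf T HT16 HVT
    (fun t Ht => Rlt_le _ _ (HP t ltac:(lra)))).
  specialize (HW s Hs (fun t Ht => proj1 (Hall' t (proj1 Ht)))
     (fun t Ht => proj2 (Hall' t (proj1 Ht)))).
  unfold W in HW. rewrite Hts in HW.
  pose proof (HV' s Hs). pose proof (HP'1 s Hs). destruct (Hall' s Hs) as [HP's HVs].
  rewrite Hts in HVs. pose proof (HP T ltac:(lra)).
  assert (Hw1 : w <= - V T / rho).
  { eapply Rle_trans; [exact HW|]. unfold Rdiv.
    assert (V' s * P T <= 0) by nra.
    assert (0 <= - V T * / rho) by (apply Rmult_le_pos; lra). nra. }
  assert (Hw2 : w * rho <= - V T).
  { apply Rmult_le_compat_r with (r := rho) in Hw1; [|lra].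
    replace (- V T / rho * rho) with (- V T) in Hw1 by (field; lra). exact Hw1. }
  assert (3 <= w * rho * T).
  { apply Rmult_le_compat_l with (r := w * rho) in HT3; [|lra].
    replace (w * rho * (3 / (w * rho))) with 3 in HT3 by (field; split; nra). exact HT3. }
  nra.
Qed.

End TwoTrajectories.

(** * The left end point *)

Lemma backward_increment (f f' : R -> R) (K s : R) :
  0 <= s -> (forall t, - s <= t <= 0 -> is_derive f t (f' t)) ->
  (forall t, - s <= t <= 0 -> Rabs (f' t) <= K) -> Rabs (f (- s) - f 0) <= K * s.
Proof.
  intros Hs Hd HK. destruct (Req_dec s 0) as [-> | Hs0].
  { rewrite Ropp_0, Rminus_diag, Rabs_R0. lra. }
  destruct (mean_value f f' (- s) 0) as [c [Hc1 Hc2]]; [lra | exact Hd |].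
  replace (f (- s) - f 0) with (- (f' c * s)) by lra.
  rewrite Rabs_Ropp, Rabs_mult, (Rabs_pos_eq s) by lra.
  apply Rmult_le_compat_r; [lra|]. apply HK. lra.
Qed.

Section LeftEnd.

Variables (r beta b : R) (P V A B : R -> R).
Hypothesis Hr : 0 < r <= 2.01.
Hypothesis Hbeta : 0 < beta <= 1 / 10000.
Hypothesis Hb : 1 <= b <= 4.
Hypothesis Hf : family r beta b P V A B.

Let H100 : 0 <= beta <= 1 / 100.
Proof. lra. Qed.

Lemma left_A_crude s : 0 <= s <= 4 * beta -> Rabs (A (- s)) <= 6.
Proof.
  intros Hs.
  destruct (flow_AB_bound (fun _ => True) r _ _ b P V A B 1 Hf (fun _ _ => I) Hr
      ltac:(nra) ltac:(lra) Hb (- s)) as [HA _].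
  { rewrite Rabs_Ropp, Rabs_pos_eq; lra. }
  eapply Rle_trans; [exact HA|]. rewrite Rabs_Ropp, Rabs_pos_eq by lra.
  unfold field_bound.
  assert (He : exp (2 * s) * (1 - 2 * s) <= 1).
  { pose proof (exp_ineq1_le (- (2 * s))).
    assert (exp (2 * s) * exp (- (2 * s)) = 1).
    { rewrite <- exp_plus. replace (2 * s + - (2 * s)) with 0 by ring. apply exp_0. }
    pose proof (exp_pos (2 * s)). nra. }
  pose proof (exp_pos (2 * s)). nra.
Qed.

Lemma left_B s : 0 <= s <= 4 * beta -> Rabs (B (- s) - b) <= beta ^ 2.
Proof.
  intros Hs. destruct (family_0 r beta b P V A B Hf) as [_ [_ [_ B0]]].
  rewrite <- B0.
  eapply Rle_trans.
  - apply (backward_increment B (fun t => r * beta ^ 2 * clip (P t) ^ 2 * A t)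
             (2.01 * beta ^ 2 * 6)); [lra | intros; apply (dB r beta b P V A B Hf) |].
    intros t Ht. pose proof (coupling_bound r beta P Hr t).
    apply Rabs_mult_le; [rewrite Rabs_pos_eq; lra|].
    replace t with (- - t) by ring. apply left_A_crude. lra.
  - assert (0 <= beta ^ 2) by nra. nra.
Qed.

Lemma left_A s : 0 <= s <= 4 * beta -> Rabs (A (- s) - (beta - 1 - b * s)) <= beta ^ 2.
Proof.
  intros Hs. destruct (family_0 r beta b P V A B Hf) as [_ [_ [A0 _]]].
  assert (H : Rabs ((fun t => A t - b * t) (- s) - (fun t => A t - b * t) 0) <= beta ^ 2 * s).
  { apply (backward_increment (fun t => A t - b * t) (fun t => B t - b)); [lra | |].
    - intros t _. pose proof (dA r beta b P V A B Hf t) as d. derive_tac.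
    - intros t Ht. replace t with (- - t) by ring. apply left_B. lra. }
  simpl in H. rewrite A0 in H.
  replace (A (- s) - (beta - 1 - b * s)) with (A (- s) - b * - s - (beta - 1 - b * 0)) by ring.
  eapply Rle_trans; [exact H|]. assert (0 <= beta ^ 2) by nra. simpl in *. nra.
Qed.

(** Squaring A(-s) = -(1 - (beta - b s)) up to an error beta^2 leaves A^2 - 1 = -2 (beta - b s) up
    to order beta^2. *)
Lemma left_A_sq s : 0 <= s <= 4 * beta ->
  Rabs (A (- s) ^ 2 - 1 + 2 * beta - 2 * b * s) <= 300 * beta ^ 2.
Proof.
  intros Hs. pose proof (left_A s Hs) as HA.
  set (x := beta - 1 - b * s) in *.
  assert (Hbs : 0 <= b * s <= 16 * beta) by nra.
  assert (Hb2 : 0 <= beta ^ 2 <= beta / 10000) by nra.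
  replace (A (- s) ^ 2 - 1 + 2 * beta - 2 * b * s)
    with ((A (- s) - x) * (A (- s) + x) + (beta - b * s) ^ 2) by (unfold x; ring).
  assert (H1 : Rabs (A (- s) + x) <= 3).
  { apply Rabs_le_between in HA. apply Rabs_le. unfold x in *. lra. }
  assert (H2 : Rabs ((A (- s) - x) * (A (- s) + x)) <= beta ^ 2 * 3)
    by (apply Rabs_mult_le; assumption).
  assert (H3 : 0 <= (beta - b * s) ^ 2 <= 256 * beta ^ 2).
  { split; [apply pow2_ge_0|]. replace (256 * beta ^ 2) with ((16 * beta) ^ 2) by ring.
    apply pow_maj_Rabs. apply Rabs_le. lra. }
  apply Rabs_le_between in H2. apply Rabs_le. lra.
Qed.

Lemma left_A_sq_bound s : 0 <= s <= 4 * beta -> Rabs (A (- s) ^ 2 - 1) <= 39 * beta.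
Proof.
  intros Hs. pose proof (left_A_sq s Hs) as HA. apply Rabs_le_between in HA.
  assert (Hbs : 0 <= b * s <= 16 * beta) by nra.
  assert (Hb2 : 0 <= beta ^ 2 <= beta / 10000) by nra.
  apply Rabs_le. lra.
Qed.

Lemma left_potential s : 0 <= s <= 4 * beta ->
  Rabs (potential beta P A (- s)) <= 40 * beta /\
  Rabs (potential beta P A (- s) + 2 * beta - 2 * b * s) <= 301 * beta ^ 2.
Proof.
  intros Hs. pose proof (left_A_sq s Hs) as HA. pose proof (left_A_sq_bound s Hs) as HA'.
  assert (Hb2 : 0 <= beta ^ 2 <= beta / 10000) by nra.
  pose proof (clip_bounds (P (- s))). assert (0 <= clip (P (- s)) ^ 2 <= 1) by nra.
  assert (0 <= beta ^ 2 * clip (P (- s)) ^ 2 <= beta ^ 2) by nra.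
  unfold potential. apply Rabs_le_between in HA. apply Rabs_le_between in HA'.
  split; apply Rabs_le; lra.
Qed.

Lemma left_P s : 0 <= s <= 4 * beta -> Rabs (P (- s) - 1) <= beta ^ 2.
Proof.
  intros Hs. destruct (family_0 r beta b P V A B Hf) as [P0 [V0 _]].
  assert (HV : forall u, 0 <= u <= 4 * beta -> Rabs (V (- u)) <= 160 * beta ^ 2).
  { intros u Hu. replace (V (- u)) with (V (- u) - V 0) by lra.
    apply Rle_trans with (40 * beta * u); [|simpl; nra].
    apply (backward_increment V (fun t => clip (P t) * potential beta P A t)); [lra | |].
    - intros; apply (dV r beta b P V A B Hf).
    - intros t Ht. replace (40 * beta) with (1 * (40 * beta)) by ring. apply Rabs_mult_le.
      + pose proof (clip_bounds (P t)). rewrite Rabs_pos_eq; lra.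
      + replace t with (- - t) by ring. apply left_potential. lra. }
  rewrite <- P0. eapply Rle_trans.
  - apply (backward_increment P V (160 * beta ^ 2)); [lra | |].
    + intros; apply (dP r beta b P V A B Hf).
    + intros t Ht. replace t with (- - t) by ring. apply HV. lra.
  - assert (0 <= beta ^ 2) by nra. nra.
Qed.

Lemma left_force s : 0 <= s <= 4 * beta ->
  Rabs (clip (P (- s)) * potential beta P A (- s) + 2 * beta - 2 * b * s) <= 302 * beta ^ 2.
Proof.
  intros Hs. destruct (left_potential s Hs) as [H1 H2]. pose proof (left_P s Hs) as HP.
  assert (Hc : Rabs (clip (P (- s)) - 1) <= beta ^ 2).
  { rewrite <- (clip_id 1) by lra. eapply Rle_trans; [apply clip_lip | exact HP]. }
  replace (clip (P (- s)) * potential beta P A (- s) + 2 * beta - 2 * b * s) with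
    ((clip (P (- s)) - 1) * potential beta P A (- s)
      + (potential beta P A (- s) + 2 * beta - 2 * b * s)) by ring.
  eapply Rle_trans; [apply Rabs_triang|].
  assert (Rabs ((clip (P (- s)) - 1) * potential beta P A (- s)) <= beta ^ 2 * (40 * beta))
    by (apply Rabs_mult_le; assumption).
  assert (0 <= beta ^ 2) by nra. nra.
Qed.

(** The comparison parabola has its positive root at s = 2 beta / b, the leading term of m. *)
Lemma left_V s : 0 <= s <= 4 * beta ->
  Rabs (V (- s) - s * (2 * beta - b * s)) <= 302 * beta ^ 2 * s.
Proof.
  intros Hs. destruct (family_0 r beta b P V A B Hf) as [_ [V0 _]].
  assert (H : Rabs ((fun t => V t + t * (2 * beta + b * t)) (- s)
             - (fun t => V t + t * (2 * beta + b * t)) 0) <= 302 * beta ^ 2 * s).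
  { apply (backward_increment (fun t => V t + t * (2 * beta + b * t))
      (fun t => clip (P t) * potential beta P A t + 2 * beta + 2 * b * t)); [lra | |].
    - intros t _. pose proof (dV r beta b P V A B Hf t) as d. derive_tac.
    - intros t Ht.
      replace (clip (P t) * potential beta P A t + 2 * beta + 2 * b * t) with
        (clip (P (- - t)) * potential beta P A (- - t) + 2 * beta - 2 * b * (- t))
        by (rewrite Ropp_involutive; ring).
      apply left_force. lra. }
  cbv beta in H. rewrite V0 in H.
  replace (V (- s) - s * (2 * beta - b * s)) with
    (V (- s) + - s * (2 * beta + b * - s) - (0 + 0 * (2 * beta + b * 0))) by ring.
  exact H.
Qed.

Lemma left_endpoint : exists m, (0 < m <= 3 * beta /\ V (- m) = 0) /\
  (forall t, - m < t < 0 -> 0 < V t) /\ (forall t, - (4 * beta) <= t < - m -> V t < 0) /\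
  (forall t, - m <= t <= 0 -> 1 / 2 <= P t <= 1) /\
  beta <= virial beta P V A (- m) <= 3 * beta /\ b < B (- m) <= b + beta ^ 2.
Proof.
  assert (Hb2 : 0 <= beta ^ 2 <= beta / 10000) by nra.
  assert (Hs1 : forall k, 0 < k -> k * beta / b * b = k * beta) by (intros; field; lra).
  assert (Hs2 : forall k, 0 < k -> 0 < k * beta / b <= k * beta).
  { intros k Hk. split.
    - apply Rdiv_lt_0_compat; nra.
    - apply Rmult_le_reg_r with b; [lra|]. rewrite Hs1 by exact Hk.
      assert (0 < k * beta) by nra. nra. }
  (* The root 2 beta / b is bracketed with margin 0.1 beta in the factor 2 beta - b s. The error 302
     beta^2 stays below 0.05 beta, which is where beta <= 1/10000 comes from. *)
  pose proof (Hs1 1.9 ltac:(lra)) as E1. pose proof (Hs1 2.1 ltac:(lra)) as E2.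
  pose proof (Hs2 1.9 ltac:(lra)) as F1. pose proof (Hs2 2.1 ltac:(lra)) as F2.
  set (s1 := 1.9 * beta / b) in *. set (s2 := 2.1 * beta / b) in *.
  assert (Hs12 : s1 < s2) by nra.
  assert (Hearly : forall s, 0 < s <= s1 -> 0 < V (- s)).
  { intros s Hs. pose proof (left_V s ltac:(lra)) as H. apply Rabs_le_between in H.
    assert (b * s <= 1.9 * beta) by nra.
    assert (s * (0.1 * beta) <= s * (2 * beta - b * s)) by (apply Rmult_le_compat_l; lra).
    assert (302 * beta ^ 2 * s <= 0.05 * beta * s) by (apply Rmult_le_compat_r; lra).
    assert (0 < beta * s) by nra. lra. }
  assert (Hlate : V (- s2) < 0).
  { pose proof (left_V s2 ltac:(lra)) as H. apply Rabs_le_between in H.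
    replace (b * s2) with (2.1 * beta) in H by lra.
    assert (302 * beta ^ 2 * s2 <= 0.05 * beta * s2) by (apply Rmult_le_compat_r; lra).
    assert (0 < beta * s2) by nra. lra. }
  assert (Hdrev : forall s, is_derive (fun s => V (- s)) s
            (- (clip (P (- s)) * potential beta P A (- s)))).
  { intros s. assert (d := is_derive_comp V (fun s => - s) s _ (-1)
      (dV r beta b P V A B Hf (- s)) ltac:(auto_derive; [easy | ring])).
    unfold scal in d; simpl in d; unfold mult in d; simpl in d.
    replace (- (clip (P (- s)) * potential beta P A (- s)))
      with (-1 * (clip (P (- s)) * potential beta P A (- s))) by ring. exact d. }
  destruct (first_zero (fun s => V (- s)) s1 s2) as [m [Hm1 [Hm2 Hm3]]]; [lra| | |lra|].
  { intros u _. eapply is_derive_continuity_pt, Hdrev. }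
  { apply Hearly. lra. }
  assert (HVpos : forall t, - m < t < 0 -> 0 < V t).
  { intros t Ht. replace t with (- - t) by ring.
    destruct (Rle_lt_dec (- t) s1) as [Hle | Hlt].
    - apply Hearly. lra.
    - apply Hm3. lra. }
  assert (Hbm : 1.9 * beta <= b * m <= 2.1 * beta) by nra.
  destruct (family_0 r beta b P V A B Hf) as [P0 [V0 [A0 B0]]].
  assert (HPb : forall t, - m <= t <= 0 -> 1 / 2 <= P t <= 1).
  { intros t Ht. split.
    - pose proof (left_P (- t) ltac:(lra)) as H. rewrite Ropp_involutive in H.
      apply Rabs_le_between in H. lra.
    - rewrite <- P0. apply (derive_nonneg_le P V); [lra | |].
      + intros; apply (dP r beta b P V A B Hf).
      + intros u Hu. left. apply HVpos. lra. }
  exists m. split; [split; [lra | exact Hm2]|]. split; [exact HVpos|]. split; [|split; [exact HPb|split]].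
  (* To the left of -m one has b s >= 1.9 beta, so the force, about 2 b s - 2 beta, is positive and
     V cannot vanish again in the window. *)
  - intros t Ht. rewrite <- Hm2. replace t with (- - t) by ring.
    apply (derive_neg_lt (fun s => V (- s))
      (fun s => - (clip (P (- s)) * potential beta P A (- s)))); [lra | |].
    + intros; apply Hdrev.
    + intros s Hs. pose proof (left_force s ltac:(lra)) as H. apply Rabs_le_between in H.
      assert (1.9 * beta <= b * s) by nra. lra.
  (* P is close to 1 and V = 0, so Y(-m) is about A^2 - 1, about 2 b m - 2 beta, that is 2 beta. *)
  - unfold virial. rewrite Hm2.
    pose proof (left_A_sq m ltac:(lra)) as H. apply Rabs_le_between in H.
    pose proof (left_P m ltac:(lra)) as HP. apply Rabs_le_between in HP.
    pose proof (HPb (- m) ltac:(lra)).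
    assert (HP2 : 0.9 <= P (- m) ^ 2 <= 1) by nra.
    assert (0 <= beta ^ 2 * P (- m) ^ 4 / 2 <= beta / 10000).
    { replace (P (- m) ^ 4) with (P (- m) ^ 2 * P (- m) ^ 2) by ring.
      assert (0 <= P (- m) ^ 2 * P (- m) ^ 2 <= 1) by nra. nra. }
    assert (1.7 * beta <= A (- m) ^ 2 - 1 <= 2.3 * beta) by lra.
    nra.
  - split.
    + rewrite <- B0. apply (derive_neg_lt B (fun t => r * beta ^ 2 * clip (P t) ^ 2 * A t)); [lra| |].
      * intros; apply (dB r beta b P V A B Hf).
      * intros t Ht. pose proof (HPb t ltac:(lra)). rewrite (clip_id (P t)) by lra.
        pose proof (left_A (- t) ltac:(lra)) as HA. rewrite Ropp_involutive in HA.
        apply Rabs_le_between in HA.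
        assert (A t < 0) by nra. assert (0 < P t ^ 2) by nra.
        assert (0 < beta ^ 2) by nra.
        assert (0 < r * beta ^ 2 * P t ^ 2) by (repeat apply Rmult_lt_0_compat; lra).
        nra.
    + pose proof (left_B m ltac:(lra)) as H. apply Rabs_le_between in H. lra.
Qed.

End LeftEnd.

(** * Shooting at fixed beta *)

Lemma compact_positive (f : R -> R) (x y : R) :
  x <= y -> (forall t, x <= t <= y -> continuity_pt f t) ->
  (forall t, x <= t <= y -> 0 < f t) ->
  exists mu, 0 < mu /\ forall t, x <= t <= y -> mu <= f t.
Proof.
  intros Hxy Hc Hp. destruct (continuity_ab_min f x y Hxy Hc) as [t0 [H1 H2]].
  exists (f t0). split; [apply Hp, H2 | exact H1].
Qed.

Lemma continuity_pt_close (f : R -> R) (t e : R) :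
  continuity_pt f t -> 0 < e -> exists d, 0 < d /\ forall s, Rabs (s - t) < d -> Rabs (f s - f t) < e.
Proof.
  intros Hc He. destruct (Hc e He) as [d [Hd H]]. exists d. split; [exact Hd|].
  intros s Hs. destruct (Req_dec s t) as [-> | Hne].
  - rewrite Rminus_diag, Rabs_R0. exact He.
  - apply H. split; [split; [exact I | congruence] | exact Hs].
Qed.

(** The sign pattern of V on [-4 beta, 0] pins m down; this yields continuity in b although m is
    obtained by choice. The window exceeds the bound 3 beta on m to leave room on both sides. *)
Definition left_spec (beta b : R) (P V A B : R -> R) (m : R) : Prop :=
  (0 < m <= 3 * beta /\ V (- m) = 0) /\
  (forall t, - m < t < 0 -> 0 < V t) /\ (forall t, - (4 * beta) <= t < - m -> V t < 0) /\
  (forall t, - m <= t <= 0 -> 1 / 2 <= P t <= 1) /\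
  beta <= virial beta P V A (- m) <= 3 * beta /\ b < B (- m) <= b + beta ^ 2.

Definition right_spec (P V B : R -> R) (m M : R) : Prop :=
  1 / 8 < M /\ V M = 0 /\ (forall t, 0 < t < M -> V t < 0) /\
  (forall t, 0 <= t <= M -> 0 < P t <= 1) /\ B M = B (- m).

Section FixedBeta.

Variables (r beta : R) (P V A B : R -> R -> R) (m : R -> R).
Hypothesis Hr : 0 < r <= 2.01.
Hypothesis Hbeta : 0 < beta <= 1 / 10000.
Hypothesis Hf : forall b, 1 <= b <= 4 -> family r beta b (P b) (V b) (A b) (B b).
Hypothesis Hm : forall b, 1 <= b <= 4 -> left_spec beta b (P b) (V b) (A b) (B b) (m b).

Let H100 : 0 <= beta <= 1 / 100.
Proof. lra. Qed.

Lemma dep_b (T : R) : 0 <= T -> exists C, 1 <= C /\ forall b b', 1 <= b <= 4 -> 1 <= b' <= 4 ->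
  forall t, Rabs t <= T ->
    Rabs (P b t - P b' t) <= C * Rabs (b - b') /\ Rabs (V b t - V b' t) <= C * Rabs (b - b') /\
    Rabs (B b t - B b' t) <= C * Rabs (b - b').
Proof.
  intros HT. destruct (family_dep T HT) as [C [HC H]]. exists C. split; [exact HC|].
  intros b b' Hb Hb' t Ht.
  destruct (H r beta beta b b' _ _ _ _ _ _ _ _ Hr ltac:(lra) ltac:(lra) Hb Hb'
    (Hf b Hb) (Hf b' Hb') t Ht) as [H1 [H2 [_ H3]]].
  rewrite Rminus_diag, Rabs_R0, Rplus_0_l in H1, H2, H3. auto.
Qed.

(** V takes strict opposite signs slightly left and right of -m(b0). Nearby b keep these signs, and
    the sign pattern in [left_spec] then traps m(b) between them. *)
Lemma m_continuous b0 e : 1 <= b0 <= 4 -> 0 < e ->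
  exists d, 0 < d /\ forall b, 1 <= b <= 4 -> Rabs (b - b0) < d -> Rabs (m b - m b0) <= e.
Proof.
  intros Hb0 He. destruct (Hm b0 Hb0) as [[Hm1 Hm2] [Hm3 [Hm4 _]]].
  destruct (dep_b 1 ltac:(lra)) as [C [HC Hdep]].
  set (e' := Rmin e (Rmin (m b0 / 2) (beta / 2))).
  assert (He' : 0 < e') by (unfold e'; repeat apply Rmin_glb_lt; lra).
  assert (He1 : e' <= e) by apply Rmin_l.
  assert (He2 : e' <= m b0 / 2) by (eapply Rle_trans; [apply Rmin_r | apply Rmin_l]).
  assert (He3 : e' <= beta / 2) by (eapply Rle_trans; [apply Rmin_r | apply Rmin_r]).
  assert (Hv1 := Hm3 (- (m b0 - e')) ltac:(lra)).
  assert (Hv2 := Hm4 (- (m b0 + e')) ltac:(lra)).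
  set (v := Rmin (V b0 (- (m b0 - e'))) (- V b0 (- (m b0 + e')))).
  assert (Hv : 0 < v) by (unfold v; apply Rmin_glb_lt; lra).
  assert (Hvl : v <= V b0 (- (m b0 - e'))) by apply Rmin_l.
  assert (Hvr : v <= - V b0 (- (m b0 + e'))) by apply Rmin_r.
  exists (v / C). split; [apply Rdiv_lt_0_compat; lra|].
  intros b Hb Hbb.
  assert (HCv : C * Rabs (b - b0) < v).
  { apply Rmult_lt_compat_l with (r := C) in Hbb; [|lra].
    replace (C * (v / C)) with v in Hbb by (field; lra). exact Hbb. }
  destruct (Hm b Hb) as [[Hn1 Hn2] [Hn3 [Hn4 _]]].
  destruct (Hdep b b0 Hb Hb0 (- (m b0 - e'))) as [_ [D1 _]].
  { rewrite Rabs_Ropp, Rabs_pos_eq; lra. }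
  destruct (Hdep b b0 Hb Hb0 (- (m b0 + e'))) as [_ [D2 _]].
  { rewrite Rabs_Ropp, Rabs_pos_eq; lra. }
  apply Rabs_le_between in D1. apply Rabs_le_between in D2.
  apply Rabs_le. split.
  - apply Rnot_lt_le. intros Hlt.
    specialize (Hn4 (- (m b0 - e')) ltac:(lra)). lra.
  - apply Rnot_lt_le. intros Hlt.
    specialize (Hn3 (- (m b0 + e')) ltac:(lra)). lra.
Qed.

Lemma Bm_continuous b0 e : 1 <= b0 <= 4 -> 0 < e ->
  exists d, 0 < d /\ forall b, 1 <= b <= 4 -> Rabs (b - b0) < d ->
    Rabs (B b (- m b) - B b0 (- m b0)) <= e.
Proof.
  intros Hb0 He. destruct (dep_b 1 ltac:(lra)) as [C [HC Hdep]].
  assert (HcB : continuity_pt (B b0) (- m b0))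
    by (eapply is_derive_continuity_pt, (dB r beta b0 _ _ _ _ (Hf b0 Hb0))).
  destruct (continuity_pt_close (B b0) (- m b0) (e / 2) HcB ltac:(lra)) as [d1 [Hd1 H1]].
  destruct (m_continuous b0 (d1 / 2) Hb0 ltac:(lra)) as [d2 [Hd2 H2]].
  assert (Hd3 : 0 < e / 2 / C) by (apply Rdiv_lt_0_compat; lra).
  exists (Rmin d2 (e / 2 / C)). split; [apply Rmin_glb_lt; assumption|].
  intros b Hb Hbb.
  specialize (H2 b Hb (Rlt_le_trans _ _ _ Hbb (Rmin_l _ _))).
  assert (Hb3 := Rlt_le_trans _ _ _ Hbb (Rmin_r _ _)).
  apply Rmult_lt_compat_l with (r := C) in Hb3; [|lra].
  replace (C * (e / 2 / C)) with (e / 2) in Hb3 by (field; lra).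
  destruct (Hm b Hb) as [[Hn1 _] _].
  destruct (Hdep b b0 Hb Hb0 (- m b)) as [_ [_ D]].
  { rewrite Rabs_Ropp, Rabs_pos_eq; lra. }
  specialize (H1 (- m b)). replace (- m b - - m b0) with (- (m b - m b0)) in H1 by ring.
  rewrite Rabs_Ropp in H1. specialize (H1 ltac:(lra)).
  replace (B b (- m b) - B b0 (- m b0)) with
    ((B b (- m b) - B b0 (- m b)) + (B b0 (- m b) - B b0 (- m b0))) by ring.
  eapply Rle_trans; [apply Rabs_triang|]. lra.
Qed.

Lemma open_on_compact (F : R -> R -> R) (T b0 x y : R) :
  1 <= b0 <= 4 ->
  (forall e, 0 < e -> exists d, 0 < d /\ forall b, 1 <= b <= 4 -> Rabs (b - b0) < d ->
     forall t, 0 <= t <= T -> Rabs (F b t - F b0 t) <= e) ->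
  0 <= x <= y -> y <= T ->
  (forall t, continuity_pt (F b0) t) -> (forall t, x <= t <= y -> 0 < F b0 t) ->
  exists d, 0 < d /\ forall b, 1 <= b <= 4 -> Rabs (b - b0) < d ->
     forall t, x <= t <= y -> 0 < F b t.
Proof.
  intros Hb0 Hu Hx Hy Hc Hp.
  destruct (compact_positive (F b0) x y ltac:(lra) ltac:(auto) Hp) as [mu [Hmu H]].
  destruct (Hu (mu / 2) ltac:(lra)) as [d [Hd H']].
  exists d. split; [exact Hd|]. intros b Hb Hbb t Ht.
  specialize (H t Ht). specialize (H' b Hb Hbb t ltac:(lra)).
  apply Rabs_le_between in H'. lra.
Qed.

Lemma unif_of_lip (F : R -> R -> R) (T C b0 : R) : 1 <= C ->
  (forall b, 1 <= b <= 4 -> forall t, 0 <= t <= T -> Rabs (F b t - F b0 t) <= C * Rabs (b - b0)) ->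
  forall e, 0 < e -> exists d, 0 < d /\ forall b, 1 <= b <= 4 -> Rabs (b - b0) < d ->
     forall t, 0 <= t <= T -> Rabs (F b t - F b0 t) <= e.
Proof.
  intros HC HF e He. exists (e / C). split; [apply Rdiv_lt_0_compat; lra|].
  intros b Hb Hbb t Ht. eapply Rle_trans; [apply HF; assumption|].
  apply Rmult_lt_compat_l with (r := C) in Hbb; [|lra].
  replace (C * (e / C)) with e in Hbb by (field; lra). lra.
Qed.

Lemma unif_V T b0 : 1 <= b0 <= 4 -> 0 <= T -> forall e, 0 < e ->
  exists d, 0 < d /\ forall b, 1 <= b <= 4 -> Rabs (b - b0) < d ->
     forall t, 0 <= t <= T -> Rabs (V b t - V b0 t) <= e.
Proof.
  intros Hb0 HT. destruct (dep_b T HT) as [C [HC H]].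
  apply (unif_of_lip V T C b0 HC). intros b Hb t Ht.
  apply H; auto. rewrite Rabs_pos_eq; lra.
Qed.

Lemma unif_negV T b0 : 1 <= b0 <= 4 -> 0 <= T -> forall e, 0 < e ->
  exists d, 0 < d /\ forall b, 1 <= b <= 4 -> Rabs (b - b0) < d ->
     forall t, 0 <= t <= T -> Rabs (- V b t - - V b0 t) <= e.
Proof.
  intros Hb0 HT e He. destruct (unif_V T b0 Hb0 HT e He) as [d [Hd H]].
  exists d. split; [exact Hd|]. intros b Hb Hbb t Ht.
  replace (- V b t - - V b0 t) with (- (V b t - V b0 t)) by ring. rewrite Rabs_Ropp. auto.
Qed.

Lemma unif_P T b0 : 1 <= b0 <= 4 -> 0 <= T -> forall e, 0 < e ->
  exists d, 0 < d /\ forall b, 1 <= b <= 4 -> Rabs (b - b0) < d ->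
     forall t, 0 <= t <= T -> Rabs (P b t - P b0 t) <= e.
Proof.
  intros Hb0 HT. destruct (dep_b T HT) as [C [HC H]].
  apply (unif_of_lip P T C b0 HC). intros b Hb t Ht.
  apply H; auto. rewrite Rabs_pos_eq; lra.
Qed.

Lemma unif_negP T b0 : 1 <= b0 <= 4 -> 0 <= T -> forall e, 0 < e ->
  exists d, 0 < d /\ forall b, 1 <= b <= 4 -> Rabs (b - b0) < d ->
     forall t, 0 <= t <= T -> Rabs (- P b t - - P b0 t) <= e.
Proof.
  intros Hb0 HT e He. destruct (unif_P T b0 Hb0 HT e He) as [d [Hd H]].
  exists d. split; [exact Hd|]. intros b Hb Hbb t Ht.
  replace (- P b t - - P b0 t) with (- (P b t - P b0 t)) by ring. rewrite Rabs_Ropp. auto.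
Qed.

Definition gap (b t : R) : R := B b (- m b) - B b t.

Lemma unif_gap T b0 : 1 <= b0 <= 4 -> 0 <= T -> forall e, 0 < e ->
  exists d, 0 < d /\ forall b, 1 <= b <= 4 -> Rabs (b - b0) < d ->
     forall t, 0 <= t <= T -> Rabs (gap b t - gap b0 t) <= e.
Proof.
  intros Hb0 HT e He. destruct (dep_b T HT) as [C [HC H]].
  destruct (unif_of_lip B T C b0 HC) with (e := e / 2) as [d1 [Hd1 H1]]; [|lra|].
  { intros b Hb t Ht. apply H; auto. rewrite Rabs_pos_eq; lra. }
  destruct (Bm_continuous b0 (e / 2) Hb0 ltac:(lra)) as [d2 [Hd2 H2]].
  exists (Rmin d1 d2). split; [apply Rmin_glb_lt; assumption|].
  intros b Hb Hbb t Ht.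
  specialize (H1 b Hb (Rlt_le_trans _ _ _ Hbb (Rmin_l _ _)) t Ht).
  specialize (H2 b Hb (Rlt_le_trans _ _ _ Hbb (Rmin_r _ _))).
  unfold gap. apply Rabs_le_between in H1. apply Rabs_le_between in H2. apply Rabs_le. lra.
Qed.

Lemma cont_V b t : 1 <= b <= 4 -> continuity_pt (V b) t.
Proof. intros Hb. eapply is_derive_continuity_pt, (dV r beta b _ _ _ _ (Hf b Hb)). Qed.

Lemma cont_P b t : 1 <= b <= 4 -> continuity_pt (P b) t.
Proof. intros Hb. eapply is_derive_continuity_pt, (dP r beta b _ _ _ _ (Hf b Hb)). Qed.

Lemma cont_gap b t : 1 <= b <= 4 -> continuity_pt (gap b) t.
Proof.
  intros Hb. apply continuity_pt_minus.
  - apply continuity_pt_const. intros x y; reflexivity.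
  - eapply is_derive_continuity_pt, (dB r beta b _ _ _ _ (Hf b Hb)).
Qed.

(** * Undershooting and overshooting on [0, T] *)

Variable T : R.
Hypothesis HT : 16 <= T.
Hypothesis HTbeta : 7680 / beta <= T.

(** A' stays below A'(-m) until the trajectory is lost. Reaching T also counts, so that a trajectory
    on which all three inequalities persist is classified. Strict inequalities on compact intervals
    make this open in b, and starting at 1/8 avoids the zero of V at 0. *)
Definition undershoots (b : R) : Prop := exists t, 1 / 8 <= t <= T /\
  (forall s, 1 / 8 <= s <= t -> 0 < gap b s) /\ (t = T \/ 0 < V b t \/ P b t < 0).

Definition overshoots (b : R) : Prop := exists t, 1 / 8 <= t <= T /\
  (forall s, 1 / 8 <= s <= t -> V b s < 0) /\ (forall s, 1 / 8 <= s <= t -> 0 < P b s) /\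
  gap b t < 0.

Lemma undershoots_open b1 b2 : 1 <= b1 -> b2 <= 4 -> open_in b1 b2 undershoots.
Proof.
  intros Hb1 Hb2 b Hb [t [Ht [Hg Hor]]].
  assert (Hb14 : 1 <= b <= 4) by lra.
  destruct (open_on_compact gap T b (1 / 8) t Hb14 (unif_gap T b Hb14 ltac:(lra))
    ltac:(lra) ltac:(lra) (fun t => cont_gap b t Hb14) Hg) as [d1 [Hd1 H1]].
  assert (Hpt : exists d, 0 < d /\ forall b', 1 <= b' <= 4 -> Rabs (b' - b) < d ->
            t = T \/ 0 < V b' t \/ P b' t < 0).
  { destruct Hor as [HtT | [HV | HP]].
    - exists 1. split; [lra|]. auto.
    - destruct (open_on_compact V T b t t Hb14 (unif_V T b Hb14 ltac:(lra))
        ltac:(lra) ltac:(lra) (fun t => cont_V b t Hb14)) as [d [Hd H]].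
      + intros s Hs. replace s with t by lra. exact HV.
      + exists d. split; [exact Hd|]. intros b' Hb' Hbb. right; left. apply H; auto; lra.
    - destruct (open_on_compact (fun b t => - P b t) T b t t Hb14 (unif_negP T b Hb14 ltac:(lra))
        ltac:(lra) ltac:(lra) (fun t => continuity_pt_opp _ _ (cont_P b t Hb14))) as [d [Hd H]].
      + intros s Hs. replace s with t by lra. lra.
      + exists d. split; [exact Hd|]. intros b' Hb' Hbb. right; right.
        specialize (H b' Hb' Hbb t ltac:(lra)). lra. }
  destruct Hpt as [d2 [Hd2 H2]].
  exists (Rmin d1 d2). split; [apply Rmin_glb_lt; assumption|].
  intros b' Hb' Hbb. exists t. split; [exact Ht|]. split.
  - apply H1; [lra | exact (Rlt_le_trans _ _ _ Hbb (Rmin_l _ _))].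
  - apply H2; [lra | exact (Rlt_le_trans _ _ _ Hbb (Rmin_r _ _))].
Qed.

Lemma overshoots_open b1 b2 : 1 <= b1 -> b2 <= 4 -> open_in b1 b2 overshoots.
Proof.
  intros Hb1 Hb2 b Hb [t [Ht [HV [HP Hg]]]].
  assert (Hb14 : 1 <= b <= 4) by lra.
  destruct (open_on_compact (fun b t => - V b t) T b (1 / 8) t Hb14 (unif_negV T b Hb14 ltac:(lra))
    ltac:(lra) ltac:(lra) (fun t => continuity_pt_opp _ _ (cont_V b t Hb14))) as [d1 [Hd1 H1]].
  { intros s Hs. specialize (HV s Hs). lra. }
  destruct (open_on_compact P T b (1 / 8) t Hb14 (unif_P T b Hb14 ltac:(lra))
    ltac:(lra) ltac:(lra) (fun t => cont_P b t Hb14) HP) as [d2 [Hd2 H2]].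
  destruct (unif_gap T b Hb14 ltac:(lra) (- gap b t / 2) ltac:(lra)) as [d3 [Hd3 H3]].
  exists (Rmin d1 (Rmin d2 d3)). split; [repeat apply Rmin_glb_lt; assumption|].
  intros b' Hb' Hbb. assert (Hbb' := Rlt_le_trans _ _ _ Hbb (Rmin_r _ _)).
  exists t. split; [exact Ht|]. split; [|split].
  - intros s Hs. specialize (H1 b' ltac:(lra) (Rlt_le_trans _ _ _ Hbb (Rmin_l _ _)) s Hs). lra.
  - apply H2; [lra | exact (Rlt_le_trans _ _ _ Hbb' (Rmin_l _ _))].
  - specialize (H3 b' ltac:(lra) (Rlt_le_trans _ _ _ Hbb' (Rmin_r _ _)) t ltac:(lra)).
    apply Rabs_le_between in H3. lra.
Qed.

Lemma shoots_disjoint b : undershoots b -> overshoots b -> False.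
Proof.
  intros [t1 [Ht1 [Hg1 Hor]]] [t2 [Ht2 [HV [HP Hg2]]]].
  destruct (Rle_lt_dec t2 t1) as [Hle | Hlt].
  - specialize (Hg1 t2 ltac:(lra)). lra.
  - specialize (HV t1 ltac:(lra)). specialize (HP t1 ltac:(lra)). lra.
Qed.

Lemma energy_gap b s : 1 <= b <= 4 -> 0 <= s -> (forall t, 0 <= t <= s -> 0 <= P b t <= 1) ->
  B b s ^ 2 - B b (- m b) ^ 2
  = r * beta ^ 2 * (virial beta (P b) (V b) (A b) s - virial beta (P b) (V b) (A b) (- m b)).
Proof.
  intros Hb Hs HP. destruct (Hm b Hb) as [[Hm1 _] [_ [_ [HPm _]]]].
  apply (energy r beta b _ _ _ _ (Hf b Hb)); [lra|].
  intros u Hu. destruct (Rle_lt_dec u 0) as [Hle | Hlt].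
  - specialize (HPm u ltac:(lra)). lra.
  - apply HP. lra.
Qed.

Lemma coupling_pos : 0 < r * beta ^ 2.
Proof. apply Rmult_lt_0_compat; nra. Qed.

Lemma gap_early b t : 1 <= b <= 4 -> 0 <= t -> A b t <= 0 -> 0 < gap b t.
Proof.
  intros Hb Ht HA. destruct (Hm b Hb) as [_ [_ [_ [_ [_ HB]]]]].
  pose proof (B_decreasing r beta b _ _ _ _ Hr H100 Hb (Hf b Hb) t Ht HA).
  unfold gap. lra.
Qed.

(** At the first zero of P one has Y = -V^2 < beta <= Y(-m), so the gap is positive there. It is
    positive before as well: B is at most b while A <= 0 and nondecreasing afterwards. A time just
    beyond the zero is the witness. *)
Lemma undershoots_of_hit b t1 : 1 <= b <= 4 -> 0 <= t1 < T ->
  (forall t, 0 < t <= t1 -> V b t < 0) -> P b t1 < 0 -> undershoots b.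
Proof.
  intros Hb Ht1 HV HP1.
  destruct (family_0 r beta b _ _ _ _ (Hf b Hb)) as [P0 _].
  destruct (first_zero (P b) 0 t1) as [s [Hs1 [Hs2 Hs3]]]; [lra| |lra|lra|].
  { intros u _. apply cont_P, Hb. }
  destruct (zero_crossing r beta b _ _ _ _ Hr H100 Hb (Hf b Hb) s ltac:(lra) Hs2 Hs3)
    as [HVs [e [He Hneg]]].
  assert (Hs8 : 1 / 8 < s).
  { apply Rnot_le_lt. intros Hle.
    pose proof (P_early r beta b _ _ _ _ Hb (Hf b Hb) s ltac:(lra)). lra. }
  assert (HP01 : forall t, 0 <= t <= s -> 0 <= P b t <= 1).
  { intros t Ht. split.
    - destruct (proj2 Ht) as [Hlt | ->]; [left; apply Hs3; lra | lra].
    - apply (P_le_1 r beta b _ _ _ _ (Hf b Hb)); [lra|]. intros u Hu. left. apply HV. lra. }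
  assert (HE := energy_gap b s Hb ltac:(lra) HP01).
  destruct (Hm b Hb) as [_ [_ [_ [_ [Hvir HB]]]]].
  assert (Hgs : 0 < gap b s).
  { assert (virial beta (P b) (V b) (A b) s < 0).
    { unfold virial. rewrite Hs2.
      replace (0 ^ 2 * (A b s ^ 2 - 1) + beta ^ 2 * 0 ^ 4 / 2 - V b s ^ 2)
        with (- V b s ^ 2) by field. nra. }
    pose proof coupling_pos.
    assert (B b s ^ 2 < B b (- m b) ^ 2) by nra.
    pose proof (B_lower r beta b _ _ _ _ Hr H100 Hb (Hf b Hb) s ltac:(lra)).
    unfold gap. nra. }
  assert (Hg : forall t, 1 / 8 <= t <= s -> 0 < gap b t).
  { intros t Ht. destruct (Rle_lt_dec (A b t) 0) as [Hle | Hlt].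
    - apply gap_early; auto; lra.
    - pose proof (B_increasing r beta b _ _ _ _ Hr H100 Hb (Hf b Hb) t s ltac:(lra) ltac:(lra)).
      unfold gap in *. lra. }
  destruct (continuity_pt_pos (gap b) s (cont_gap b s Hb) Hgs) as [e2 [He2 Hg2]].
  set (d := Rmin (e / 2) (Rmin (e2 / 2) (T - s))).
  assert (Hd : 0 < d) by (unfold d; repeat apply Rmin_glb_lt; lra).
  assert (Hd1 : d <= e / 2) by apply Rmin_l.
  assert (Hd2 : d <= e2 / 2) by (eapply Rle_trans; [apply Rmin_r | apply Rmin_l]).
  assert (Hd3 : d <= T - s) by (eapply Rle_trans; [apply Rmin_r | apply Rmin_r]).
  exists (s + d). split; [lra|]. split.
  - intros t Ht. destruct (Rle_lt_dec t s) as [Hle | Hlt].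
    + apply Hg. lra.
    + apply Hg2. rewrite Rabs_pos_eq; lra.
  - right; right. apply Hneg. lra.
Qed.

Lemma overshoots_of_virial b t : 1 <= b <= 4 -> 1 / 8 <= t <= T ->
  (forall s, 0 < s <= t -> V b s < 0) -> (forall s, 0 <= s <= t -> 0 < P b s) ->
  3 * beta < virial beta (P b) (V b) (A b) t -> overshoots b.
Proof.
  intros Hb Ht HV HP Hvir'.
  assert (HP01 : forall s, 0 <= s <= t -> 0 <= P b s <= 1).
  { intros s Hs. split; [left; apply HP, Hs|].
    apply (P_le_1 r beta b _ _ _ _ (Hf b Hb)); [lra|]. intros u Hu. left. apply HV. lra. }
  assert (HE := energy_gap b t Hb ltac:(lra) HP01).
  destruct (Hm b Hb) as [_ [_ [_ [_ [Hvir HB]]]]].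
  exists t. split; [exact Ht|]. split; [|split].
  - intros s Hs. apply HV. lra.
  - intros s Hs. apply HP. lra.
  - pose proof coupling_pos.
    assert (B b (- m b) ^ 2 < B b t ^ 2) by nra.
    pose proof (B_lower r beta b _ _ _ _ Hr H100 Hb (Hf b Hb) t ltac:(lra)).
    unfold gap. nra.
Qed.

(** A positive gap keeps B <= 5, so A(T) <= 5 T. With P T^3 <= 1536 this gives P A T^2 <= 7680 <=
    beta T, which is the origin of the bound on T; hence P A <= beta and Y(T) <= beta^2 < beta. *)
Lemma virial_small b : 1 <= b <= 4 ->
  (forall t, 0 < t < T -> V b t < 0) -> (forall t, 0 <= t < T -> 0 < P b t) ->
  (forall t, 1 / 8 <= t < T -> 0 < gap b t) -> virial beta (P b) (V b) (A b) T < beta.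
Proof.
  intros Hb HV HP Hg.
  destruct (family_0 r beta b _ _ _ _ (Hf b Hb)) as [P0 [V0 [A0 B0]]].
  destruct (Hm b Hb) as [_ [_ [_ [_ [Hvir HB]]]]].
  assert (Hdec := P_decay r beta b _ _ _ _ Hr H100 Hb (Hf b Hb) T HT
    (fun t Ht => Rlt_le _ _ (HV t Ht)) (fun t Ht => Rlt_le _ _ (HP t ltac:(lra)))).
  assert (HPT1 : P b T <= 1).
  { apply (P_le_1 r beta b _ _ _ _ (Hf b Hb)); [lra|]. intros u Hu. left. apply HV. lra. }
  assert (HPT0 : 0 <= P b T).
  { apply Rnot_lt_le. intros Hneg.
    destruct (continuity_pt_neg (P b) T (cont_P b T Hb) Hneg) as [e [He H]].
    pose proof (Rmax_l 1 (T - e / 2)). pose proof (Rmax_r 1 (T - e / 2)).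
    assert (Rmax 1 (T - e / 2) < T) by (apply Rmax_lub_lt; lra).
    specialize (H (Rmax 1 (T - e / 2))). specialize (HP (Rmax 1 (T - e / 2)) ltac:(lra)).
    rewrite Rabs_left in H by lra. specialize (H ltac:(lra)). lra. }
  assert (HAT : 0 <= A b T <= 5 * T).
  { split.
    - pose proof (A_lower r beta b _ _ _ _ Hr H100 Hb (Hf b Hb) T ltac:(lra)). nra.
    - destruct (mean_value (A b) (B b) 0 T) as [c [Hc1 Hc2]]; [lra| |].
      { intros; apply (dA r beta b _ _ _ _ (Hf b Hb)). }
      assert (B b c <= 5); [|nra].
      destruct (Rle_lt_dec c (1 / 8)) as [Hle | Hlt].
      + pose proof (A_early r beta b _ _ _ _ Hr H100 Hb (Hf b Hb) c ltac:(lra)).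
        pose proof (B_decreasing r beta b _ _ _ _ Hr H100 Hb (Hf b Hb) c ltac:(lra) ltac:(lra)).
        lra.
      + specialize (Hg c ltac:(lra)). unfold gap in Hg. assert (beta ^ 2 <= 1) by nra. lra. }
  assert (HbT : 7680 <= beta * T).
  { apply Rmult_le_compat_l with (r := beta) in HTbeta; [|lra].
    replace (beta * (7680 / beta)) with 7680 in HTbeta by (field; lra). exact HTbeta. }
  assert (HPA : 0 <= P b T * A b T <= beta).
  { split; [apply Rmult_le_pos; lra|].
    assert (H1 : P b T * A b T <= P b T * (5 * T)) by (apply Rmult_le_compat_l; lra).
    assert (H2 : P b T * (5 * T) * T ^ 2 <= 7680) by (simpl in *; nra).
    assert (H3 : P b T * (5 * T) * T ^ 2 <= beta * T) by lra.
    assert (H4 : 0 <= P b T * (5 * T)) by (apply Rmult_le_pos; lra).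
    assert (H5 : P b T * (5 * T) * T <= beta).
    { apply Rmult_le_reg_r with T; [lra|].
      replace (P b T * (5 * T) * T * T) with (P b T * (5 * T) * T ^ 2) by ring. exact H3. }
    nra. }
  unfold virial.
  assert (HP2 : 0 <= P b T ^ 2 <= 1) by nra.
  assert (beta ^ 2 * P b T ^ 4 / 2 <= P b T ^ 2).
  { replace (beta ^ 2 * P b T ^ 4 / 2) with (P b T ^ 2 * (beta ^ 2 * P b T ^ 2 / 2)) by field.
    assert (0 <= beta ^ 2 <= 1) by nra. assert (beta ^ 2 * P b T ^ 2 / 2 <= 1) by nra. nra. }
  assert (P b T ^ 2 * A b T ^ 2 <= beta ^ 2).
  { replace (P b T ^ 2 * A b T ^ 2) with ((P b T * A b T) ^ 2) by ring. nra. }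
  pose proof (pow2_ge_0 (V b T)). nra.
Qed.

(** At the first failure of V < 0, P > 0, gap > 0, every failure other than gap = V = 0 with P > 0
    can be continued slightly into an undershoot or an overshoot, or happens at T. *)
Lemma balanced b : 1 <= b <= 4 -> ~ undershoots b -> ~ overshoots b ->
  exists M, right_spec (P b) (V b) (B b) (m b) M.
Proof.
  intros Hb Hnu Hno.
  destruct (family_0 r beta b _ _ _ _ (Hf b Hb)) as [P0 [V0 [A0 B0]]].
  destruct (Hm b Hb) as [[Hm1 _] [_ [_ [HPm [Hvir HB]]]]].
  assert (HdV := dV r beta b _ _ _ _ (Hf b Hb)). assert (HdP := dP r beta b _ _ _ _ (Hf b Hb)).
  assert (HVe := V_neg_early r beta b _ _ _ _ Hr H100 Hb (Hf b Hb)).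
  assert (HPe := P_early r beta b _ _ _ _ Hb (Hf b Hb)).
  pose (f := fun t => Rmin (Rmin (- V b t) (P b t)) (gap b t)).
  assert (Hfpos : forall t, 0 < f t -> V b t < 0 /\ 0 < P b t /\ 0 < gap b t).
  { intros t Ht. unfold f in Ht. pose proof (Rmin_l (Rmin (- V b t) (P b t)) (gap b t)).
    pose proof (Rmin_r (Rmin (- V b t) (P b t)) (gap b t)).
    pose proof (Rmin_l (- V b t) (P b t)). pose proof (Rmin_r (- V b t) (P b t)). lra. }
  assert (Hfc : forall t, continuity_pt f t).
  { intros t. apply continuity_pt_Rmin; [apply continuity_pt_Rmin|].
    - apply continuity_pt_opp, cont_V, Hb.
    - apply cont_P, Hb.
    - apply cont_gap, Hb. }
  assert (Hf8 : 0 < f (1 / 8)).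
  { specialize (HVe (1 / 8) ltac:(lra)). specialize (HPe (1 / 8) ltac:(lra)).
    unfold f. repeat apply Rmin_glb_lt; try lra.
    apply gap_early; [exact Hb | lra|].
    left. apply (A_early r beta b _ _ _ _ Hr H100 Hb (Hf b Hb)). lra. }
  (* If all three inequalities persisted up to T, this would be an undershoot. *)
  assert (Hex : exists y, 1 / 8 <= y <= T /\ f y <= 0).
  { apply NNPP. intros Hn. apply Hnu. exists T. split; [lra|]. split; [|left; reflexivity].
    intros s Hs. apply Hfpos. apply Rnot_le_lt. intros Hle. apply Hn. exists s. auto. }
  destruct Hex as [y [Hy1 Hy2]].
  destruct (first_zero f (1 / 8) y) as [s [Hs1 [Hs2 Hs3]]]; [lra | auto | exact Hf8 | exact Hy2 |].
  assert (HVlt : forall t, 0 < t < s -> V b t < 0).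
  { intros t Ht. destruct (Rle_lt_dec t (1 / 8)); [apply HVe; lra | apply Hfpos, Hs3; lra]. }
  assert (HPlt : forall t, 0 <= t < s -> 0 < P b t).
  { intros t Ht. destruct (Rle_lt_dec t (1 / 8)).
    - specialize (HPe t ltac:(lra)). lra.
    - apply Hfpos, Hs3; lra. }
  assert (Hglt : forall t, 1 / 8 <= t < s -> 0 < gap b t) by (intros t Ht; apply Hfpos, Hs3; lra).
  assert (Hfs : V b s <= 0 /\ 0 <= P b s /\ 0 <= gap b s /\
                (V b s = 0 \/ P b s = 0 \/ gap b s = 0)).
  { unfold f, Rmin in Hs2. destruct (Rle_dec (- V b s) (P b s)); destruct Rle_dec; lra. }
  destruct Hfs as [HVs [HPs [Hgs Hor]]].
  assert (HP01 : forall t, 0 <= t <= s -> 0 <= P b t <= 1).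
  { intros t Ht. split.
    - destruct (proj2 Ht) as [Hlt | ->]; [left; apply HPlt; lra | exact HPs].
    - apply (P_le_1 r beta b _ _ _ _ (Hf b Hb)); [lra|]. intros u Hu. left. apply HVlt. lra. }
  assert (HE := energy_gap b s Hb ltac:(lra) HP01).
  pose proof coupling_pos as Hk.
  destruct (Req_dec (gap b s) 0) as [Hg0 | Hg0].
  (* Equal B means equal Y, and Y(-m) > 0 excludes P = 0. *)
  - assert (Hveq : virial beta (P b) (V b) (A b) s = virial beta (P b) (V b) (A b) (- m b)).
    { unfold gap in Hg0. replace (B b s) with (B b (- m b)) in HE by lra. nra. }
    assert (HPs' : 0 < P b s).
    { destruct HPs as [HPs | HPs]; [exact HPs|]. exfalso.
      assert (virial beta (P b) (V b) (A b) s <= 0); [|lra].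
      unfold virial. rewrite <- HPs.
      replace (0 ^ 2 * (A b s ^ 2 - 1) + beta ^ 2 * 0 ^ 4 / 2 - V b s ^ 2)
        with (- V b s ^ 2) by field. nra. }
    (* If V < 0, then s < T by [virial_small], and B' > 0 at s makes the gap negative just after s
       while V < 0 < P: an overshoot. *)
    assert (HVs0 : V b s = 0).
    { destruct HVs as [HVs | HVs]; [|exact HVs]. exfalso. apply Hno.
      assert (HsT : s < T).
      { destruct (proj2 Hy1) as [HyT | HyT]; [lra|].
        destruct (proj2 Hs1) as [Hsy | Hsy]; [lra|]. subst y. subst s.
        pose proof (virial_small b Hb HVlt HPlt Hglt). lra. }
      assert (HAs : 0 < A b s).
      { apply Rnot_le_lt. intros Hle. pose proof (gap_early b s Hb ltac:(lra) Hle). lra. }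
      destruct (derive_pos_local (B b) s _ (dB r beta b _ _ _ _ (Hf b Hb) s))
        as [e1 [He1 [Hinc _]]].
      { pose proof (clip_pos (P b s) HPs'). assert (0 < clip (P b s) ^ 2) by nra.
        repeat apply Rmult_lt_0_compat; lra. }
      destruct (continuity_pt_neg (V b) s (cont_V b s Hb) HVs) as [e2 [He2 HVn]].
      destruct (continuity_pt_pos (P b) s (cont_P b s Hb) HPs') as [e3 [He3 HPn]].
      set (d := Rmin (Rmin (e1 / 2) (T - s)) (Rmin (e2 / 2) (e3 / 2))).
      assert (Hd : 0 < d) by (unfold d; repeat apply Rmin_glb_lt; lra).
      assert (Hd1 : d <= e1 / 2) by (eapply Rle_trans; [apply Rmin_l | apply Rmin_l]).
      assert (Hd2 : d <= T - s) by (eapply Rle_trans; [apply Rmin_l | apply Rmin_r]).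
      assert (Hd3 : d <= e2 / 2) by (eapply Rle_trans; [apply Rmin_r | apply Rmin_l]).
      assert (Hd4 : d <= e3 / 2) by (eapply Rle_trans; [apply Rmin_r | apply Rmin_r]).
      exists (s + d). split; [lra|]. split; [|split].
      - intros t Ht. destruct (Rlt_le_dec t s) as [Hlt | Hle]; [apply HVlt; lra|].
        apply HVn. rewrite Rabs_pos_eq; lra.
      - intros t Ht. destruct (Rlt_le_dec t s) as [Hlt | Hle]; [apply HPlt; lra|].
        apply HPn. rewrite Rabs_pos_eq; lra.
      - specialize (Hinc (s + d) ltac:(lra)). unfold gap in *. lra. }
    exists s. split; [lra|]. split; [exact HVs0|]. split; [exact HVlt|]. split.
    + intros t Ht. split; [|apply HP01, Ht].
      destruct (proj2 Ht) as [Hlt | ->]; [apply HPlt; lra | exact HPs'].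
    + unfold gap in Hg0. lra.
  - exfalso. apply Hnu.
    assert (Hgs' : 0 < gap b s) by lra.
    assert (Hgle : forall t, 1 / 8 <= t <= s -> 0 < gap b t).
    { intros t Ht. destruct (proj2 Ht) as [Hlt | ->]; [apply Hglt; lra | exact Hgs']. }
    assert (Hafter : s < T -> (exists e, 0 < e /\ forall t, s < t < s + e -> 0 < V b t \/ P b t < 0) ->
              undershoots b).
    { intros HsT [e [He H]].
      destruct (continuity_pt_pos (gap b) s (cont_gap b s Hb) Hgs') as [e2 [He2 Hg2]].
      set (d := Rmin (e / 2) (Rmin (e2 / 2) (T - s))).
      assert (Hd : 0 < d) by (unfold d; repeat apply Rmin_glb_lt; lra).
      assert (Hd1 : d <= e / 2) by apply Rmin_l.
      assert (Hd2 : d <= e2 / 2) by (eapply Rle_trans; [apply Rmin_r | apply Rmin_l]).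
      assert (Hd3 : d <= T - s) by (eapply Rle_trans; [apply Rmin_r | apply Rmin_r]).
      exists (s + d). split; [lra|]. split.
      - intros t Ht. destruct (Rle_lt_dec t s) as [Hle | Hlt]; [apply Hgle; lra|].
        apply Hg2. rewrite Rabs_pos_eq; lra.
      - right. apply H. lra. }
    destruct (Rlt_le_dec s T) as [HsT | HsT].
    2:{ exists s. split; [lra|]. split; [exact Hgle | left; lra]. }
    apply Hafter; [exact HsT|].
    destruct HPs as [HPs | HPs].
    + assert (HVs0 : V b s = 0) by lra.
      assert (Hcs : clip (P b s) = P b s) by (apply clip_id, HP01; lra).
      assert (HAs : 1 - beta < A b s).
      { apply Rnot_le_lt. intros Hle.
        pose proof (V_neg r beta b _ _ _ _ Hr H100 Hb (Hf b Hb) s ltac:(lra) Hle). lra. }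
      (* V reaches 0 from below, so its slope is not negative. If the slope is zero, the potential
         vanishes with derivative 2 A B > 0, so it is negative just before s and V decreases to 0
         there, against V < 0. A positive slope gives V > 0 right after s. *)
      destruct (Rtotal_order (potential beta (P b) (A b) s) 0) as [Hq | [Hq | Hq]].
      * exfalso.
        destruct (derive_neg_local (V b) s _ (HdV s)) as [e [He [_ H]]]; [rewrite Hcs; nra|].
        pose proof (Rmax_l (1 / 8) (s - e / 2)). pose proof (Rmax_r (1 / 8) (s - e / 2)).
        assert (Rmax (1 / 8) (s - e / 2) < s) by (apply Rmax_lub_lt; lra).
        specialize (H (Rmax (1 / 8) (s - e / 2)) ltac:(lra)).
        specialize (HVlt (Rmax (1 / 8) (s - e / 2)) ltac:(lra)). lra.
      * exfalso.
        assert (Hdq : is_derive (fun t => beta ^ 2 * P b t ^ 2 + A b t ^ 2 - 1) s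
                  (2 * beta ^ 2 * P b s * V b s + 2 * A b s * B b s)).
        { pose proof (HdP s) as d1. pose proof (dA r beta b _ _ _ _ (Hf b Hb) s) as d2.
          derive_tac. }
        destruct (derive_pos_local _ s _ Hdq) as [e [He [_ H]]].
        { rewrite HVs0. pose proof (B_lower r beta b _ _ _ _ Hr H100 Hb (Hf b Hb) s ltac:(lra)).
          assert (0 < A b s * B b s) by (apply Rmult_lt_0_compat; lra). lra. }
        set (u := Rmax (1 / 8) (s - e / 2)).
        assert (Hu1 : 1 / 8 <= u) by apply Rmax_l.
        assert (Hu2 : s - e / 2 <= u) by apply Rmax_r.
        assert (Hu3 : u < s) by (unfold u; apply Rmax_lub_lt; lra).
        assert (V b s <= V b u).
        { apply (derive_nonpos_le (V b)
            (fun t => clip (P b t) * potential beta (P b) (A b) t)); [lra | intros; apply HdV |].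
          intros t Ht. specialize (H t ltac:(lra)). unfold potential in Hq |- *.
          rewrite Hcs in Hq. rewrite (clip_id (P b t)) by (apply HP01; lra).
          specialize (HPlt t ltac:(lra)). nra. }
        specialize (HVlt u ltac:(lra)). lra.
      * destruct (derive_pos_local (V b) s _ (HdV s)) as [e [He [H _]]]; [rewrite Hcs; nra|].
        exists e. split; [exact He|]. intros t Ht. left. specialize (H t Ht). lra.
    + destruct (zero_crossing r beta b _ _ _ _ Hr H100 Hb (Hf b Hb) s ltac:(lra) (eq_sym HPs) HPlt)
        as [_ [e [He H]]].
      exists e. split; [exact He|]. intros t Ht. right. apply H, Ht.
Qed.

Theorem shooting b1 b2 t1 t2 :
  1 <= b1 -> b1 < b2 -> b2 <= 4 -> 0 <= t1 < T -> 1 / 8 <= t2 <= T ->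
  (forall t, 0 < t <= t1 -> V b1 t < 0) -> P b1 t1 < 0 ->
  (forall s, 0 < s <= t2 -> V b2 s < 0) -> (forall s, 0 <= s <= t2 -> 0 < P b2 s) ->
  3 * beta < virial beta (P b2) (V b2) (A b2) t2 ->
  exists b M, b1 <= b <= b2 /\ right_spec (P b) (V b) (B b) (m b) M.
Proof.
  intros Hb1 Hb12 Hb2 Ht1 Ht2 HV1 HP1 HV2 HP2 Hvir.
  destruct (interval_connected b1 b2 undershoots overshoots) as [b [Hb [Hnu Hno]]].
  - lra.
  - apply undershoots_open; lra.
  - apply overshoots_open; lra.
  - apply (undershoots_of_hit b1 t1); auto; lra.
  - apply (overshoots_of_virial b2 t2); auto; lra.
  - intros b _. apply shoots_disjoint.
  - destruct (balanced b ltac:(lra) Hnu Hno) as [M HM]. exists b, M. auto.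
Qed.

End FixedBeta.

(** * The limit beta -> 0 *)

(** Supplies the form of [hits] that survives small beta: V is negative up to a time beyond the
    zero. Before the zero this holds because V, negative there, is nondecreasing once b t >= 2. *)
Lemma hits_decreasing r b P V A B : 0 < r <= 2.01 -> 1 <= b <= 4 -> family r 0 b P V A B ->
  hits P -> exists t, 1 / 8 < t /\ P t < 0 /\ forall s, 0 < s <= t -> V s < 0.
Proof.
  intros Hr Hb Hf Hh. assert (H0 : 0 <= 0 <= 1 / 100) by lra.
  destruct Hh as [t1 [Ht1 HP1]].
  destruct (family_0 r 0 b P V A B Hf) as [P0 _].
  destruct (first_zero P 0 t1 Ht1) as [s [Hs1 [Hs2 Hs3]]]; [|lra|lra|].
  { intros u _. eapply is_derive_continuity_pt, (dP r 0 b P V A B Hf). }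
  destruct (zero_crossing r 0 b P V A B Hr H0 Hb Hf s ltac:(lra) Hs2 Hs3) as [HVs [e [He Hneg]]].
  assert (Hs8 : 1 / 8 < s).
  { apply Rnot_le_lt. intros Hle.
    pose proof (P_early r 0 b P V A B Hb Hf s ltac:(lra)). lra. }
  destruct (continuity_pt_neg V s) as [e2 [He2 HV2]]; [|exact HVs|].
  { eapply is_derive_continuity_pt, (dV r 0 b P V A B Hf). }
  set (d := Rmin (e / 2) (e2 / 2)).
  assert (Hd : 0 < d) by (unfold d; apply Rmin_glb_lt; lra).
  assert (Hd1 : d <= e / 2) by apply Rmin_l.
  assert (Hd2 : d <= e2 / 2) by apply Rmin_r.
  exists (s + d). split; [lra|]. split; [apply Hneg; lra|].
  intros u Hu. destruct (Rle_lt_dec u s) as [Hle | Hlt].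
  - destruct (Rle_lt_dec (b * u) 2) as [Hbu | Hbu].
    + apply (limit_V_neg r b P V A B Hr Hb Hf); lra.
    + pose proof (limit_V_incr r b P V A B Hr Hb Hf u s ltac:(lra) Hle). lra.
  - apply HV2. rewrite Rabs_pos_eq; lra.
Qed.

(** Once b t > 2 the force is strictly positive, so V(t) < V(t + 1) <= 0. *)
Lemma limit_V_neg_all r b P V A B : 0 < r <= 2.01 -> 1 <= b <= 4 -> family r 0 b P V A B ->
  ~ hits P -> ~ turns V -> forall t, 0 < t -> V t < 0.
Proof.
  intros Hr Hb Hf Hh HT t Ht.
  destruct (Rle_lt_dec (b * t) 2) as [Hbt | Hbt].
  - apply (limit_V_neg r b P V A B Hr Hb Hf); lra.
  - apply Rlt_le_trans with (V (t + 1)); [|apply V_nonpos; [exact HT | lra]].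
    apply (derive_pos_lt V (fun u => clip (P u) * potential 0 P A u)); [lra | |].
    + intros; apply (dV r 0 b P V A B Hf).
    + intros u Hu. rewrite (limit_potential r b P V A B Hf).
      apply Rmult_lt_0_compat.
      * apply clip_pos, (P_pos r b P V A B Hr Hb Hf Hh). lra.
      * assert (0 < b * (u - t)) by (apply Rmult_lt_0_compat; lra). nra.
Qed.

(** The quartic term of Y is left out: it vanishes for beta = 0 and only helps for beta > 0. *)
Lemma virial_close p0 v0 a0 : exists K, 0 <= K /\ forall d p v a, 0 <= d <= 1 ->
  Rabs (p - p0) <= d -> Rabs (v - v0) <= d -> Rabs (a - a0) <= d ->
  p0 ^ 2 * (a0 ^ 2 - 1) - v0 ^ 2 - K * d <= p ^ 2 * (a ^ 2 - 1) - v ^ 2.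
Proof.
  set (N := 1 + Rabs p0 + Rabs v0 + Rabs a0).
  assert (HN : 1 <= N /\ Rabs p0 <= N /\ Rabs v0 <= N /\ Rabs a0 <= N).
  { unfold N. pose proof (Rabs_pos p0). pose proof (Rabs_pos v0). pose proof (Rabs_pos a0). lra. }
  destruct HN as [HN [Hp0 [Hv0 Ha0]]].
  exists (25 * N ^ 3). split; [assert (0 <= N ^ 3) by (apply pow_le; lra); lra|].
  intros d p v a Hd Hp Hv Ha.
  assert (Hsum : forall x x0, Rabs x0 <= N -> Rabs (x - x0) <= d -> Rabs (x + x0) <= 3 * N).
  { intros x x0 H1 H2. replace (x + x0) with ((x - x0) + 2 * x0) by ring.
    eapply Rle_trans; [apply Rabs_triang|]. rewrite Rabs_mult, (Rabs_pos_eq 2) by lra. lra. }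
  assert (Hbd : Rabs p <= 2 * N).
  { replace p with ((p - p0) + p0) by ring. eapply Rle_trans; [apply Rabs_triang|]. lra. }
  assert (Hpa : Rabs (p * a - p0 * a0) <= 3 * N * d).
  { replace (p * a - p0 * a0) with (p * (a - a0) + a0 * (p - p0)) by ring.
    eapply Rle_trans; [apply Rabs_triang|].
    assert (Rabs (p * (a - a0)) <= 2 * N * d) by (apply Rabs_mult_le; assumption).
    assert (Rabs (a0 * (p - p0)) <= N * d) by (apply Rabs_mult_le; assumption). lra. }
  assert (Hpa2 : Rabs (p * a + p0 * a0) <= 5 * N ^ 2).
  { replace (p * a + p0 * a0) with ((p * a - p0 * a0) + 2 * (p0 * a0)) by ring.
    eapply Rle_trans; [apply Rabs_triang|].
    rewrite (Rabs_mult 2), (Rabs_pos_eq 2) by lra.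
    assert (Rabs (p0 * a0) <= N * N) by (apply Rabs_mult_le; assumption). nra. }
  assert (E1 : Rabs ((p * a - p0 * a0) * (p * a + p0 * a0)) <= 3 * N * d * (5 * N ^ 2))
    by (apply Rabs_mult_le; assumption).
  assert (E2 : Rabs ((p - p0) * (p + p0)) <= d * (3 * N)) by (apply Rabs_mult_le; auto).
  assert (E3 : Rabs ((v - v0) * (v + v0)) <= d * (3 * N)) by (apply Rabs_mult_le; auto).
  apply Rabs_le_between in E1. apply Rabs_le_between in E2. apply Rabs_le_between in E3.
  assert (HN3 : N <= N ^ 3) by (simpl; nra).
  assert (d * N <= d * N ^ 3) by (apply Rmult_le_compat_l; lra).
  replace (3 * N * d * (5 * N ^ 2)) with (15 * (d * N ^ 3)) in E1 by ring.
  assert (0 <= d * N ^ 3) by (apply Rmult_le_pos; lra).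
  replace (25 * N ^ 3 * d) with (25 * (d * N ^ 3)) by ring. nra.
Qed.

(** Selects the shooting parameter. The infimum of the distance to h0 need not be attained, so an
    error [e] is conceded; it will be beta. *)
Lemma near_minimizer (E : R -> Prop) (x0 e : R) : (exists x, E x) -> 0 < e ->
  exists x, E x /\ forall y, E y -> Rabs (x - x0) <= Rabs (y - x0) + e.
Proof.
  intros [x1 Hx1] He.
  destruct (completeness (fun z => exists y, E y /\ z = - Rabs (y - x0))) as [c [Hub Hlub]].
  - exists 0. intros z [y [_ ->]]. pose proof (Rabs_pos (y - x0)). lra.
  - exists (- Rabs (x1 - x0)), x1. auto.
  - apply NNPP. intros Hn. assert (c <= c - e); [|lra].
    apply Hlub. intros z [y [Hy ->]]. apply Rnot_lt_le. intros Hlt.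
    apply Hn. exists y. split; [exact Hy|]. intros w Hw.
    assert (- Rabs (w - x0) <= c) by (apply Hub; exists w; auto). lra.
Qed.

Lemma at_right_0 (Q : R -> Prop) :
  (exists d, 0 < d /\ forall y, 0 < y < d -> Q y) -> at_right 0 Q.
Proof.
  intros [d [Hd H]]. exists (mkposreal d Hd). intros y Hy Hy0. apply H.
  change (Rabs (y - 0) < d) in Hy. rewrite Rminus_0_r in Hy.
  apply Rabs_lt_between in Hy. lra.
Qed.

Lemma deriv_on_of_is_derive (a b : R) (f f' g : R -> R) :
  (forall t, a <= t <= b -> is_derive f t (g t)) ->
  (forall t, a <= t <= b -> g t = f' t) -> deriv_on a b f f'.
Proof.
  intros Hd Hg t Ht. specialize (Hd t Ht). rewrite (Hg t Ht) in Hd.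
  apply is_derive_Reals in Hd. apply derivable_pt_lim_D_in in Hd.
  intros eps Heps. destruct (Hd eps Heps) as [alp [Halp H]]. exists alp.
  split; [exact Halp|]. intros x [[Hx Hne] Hdist]. apply H. repeat split; auto.
Qed.

(** * The critical field and admissible shooting parameters near it *)

Section Assembly.

Variables (r : R) (P V A B : R -> R -> R -> R) (m : R -> R -> R).
Hypothesis Hr : 0 < r <= 2.01.
Hypothesis Hf : forall beta b, 0 <= beta <= 1 -> 1 <= b <= 4 ->
  family r beta b (P beta b) (V beta b) (A beta b) (B beta b).
Hypothesis Hm : forall beta b, 0 < beta <= 1 / 10000 -> 1 <= b <= 4 ->
  left_spec beta b (P beta b) (V beta b) (A beta b) (B beta b) (m beta b).

Let Hf0 b (Hb : 1 <= b <= 4) : family r 0 b (P 0 b) (V 0 b) (A 0 b) (B 0 b).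
Proof. apply Hf; lra. Qed.

(** [hits] and [turns] are open, disjoint, and hold at the two ends; the inequality 1.6831 < h0 is
    strict because 1.6831 itself hits. *)
Lemma critical_field : exists h0, 1.6831 < h0 < 3 /\ ~ hits (P 0 h0) /\ ~ turns (V 0 h0).
Proof.
  assert (Hlip : forall t, 0 <= t -> exists C, 1 <= C /\ forall b b', 1 <= b <= 4 -> 1 <= b' <= 4 ->
    Rabs (P 0 b t - P 0 b' t) <= C * Rabs (b - b') /\
    Rabs (V 0 b t - V 0 b' t) <= C * Rabs (b - b')).
  { intros t Ht. destruct (family_dep t Ht) as [C [HC H]]. exists C. split; [exact HC|].
    intros b b' Hb Hb'.
    destruct (H r 0 0 b b' _ _ _ _ _ _ _ _ Hr ltac:(lra) ltac:(lra) Hb Hb'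
      (Hf0 b Hb) (Hf0 b' Hb') t) as [H1 [H2 _]]; [rewrite Rabs_pos_eq; lra|].
    rewrite Rminus_diag, Rabs_R0, Rplus_0_l in H1, H2. auto. }
  destruct (interval_connected 1.6831 3 (fun b => hits (P 0 b)) (fun b => turns (V 0 b)))
    as [h0 [Hh [Hn1 Hn2]]].
  - lra.
  - intros b Hb [t [Ht HP]]. destruct (Hlip t Ht) as [C [HC H]].
    exists (- P 0 b t / C). split; [apply Rdiv_lt_0_compat; lra|].
    intros b' Hb' Hbb. exists t. split; [exact Ht|].
    destruct (H b' b ltac:(lra) ltac:(lra)) as [H1 _]. apply Rabs_le_between in H1.
    apply Rmult_lt_compat_l with (r := C) in Hbb; [|lra].
    replace (C * (- P 0 b t / C)) with (- P 0 b t) in Hbb by (field; lra). lra.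
  - intros b Hb [t [Ht HV]]. destruct (Hlip t Ht) as [C [HC H]].
    exists (V 0 b t / C). split; [apply Rdiv_lt_0_compat; lra|].
    intros b' Hb' Hbb. exists t. split; [exact Ht|].
    destruct (H b' b ltac:(lra) ltac:(lra)) as [_ H1]. apply Rabs_le_between in H1.
    apply Rmult_lt_compat_l with (r := C) in Hbb; [|lra].
    replace (C * (V 0 b t / C)) with (V 0 b t) in Hbb by (field; lra). lra.
  - apply (hits_small r 1.6831 _ _ _ _ Hr ltac:(lra) (Hf0 1.6831 ltac:(lra))). lra.
  - apply (turns_large r 3 _ _ _ _ Hr ltac:(lra) (Hf0 3 ltac:(lra))). lra.
  - intros b Hb. exact (not_hits_and_turns r b _ _ _ _ Hr ltac:(lra) (Hf0 b ltac:(lra))).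
  - exists h0. split; [|auto]. split.
    + destruct (proj1 Hh) as [H | H]; [exact H|]. exfalso. apply Hn1. rewrite <- H.
      apply (hits_small r 1.6831 _ _ _ _ Hr ltac:(lra) (Hf0 1.6831 ltac:(lra))). lra.
    + destruct (proj2 Hh) as [H | H]; [exact H|]. exfalso. apply Hn2. rewrite H.
      apply (turns_large r 3 _ _ _ _ Hr ltac:(lra) (Hf0 3 ltac:(lra))). lra.
Qed.

Variable h0 : R.
Hypothesis Hh0 : 1.6831 < h0 < 3.
Hypothesis Hhits : ~ hits (P 0 h0).
Hypothesis Hturns : ~ turns (V 0 h0).

(** The weak bound on b suffices for h > 1.6831, since h = A'(-m) > b by [left_spec]. *)
Definition admissible (beta b : R) : Prop :=
  1.6831 <= b <= 4 /\ exists M, right_spec (P beta b) (V beta b) (B beta b) (m beta b) M.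

(** By [rescaled_exclusion] every b below h0 hits and every b above it turns. For one b on each side
    the behaviour is witnessed at a finite time, hence persists for small beta, and shooting between
    them applies. *)
Lemma admissible_near (e : R) : 0 < e -> exists d, 0 < d <= 1 / 10000 /\
  forall beta, 0 < beta < d -> exists b, Rabs (b - h0) <= e /\ admissible beta b.
Proof.
  intros He.
  set (b1 := Rmax 1.6831 (h0 - e)). set (b2 := h0 + Rmin e 1).
  assert (Hb1 : 1.6831 <= b1 < h0).
  { unfold b1. split; [apply Rmax_l | apply Rmax_lub_lt; lra]. }
  assert (Hb1e : h0 - e <= b1) by apply Rmax_r.
  assert (Hmin : 0 < Rmin e 1) by (apply Rmin_glb_lt; lra).
  assert (Hb2 : h0 < b2 <= 4) by (unfold b2; pose proof (Rmin_r e 1); lra).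
  assert (Hb2e : b2 <= h0 + e) by (unfold b2; pose proof (Rmin_l e 1); lra).
  assert (Hb1r : 1 <= b1 <= 4) by lra. assert (Hb2r : 1 <= b2 <= 4) by lra.
  assert (Hh0r : 1 <= h0 <= 4) by lra.
  assert (Hhit1 : hits (P 0 b1)).
  { apply NNPP. intros Hn.
    exact (rescaled_exclusion r b1 h0 _ _ _ _ _ _ _ _ Hr Hb1r Hh0r (proj2 Hb1)
      (Hf0 b1 Hb1r) (Hf0 h0 Hh0r) Hn Hturns). }
  assert (Hturn2 : turns (V 0 b2)).
  { apply NNPP. intros Hn.
    exact (rescaled_exclusion r h0 b2 _ _ _ _ _ _ _ _ Hr Hh0r Hb2r (proj1 Hb2)
      (Hf0 h0 Hh0r) (Hf0 b2 Hb2r) Hhits Hn). }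
  destruct (hits_decreasing r b1 _ _ _ _ Hr Hb1r (Hf0 b1 Hb1r) Hhit1)
    as [t1 [Ht1 [HP1 HV1]]].
  destruct (turns_virial r b2 _ _ _ _ Hr Hb2r (Hf0 b2 Hb2r) Hturn2)
    as [t2 [Ht2 [HY2 [HV2 HP2]]]].
  destruct (family_dep (Rmax t1 t2)) as [C [HC Hdep]].
  { pose proof (Rmax_l t1 t2). lra. }
  assert (Hclose : forall beta b t, 0 <= beta <= 1 -> 1 <= b <= 4 -> 0 <= t <= Rmax t1 t2 ->
    Rabs (P beta b t - P 0 b t) <= C * beta /\ Rabs (V beta b t - V 0 b t) <= C * beta /\
    Rabs (A beta b t - A 0 b t) <= C * beta).
  { intros beta b t Hbe Hb Ht.
    destruct (Hdep r beta 0 b b _ _ _ _ _ _ _ _ Hr Hbe ltac:(lra) Hb Hb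
      (Hf beta b Hbe Hb) (Hf0 b Hb) t) as [D1 [D2 [D3 _]]]; [rewrite Rabs_pos_eq; lra|].
    rewrite Rminus_diag, Rabs_R0, Rplus_0_r, Rminus_0_r, (Rabs_pos_eq beta) in D1, D2, D3 by lra.
    auto. }
  clear Hdep. pose proof (Rmax_l t1 t2) as Hm1. pose proof (Rmax_r t1 t2) as Hm2.
  assert (HcV : forall b t, 1 <= b <= 4 -> continuity_pt (fun t => - V 0 b t) t).
  { intros b t Hb. apply continuity_pt_opp.
    eapply is_derive_continuity_pt, (dV r 0 b _ _ _ _ (Hf0 b Hb)). }
  destruct (compact_positive (fun t => - V 0 b1 t) (1 / 8) t1) as [mu1 [Hmu1 Hpos1]];
    [lra | auto | intros t Ht; specialize (HV1 t ltac:(lra)); lra |].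
  destruct (compact_positive (fun t => - V 0 b2 t) (1 / 8) t2) as [mu2 [Hmu2 Hpos2]];
    [lra | auto | intros t Ht; specialize (HV2 t ltac:(lra)); lra |].
  destruct (compact_positive (P 0 b2) (1 / 8) t2) as [mu3 [Hmu3 Hpos3]];
    [lra | | intros t Ht; apply HP2; lra |].
  { intros t _. eapply is_derive_continuity_pt, (dP r 0 b2 _ _ _ _ (Hf0 b2 Hb2r)). }
  destruct (virial_close (P 0 b2 t2) (V 0 b2 t2) (A 0 b2 t2)) as [K [HK Hvc]].
  set (Y := virial 0 (P 0 b2) (V 0 b2) (A 0 b2) t2) in *.
  set (mu := Rmin (Rmin (- P 0 b1 t1) mu1) (Rmin mu2 mu3)).
  assert (Hmu : 0 < mu) by (unfold mu; repeat apply Rmin_glb_lt; lra).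
  assert (Hmua : mu <= - P 0 b1 t1) by (eapply Rle_trans; [apply Rmin_l | apply Rmin_l]).
  assert (Hmub : mu <= mu1) by (eapply Rle_trans; [apply Rmin_l | apply Rmin_r]).
  assert (Hmuc : mu <= mu2) by (eapply Rle_trans; [apply Rmin_r | apply Rmin_l]).
  assert (Hmud : mu <= mu3) by (eapply Rle_trans; [apply Rmin_r | apply Rmin_r]).
  (* The bound 1/C makes [virial_close] applicable, mu/C preserves the signs of P and V, and the
     last bound keeps Y above 3 beta after a loss of K C beta. *)
  set (d := Rmin (Rmin (1 / 10000) (1 / C)) (Rmin (mu / C) (Y / (K * C + 3)))).
  assert (HKC : 0 <= K * C) by (apply Rmult_le_pos; lra).
  assert (Hd : 0 < d).
  { unfold d. repeat apply Rmin_glb_lt; try lra; apply Rdiv_lt_0_compat; lra. }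
  assert (Hd1 : d <= 1 / 10000) by (eapply Rle_trans; [apply Rmin_l | apply Rmin_l]).
  assert (Hd2 : d <= 1 / C) by (eapply Rle_trans; [apply Rmin_l | apply Rmin_r]).
  assert (Hd3 : d <= mu / C) by (eapply Rle_trans; [apply Rmin_r | apply Rmin_l]).
  assert (Hd4 : d <= Y / (K * C + 3)) by (eapply Rle_trans; [apply Rmin_r | apply Rmin_r]).
  exists d. split; [lra|]. intros beta Hbe.
  assert (Hbe1 : 0 <= beta <= 1) by lra.
  assert (H100 : 0 <= beta <= 1 / 100) by lra.
  assert (HCb : C * beta < mu).
  { apply Rmult_lt_reg_r with (/ C); [apply Rinv_0_lt_compat; lra|].
    replace (C * beta * / C) with beta by (field; lra). unfold Rdiv in Hd3. lra. }
  assert (HCb1 : 0 <= C * beta <= 1).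
  { split; [apply Rmult_le_pos; lra|].
    apply Rmult_le_reg_r with (/ C); [apply Rinv_0_lt_compat; lra|].
    replace (C * beta * / C) with beta by (field; lra). unfold Rdiv in Hd2. lra. }
  assert (HYb : (K * C + 3) * beta < Y).
  { apply Rmult_lt_reg_r with (/ (K * C + 3)); [apply Rinv_0_lt_compat; lra|].
    replace ((K * C + 3) * beta * / (K * C + 3)) with beta by (field; lra).
    unfold Rdiv in Hd4. lra. }
  assert (HVn : forall b t0 mu', 1 <= b <= 4 -> t0 <= Rmax t1 t2 -> mu <= mu' ->
      (forall t, 1 / 8 <= t <= t0 -> mu' <= - V 0 b t) ->
      forall t, 0 < t <= t0 -> V beta b t < 0).
  { intros b t0 mu' Hb Ht0 Hmu' Hpos t Ht.
    destruct (Rle_lt_dec t (1 / 8)) as [Hle | Hlt].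
    - apply (V_neg_early r beta b _ _ _ _ Hr H100 Hb (Hf beta b Hbe1 Hb)). lra.
    - destruct (Hclose beta b t Hbe1 Hb ltac:(lra)) as [_ [D _]].
      apply Rabs_le_between in D. specialize (Hpos t ltac:(lra)). lra. }
  (* T grows as beta decreases, but t1, t2 and hence [d] do not depend on beta. The added 1 makes t1
     < T strict. *)
  set (T := Rmax (Rmax 16 (7680 / beta)) (Rmax t1 t2) + 1).
  assert (HT1 : 16 <= T).
  { unfold T. pose proof (Rmax_l (Rmax 16 (7680 / beta)) (Rmax t1 t2)).
    pose proof (Rmax_l 16 (7680 / beta)). lra. }
  assert (HT2 : 7680 / beta <= T).
  { unfold T. pose proof (Rmax_l (Rmax 16 (7680 / beta)) (Rmax t1 t2)).
    pose proof (Rmax_r 16 (7680 / beta)). lra. }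
  assert (HT3 : Rmax t1 t2 < T).
  { unfold T. pose proof (Rmax_r (Rmax 16 (7680 / beta)) (Rmax t1 t2)). lra. }
  destruct (shooting r beta (P beta) (V beta) (A beta) (B beta) (m beta) Hr ltac:(lra)
    (fun b => Hf beta b Hbe1) (fun b => Hm beta b ltac:(lra)) T HT1 HT2 b1 b2 t1 t2)
    as [b [M [Hb HM]]]; try lra.
  - apply (HVn b1 t1 mu1 Hb1r Hm1 Hmub Hpos1).
  - destruct (Hclose beta b1 t1 Hbe1 Hb1r ltac:(lra)) as [D _].
    apply Rabs_le_between in D. lra.
  - apply (HVn b2 t2 mu2 Hb2r Hm2 Hmuc Hpos2).
  - intros s Hs. destruct (Rle_lt_dec s (1 / 8)) as [Hle | Hlt].
    + pose proof (P_early r beta b2 _ _ _ _ Hb2r (Hf beta b2 Hbe1 Hb2r) s ltac:(lra)). lra.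
    + destruct (Hclose beta b2 s Hbe1 Hb2r ltac:(lra)) as [D _].
      apply Rabs_le_between in D. specialize (Hpos3 s ltac:(lra)). lra.
  - destruct (Hclose beta b2 t2 Hbe1 Hb2r ltac:(lra)) as [D1 [D2 D3]].
    specialize (Hvc (C * beta) _ _ _ HCb1 D1 D2 D3).
    assert (HYe : Y = P 0 b2 t2 ^ 2 * (A 0 b2 t2 ^ 2 - 1) - V 0 b2 t2 ^ 2)
      by (unfold Y, virial; field).
    unfold virial.
    assert (0 <= beta ^ 2 * P beta b2 t2 ^ 4 / 2).
    { replace (P beta b2 t2 ^ 4) with ((P beta b2 t2 ^ 2) ^ 2) by ring.
      pose proof (pow2_ge_0 (P beta b2 t2 ^ 2)). pose proof (pow2_ge_0 beta).
      assert (0 <= beta ^ 2 * (P beta b2 t2 ^ 2) ^ 2) by (apply Rmult_le_pos; lra). lra. }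
    replace (K * (C * beta)) with (K * C * beta) in Hvc by ring. lra.
  - exists b. split; [apply Rabs_le; lra|]. split; [lra|]. exists M. exact HM.
Qed.

(** At h0 and beta = 0 the slope V is bounded away from 0 on [1/8, K1], so nearby trajectories have
    no zero of V there, and [right_spec] places M beyond 1/8. *)
Lemma M_large (K : R) : exists d, 0 < d /\ forall beta b M, 0 < beta < d ->
  Rabs (b - h0) < d -> 1 <= b <= 4 ->
  right_spec (P beta b) (V beta b) (B beta b) (m beta b) M -> K < M.
Proof.
  assert (Hh0r : 1 <= h0 <= 4) by lra.
  set (K1 := Rmax K 1). assert (HK1 : 1 <= K1) by apply Rmax_r.
  assert (HKK1 : K <= K1) by apply Rmax_l.
  destruct (compact_positive (fun t => - V 0 h0 t) (1 / 8) K1) as [mu [Hmu Hpos]]; [lra | | |].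
  { intros t _. apply continuity_pt_opp.
    eapply is_derive_continuity_pt, (dV r 0 h0 _ _ _ _ (Hf0 h0 Hh0r)). }
  { intros t Ht.
    pose proof (limit_V_neg_all r h0 _ _ _ _ Hr Hh0r (Hf0 h0 Hh0r) Hhits Hturns t ltac:(lra)). lra. }
  destruct (family_dep K1 ltac:(lra)) as [C [HC Hdep]].
  set (d := Rmin 1 (mu / (2 * C))).
  assert (Hd : 0 < d) by (unfold d; apply Rmin_glb_lt; [lra | apply Rdiv_lt_0_compat; lra]).
  assert (Hd1 : d <= 1) by apply Rmin_l.
  assert (Hd2 : d <= mu / (2 * C)) by apply Rmin_r.
  exists d. split; [exact Hd|]. intros beta b M Hbe Hbb Hb [HM8 [HVM _]].
  apply Rnot_le_lt. intros HMK.
  destruct (Hdep r beta 0 b h0 _ _ _ _ _ _ _ _ Hr ltac:(lra) ltac:(lra) Hb Hh0r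
    (Hf beta b ltac:(lra) Hb) (Hf0 h0 Hh0r) M) as [_ [D _]]; [rewrite Rabs_pos_eq; lra|].
  rewrite Rminus_0_r, (Rabs_pos_eq beta), HVM in D by lra.
  specialize (Hpos M ltac:(lra)). apply Rabs_le_between in D.
  assert (C * (beta + Rabs (b - h0)) < C * (2 * (mu / (2 * C))))
    by (apply Rmult_lt_compat_l; lra).
  replace (C * (2 * (mu / (2 * C)))) with mu in H by (field; lra). lra.
Qed.

Lemma solution_of_specs beta b M : 0 < beta <= 1 / 10000 -> 1 <= b <= 4 ->
  right_spec (P beta b) (V beta b) (B beta b) (m beta b) M ->
  GL_solution r beta (m beta b) M (B beta b (- m beta b))
    (P beta b) (V beta b) (A beta b) (B beta b).
Proof.
  intros Hbe Hb [HM8 [HVM [_ [HPM HBM]]]].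
  assert (Hfb := Hf beta b ltac:(lra) Hb).
  destruct (Hm beta b Hbe Hb) as [[Hm1 Hm2] [_ [_ [HPm _]]]].
  assert (HP : forall t, - m beta b <= t <= M -> 0 < P beta b t <= 1).
  { intros t Ht. destruct (Rle_lt_dec t 0) as [Hle | Hlt].
    - specialize (HPm t ltac:(lra)). lra.
    - apply HPM. lra. }
  split; auto.
  - eapply deriv_on_of_is_derive; [intros; apply (dP r beta b _ _ _ _ Hfb) | reflexivity].
  - eapply deriv_on_of_is_derive; [intros; apply (dV r beta b _ _ _ _ Hfb)|].
    intros t Ht. unfold potential. rewrite clip_id by (specialize (HP t Ht); lra). reflexivity.
  - eapply deriv_on_of_is_derive; [intros; apply (dA r beta b _ _ _ _ Hfb) | reflexivity].
  - eapply deriv_on_of_is_derive; [intros; apply (dB r beta b _ _ _ _ Hfb)|].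
    intros t Ht. cbv beta. rewrite clip_id by (specialize (HP t Ht); lra). reflexivity.
  - intros t Ht. apply HP, Ht.
Qed.

End Assembly.

Theorem theorem2 (r : R) (hr : 0 < r <= 2.01) :
  exists beta0 : R, 0 < beta0 /\
  exists (m M h : R -> R) (psi psi' A A' : R -> R -> R),
    (forall beta : R, 0 < beta < beta0 ->
       0 < m beta /\ 0 < M beta /\ 1.6831 < h beta /\
       GL_solution r beta (m beta) (M beta) (h beta)
         (psi beta) (psi' beta) (A beta) (A' beta) /\
       (forall t : R, - m beta < t < 0 -> 0 < psi' beta t) /\
       psi' beta 0 = 0 /\
       psi beta 0 = 1 /\
       (forall t : R, 0 < t < M beta -> psi' beta t < 0)) /\
    filterlim m (at_right 0) (locally 0) /\
    filterlim M (at_right 0) (Rbar_locally p_infty) /\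
    exists h0 : R, 1.6831 < h0 /\
      filterlim (fun beta => A' beta (- m beta)) (at_right 0) (locally h0).
Proof.
  (* The choice is made over all pairs (beta, b); outside the parameter range the zero functions are
     dummies. *)
  assert (HY : forall p : R * R, exists Y : (R -> R) * (R -> R) * (R -> R) * (R -> R),
    let '(P, V, A, B) := Y in
    0 <= fst p <= 1 -> 1 <= snd p <= 4 -> family r (fst p) (snd p) P V A B).
  { intros [beta b]. simpl fst. simpl snd.
    destruct (classic (0 <= beta <= 1 /\ 1 <= b <= 4)) as [[Hbe Hb] | Hn].
    - destruct (global_flow r (beta ^ 2) (beta - 1) b hr) as [P [V [A [B H]]]]; [nra | lra | lra |].
      exists (P, V, A, B). auto.
    - exists (fun _ => 0, fun _ => 0, fun _ => 0, fun _ => 0). tauto. }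
  apply choice in HY. destruct HY as [Y HY].
  pose (P := fun beta b => fst (fst (fst (Y (beta, b))))).
  pose (V := fun beta b => snd (fst (fst (Y (beta, b))))).
  pose (A := fun beta b => snd (fst (Y (beta, b)))).
  pose (B := fun beta b => snd (Y (beta, b))).
  assert (Hf : forall beta b, 0 <= beta <= 1 -> 1 <= b <= 4 ->
    family r beta b (P beta b) (V beta b) (A beta b) (B beta b)).
  { intros beta b Hbe Hb. specialize (HY (beta, b)). unfold P, V, A, B.
    destruct (Y (beta, b)) as [[[P1 V1] A1] B1]. exact (HY Hbe Hb). }
  clearbody P V A B. clear HY Y.
  assert (Hmex : forall p : R * R, exists m, 0 < fst p <= 1 / 10000 -> 1 <= snd p <= 4 ->
    left_spec (fst p) (snd p) (P (fst p) (snd p)) (V (fst p) (snd p)) (A (fst p) (snd p))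
      (B (fst p) (snd p)) m).
  { intros [beta b]. simpl fst. simpl snd.
    destruct (classic (0 < beta <= 1 / 10000 /\ 1 <= b <= 4)) as [[Hbe Hb] | Hn].
    - destruct (left_endpoint r beta b _ _ _ _ hr Hbe Hb (Hf beta b ltac:(lra) Hb)) as [m Hm].
      exists m. intros _ _. exact Hm.
    - exists 0. tauto. }
  apply choice in Hmex. destruct Hmex as [mp Hmp].
  assert (Hm : forall beta b, 0 < beta <= 1 / 10000 -> 1 <= b <= 4 ->
    left_spec beta b (P beta b) (V beta b) (A beta b) (B beta b) (mp (beta, b)))
    by (intros beta b; exact (Hmp (beta, b))).
  pose (m := fun beta b => mp (beta, b)).
  change (forall beta b, 0 < beta <= 1 / 10000 -> 1 <= b <= 4 ->
    left_spec beta b (P beta b) (V beta b) (A beta b) (B beta b) (m beta b)) in Hm.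
  clearbody m. clear mp Hmp.
  destruct (critical_field r P V A B hr Hf) as [h0 [Hh0 [Hhits Hturns]]].
  assert (Hnear := admissible_near r P V A B m hr Hf Hm h0 Hh0 Hhits Hturns).
  assert (Hlarge := M_large r P V A B m hr Hf h0 Hh0 Hhits Hturns).
  destruct (Hnear 1 ltac:(lra)) as [beta0 [Hbeta0 Hex]].
  exists beta0. split; [lra|].
  (* Besides admissibility, b is almost closest to h0. As [Hnear] provides admissible values within
     any e for small beta, this forces b to tend to h0. *)
  assert (Hsel : forall beta, exists bM : R * R, 0 < beta < beta0 ->
    1.6831 <= fst bM <= 4 /\
    right_spec (P beta (fst bM)) (V beta (fst bM)) (B beta (fst bM)) (m beta (fst bM)) (snd bM) /\
    forall b', admissible P V B m beta b' -> Rabs (fst bM - h0) <= Rabs (b' - h0) + beta).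
  { intros beta. destruct (Rlt_le_dec 0 beta) as [H0 | H0]; [|exists (0, 0); lra].
    destruct (Rlt_le_dec beta beta0) as [H1 | H1]; [|exists (0, 0); lra].
    destruct (near_minimizer (admissible P V B m beta) h0 beta) as [b [[Hb [M HM]] Hmin]]; [|exact H0|].
    - destruct (Hex beta (conj H0 H1)) as [b [_ Hb]]. exists b. exact Hb.
    - exists (b, M). auto. }
  apply choice in Hsel. destruct Hsel as [bM Hsel].
  pose (b := fun beta => fst (bM beta)). pose (M := fun beta => snd (bM beta)).
  assert (Hb : forall beta, 0 < beta < beta0 -> 1.6831 <= b beta <= 4)
    by (intros beta H; apply (Hsel beta H)).
  assert (HM : forall beta, 0 < beta < beta0 -> right_spec (P beta (b beta)) (V beta (b beta))
    (B beta (b beta)) (m beta (b beta)) (M beta)) by (intros beta H; apply (Hsel beta H)).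
  assert (Hmin : forall beta, 0 < beta < beta0 -> forall b', admissible P V B m beta b' ->
    Rabs (b beta - h0) <= Rabs (b' - h0) + beta) by (intros beta H; apply (Hsel beta H)).
  clearbody b M. clear Hsel bM.
  assert (Hbh : forall e, 0 < e -> exists d, 0 < d <= beta0 /\ forall beta, 0 < beta < d ->
            Rabs (b beta - h0) < e).
  { intros e He. destruct (Hnear (e / 2) ltac:(lra)) as [d [Hd H]].
    exists (Rmin (Rmin d beta0) (e / 2)). split.
    - split; [repeat apply Rmin_glb_lt; lra|].
      eapply Rle_trans; [apply Rmin_l | apply Rmin_r].
    - intros beta Hbe.
      assert (Hdb : beta < Rmin d beta0) by (eapply Rlt_le_trans; [apply Hbe | apply Rmin_l]).
      assert (beta < e / 2) by (eapply Rlt_le_trans; [apply Hbe | apply Rmin_r]).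
      assert (beta < d) by (eapply Rlt_le_trans; [exact Hdb | apply Rmin_l]).
      assert (beta < beta0) by (eapply Rlt_le_trans; [exact Hdb | apply Rmin_r]).
      destruct (H beta ltac:(lra)) as [b' [Hb'1 Hb'2]].
      specialize (Hmin beta ltac:(lra) b' Hb'2). lra. }
  (* The applied field h is A'(-m), which exceeds the shooting parameter b = A'(0) by at most beta^2
     and so has the same limit. *)
  exists (fun beta => m beta (b beta)), M, (fun beta => B beta (b beta) (- m beta (b beta))),
    (fun beta => P beta (b beta)), (fun beta => V beta (b beta)),
    (fun beta => A beta (b beta)), (fun beta => B beta (b beta)).
  split; [|split; [|split]].
  - intros beta Hbe. specialize (Hb beta Hbe). specialize (HM beta Hbe).
    assert (Hbe1 : 0 < beta <= 1 / 10000) by lra.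
    destruct (Hm beta (b beta) Hbe1 ltac:(lra)) as [[Hm1 _] [Hm2 [_ [_ [_ HB]]]]].
    destruct (family_0 r beta (b beta) _ _ _ _ (Hf beta (b beta) ltac:(lra) ltac:(lra)))
      as [P0 [V0 _]].
    assert (HS := solution_of_specs r P V A B m Hf Hm beta (b beta) (M beta) Hbe1 ltac:(lra) HM).
    destruct HM as [HM8 [_ [HMV _]]].
    split; [lra|]. split; [lra|]. split; [lra|]. split; [exact HS|].
    split; [exact Hm2|]. split; [exact V0|]. split; [exact P0 | exact HMV].
  - apply filterlim_locally. intros eps. apply at_right_0.
    exists (Rmin beta0 (eps / 3)). split.
    { apply Rmin_glb_lt; [lra|]. pose proof (cond_pos eps). lra. }
    intros beta Hbe.
    assert (beta < beta0) by (eapply Rlt_le_trans; [apply Hbe | apply Rmin_l]).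
    assert (beta < eps / 3) by (eapply Rlt_le_trans; [apply Hbe | apply Rmin_r]).
    specialize (Hb beta ltac:(lra)).
    destruct (Hm beta (b beta) ltac:(lra) ltac:(lra)) as [[Hm1 _] _].
    change (Rabs (m beta (b beta) - 0) < eps). rewrite Rminus_0_r, Rabs_pos_eq; lra.
  - intros Q [K HQ]. apply at_right_0.
    destruct (Hlarge K) as [d [Hd H]]. destruct (Hbh d Hd) as [d' [Hd' Hb']].
    exists (Rmin d d'). split; [apply Rmin_glb_lt; lra|]. intros beta Hbe.
    assert (beta < d) by (eapply Rlt_le_trans; [apply Hbe | apply Rmin_l]).
    assert (beta < d') by (eapply Rlt_le_trans; [apply Hbe | apply Rmin_r]).
    specialize (Hb beta ltac:(lra)).
    apply HQ, (H beta (b beta)); [lra | apply Hb'; lra | lra | apply HM; lra].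
  - exists h0. split; [lra|].
    apply filterlim_locally. intros eps. apply at_right_0.
    destruct (Hbh (eps / 2)) as [d [Hd H]]; [pose proof (cond_pos eps); lra|].
    exists (Rmin d (eps / 2)). split.
    { apply Rmin_glb_lt; [lra|]. pose proof (cond_pos eps). lra. }
    intros beta Hbe.
    assert (beta < d) by (eapply Rlt_le_trans; [apply Hbe | apply Rmin_l]).
    assert (beta < eps / 2) by (eapply Rlt_le_trans; [apply Hbe | apply Rmin_r]).
    specialize (Hb beta ltac:(lra)). specialize (H beta ltac:(lra)).
    destruct (Hm beta (b beta) ltac:(lra) ltac:(lra)) as [_ [_ [_ [_ [_ HB]]]]].
    change (Rabs (B beta (b beta) (- m beta (b beta)) - h0) < eps).
    assert (beta ^ 2 <= beta) by nra.
    apply Rabs_lt_between in H. apply Rabs_lt_between. lra.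
Qed.
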